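(* Let $n\ge 3$ and let $X\subset\mathbb{P}^n$ be a general hypersurface of degree at least $3$ (that is, for each degree $d\ge 3$, a general member of the family of hypersurfaces of degree $d$). Let $\mathcal{P}_X\subset\mathbb{P}^*(\mathcal{T}_{\mathbb{P}^n})$ be its conormal variety and let $\vartheta\colon\mathbb{P}^*(\mathcal{T}_{\mathbb{P}^n})\dashrightarrow\mathbb{P}^{2n-1}$ be the birational isomorphism defined in the context. Then the proper image $C=\vartheta(\mathcal{P}_X)\subset\mathbb{P}^{2n-1}$ is an $(n-1)$-dimensional subvariety such that $\dim\operatorname{Osc}^2_xC=2n-2$ for general $x\in C$, $C$ is not contained in a hyperplane, and the osculating dual $C^\vee\subset(\mathbb{P}^{2n-1})^*$ is projectively equivalent to $C$.
   Context: The base field is $\mathbb{C}$. ''General'' means: for all members of a non-empty Zariski open subset of the parameter space. $\mathbb{P}^*(\mathcal{T}_{\mathbb{P}^n})$ denotes the incidence variety $\{(x,H)\in\mathbb{P}^n\times(\mathbb{P}^n)^*\colon x\in H\}$, i.e. $\{((x_0:\ldots:x_n),(y_0:\ldots:y_n))\colon \sum_i x_iy_i=0\}$, where $(x_0:\ldots:x_n)$ are homogeneous coordinates in $\mathbb{P}^n$ and $(y_0:\ldots:y_n)$ the dual homogeneous coordinates in $(\mathbb{P}^n)^*$. For a subvariety $Y\subset\mathbb{P}^n$ the conormal variety $\mathcal{P}_Y$ is the closure in $\mathbb{P}^*(\mathcal{T}_{\mathbb{P}^n})$ of the set of pairs $(y,H)$ such that $y$ is a smooth point of $Y$ and the hyperplane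 $H$ is tangent to $Y$ at $y$ (contains the embedded tangent space $T_yY$). The rational map $\vartheta\colon\mathbb{P}^*(\mathcal{T}_{\mathbb{P}^n})\dashrightarrow\mathbb{P}^{2n-1}$ sends $((x_0:\ldots:x_n),(y_0:\ldots:y_n))$ to $(z_0:\ldots:z_{2n-1})$ with $z_0=x_0y_1$, $z_1=\frac12(x_1y_1-x_0y_0)$, and $z_{2k-2}=x_ky_1$, $z_{2k-1}=-\frac12x_0y_k$ for $2\le k\le n$. It is a birational isomorphism, and it induces an isomorphism between the open subset $\{x_0\ne0,\ y_1\ne0\}$ of $\mathbb{P}^*(\mathcal{T}_{\mathbb{P}^n})$ and the open subset $\{z_0\ne0\}$ of $\mathbb{P}^{2n-1}$. The proper image $\vartheta(\mathcal{P}_X)$ is the closure of the image under $\vartheta$ of the intersection of $\mathcal{P}_X$ with the domain of definition of $\vartheta$. Osculating spaces: if $Y\subset\mathbb{P}^N$ is a projective variety and $x\in Y$ a non-singular point, a hyperplane $H$ osculates to $Y$ at $x$ to order $s$ if $x\in H$ and the local equation of $H\cap Y$ in the local ring $\mathcal{O}_{x,Y}$ lies in $\mathfrak{m}_x^{s+1}$. $\operatorname{Osc}^s_xY$ is the intersection of all hyperplanes osculating to $Y$ at $x$ to order $s$ (the linear span of $Y$ if there are none). If $Y\subset\mathbb{P}^{2n-1}$ is an $(n-1)$-dimensional projective variety not contained in a hyperplane and $\operatorname{Osc}^2_xY$ is a hyperplane for general $x\in Y$, then its osculating dual $Y^\vee\subset(\mathbb{P}^{2n-1})^*$ is the closure of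 the set of points corresponding to the hyperplanes $\operatorname{Osc}^2_xY$ for general $x\in Y$. $Y$ and $Y^\vee$ are projectively equivalent if there is a projective (linear) isomorphism $\mathbb{P}^{2n-1}\to(\mathbb{P}^{2n-1})^*$ mapping $Y$ onto $Y^\vee$. *)

(* Defs.v *)
From mathcomp Require Import all_boot all_order all_algebra.
From mathcomp Require Import complex.
From mathcomp Require Import boolp classical_sets reals.
From mathcomp Require Import mpoly.

Set Implicit Arguments.
Unset Strict Implicit.
Unset Printing Implicit Defensive.

Import GRing.Theory.

Local Open Scope classical_set_scope.
Local Open Scope ring_scope.

(* A subset of the projective space P^(N-1) is given by its vectors of        *)
(* homogeneous coordinates, i.e. by a set of nonzero row vectors of length N. *)
(* The dual projective space uses the dual coordinates: the point h of the    *)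
(* dual space is the hyperplane  \sum_i h_i z_i = 0.                          *)

Section ProjectiveSets.
Variables (F : fieldType) (N : nat).
Implicit Types (S Y Z U : set 'rV[F]_N) (x v h : 'rV[F]_N).

Definition proj_space : set 'rV[F]_N := [set v : 'rV[F]_N | v != 0].

Definition ev (f : {mpoly F[N]}) v : F := f.@[v 0].

Definition pairing h v : F := \sum_i h 0 i * v 0 i.

Definition hyperplane h : set 'rV[F]_N :=
  [set v : 'rV[F]_N | v != 0 /\ pairing h v = 0].

Definition zclosed Z : Prop :=
  exists E : set {mpoly F[N]},
    (forall f, E f -> exists d, f \is d.-homog) /\
    Z = [set v | v != 0 /\ forall f, E f -> ev f v = 0].

Definition zopen U : Prop := exists2 Z, zclosed Z & U = proj_space `\` Z.

Definition zclosure S : set 'rV[F]_N :=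
  [set v : 'rV[F]_N | forall Z, zclosed Z -> S `<=` Z -> Z v].

Definition irreducible Y : Prop :=
  Y !=set0 /\
  forall Z1 Z2, zclosed Z1 -> zclosed Z2 ->
    Y `<=` Z1 `|` Z2 -> Y `<=` Z1 \/ Y `<=` Z2.

Definition variety Y : Prop := zclosed Y /\ irreducible Y.

Definition general Y (P : 'rV[F]_N -> Prop) : Prop :=
  exists U, [/\ zopen U, Y `&` U !=set0 & forall v, Y v -> U v -> P v].

Definition vanishing_ideal Y : set {mpoly F[N]} :=
  [set f | forall v, Y v -> ev f v = 0].

(* There are k algebraically independent rational functions f_i / g_i on Y.   *)
Definition has_alg_indep Y (k : nat) : Prop :=
  exists (e : 'I_k -> nat) (f g : 'I_k -> {mpoly F[N]}),
    (forall i, f i \is (e i).-homog /\ g i \is (e i).-homog) /\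
    forall P : {mpoly F[k]}, P != 0 ->
      exists y, [/\ Y y, forall i, ev (g i) y != 0 &
                    P.@[fun i => ev (f i) y / ev (g i) y] != 0].

(* The dimension of a variety is the transcendence degree of its function     *)
(* field (for a reducible closed set, the maximum over its components).       *)
Definition has_dim Y (d : nat) : Prop :=
  has_alg_indep Y d /\ ~ has_alg_indep Y d.+1.

Definition linear_of_dim S (d : nat) : Prop :=
  exists A : 'M[F]_(d.+1, N),
    row_free A /\ S = [set v | v != 0 /\ (v <= A)%MS].

Definition tangent_space Y x : set 'rV[F]_N :=
  [set v : 'rV[F]_N | v != 0 /\
     forall d (f : {mpoly F[N]}), f \is d.-homog -> vanishing_ideal Y f ->
       \sum_i ev (mderiv i f) x * v 0 i = 0].

(* Stated for varieties, or more generally closed sets all of whose           *)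
(* components have the same dimension (hypersurfaces, for instance).          *)
Definition smooth_point Y x : Prop :=
  Y x /\ exists d, has_dim Y d /\ linear_of_dim (tangent_space Y x) d.

(* The local ring O_{x,Y} consists of the germs at x, in the sense of         *)
(* [germ_eq], of the functions that are regular at x.                         *)
Definition germ_eq Y x (phi psi : 'rV[F]_N -> F) : Prop :=
  exists U, [/\ zopen U, U x & forall v, Y v -> U v -> phi v = psi v].

Definition regular_at Y x (phi : 'rV[F]_N -> F) : Prop :=
  exists d (f g : {mpoly F[N]}),
    [/\ f \is d.-homog, g \is d.-homog, ev g x != 0 &
        germ_eq Y x phi (fun v => ev f v / ev g v)].

Definition max_ideal Y x (phi : 'rV[F]_N -> F) : Prop :=
  regular_at Y x phi /\ phi x = 0.

Definition max_ideal_pow Y x (s : nat) (phi : 'rV[F]_N -> F) : Prop :=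
  exists k (c : 'I_k -> 'rV[F]_N -> F) (a : 'I_k -> 'I_s -> 'rV[F]_N -> F),
    [/\ forall i, regular_at Y x (c i),
        forall i j, max_ideal Y x (a i j) &
        germ_eq Y x phi (fun v => \sum_i c i v * \prod_j a i j v)].

(* The local equation at x of the hyperplane h is h / l for a linear form l   *)
(* with l(x) != 0; another choice of l changes it by a unit of O_{x,Y}.       *)
Definition osculates Y x (s : nat) h : Prop :=
  [/\ h != 0, pairing h x = 0 &
      exists2 l, pairing l x != 0 &
        max_ideal_pow Y x s.+1 (fun v => pairing h v / pairing l v)].

(* A hyperplane containing Y osculates to every order, so if no hyperplane    *)
(* osculates then Y spans the projective space, which is also the value of    *)
(* the empty intersection below.                                              *)
Definition osc (s : nat) Y x : set 'rV[F]_N :=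
  [set v : 'rV[F]_N | v != 0 /\ forall h, osculates Y x s h -> hyperplane h v].

Definition not_in_hyperplane Y : Prop :=
  forall h, h != 0 -> ~ Y `<=` hyperplane h.

(* "General x" means that x may be restricted to any nonempty open subset of  *)
(* the variety Y without changing the closure.                                *)
Definition osc_dual Y : set 'rV[F]_N :=
  [set h | forall U, zopen U -> Y `&` U !=set0 ->
     zclosure [set k | k != 0 /\
       exists x, [/\ Y x, U x, smooth_point Y x & osc 2 Y x = hyperplane k]] h].

Definition proj_equivalent Y Z : Prop :=
  exists2 A : 'M[F]_N, A \in unitmx & Z = [set v *m A | v in Y].

End ProjectiveSets.

(* Subsets of P^n x (P^n)^*: sets of pairs (x, y) of nonzero vectors. The     *)
(* bihomogeneous polynomials have the x_i as first and the y_i as last n + 1  *)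
(* variables.                                                                 *)
Section Incidence.
Variables (F : fieldType) (n : nat).
Notation vec := ('rV[F]_n.+1).
Notation bipoly := {mpoly F[n.+1 + n.+1]}.

Definition biev (f : bipoly) (p : vec * vec) : F := f.@[row_mx p.1 p.2 0].

Definition bihomog (a b : nat) (f : bipoly) : Prop :=
  forall m, m \in msupp f ->
    (\sum_(i < n.+1) m (lshift n.+1 i) = a)%N /\
    (\sum_(i < n.+1) m (rshift n.+1 i) = b)%N.

Definition incidence : set (vec * vec) :=
  [set p | [/\ p.1 != 0, p.2 != 0 & pairing p.2 p.1 = 0]].

Definition inc_closed (Z : set (vec * vec)) : Prop :=
  exists E : set bipoly,
    (forall f, E f -> exists a b, bihomog a b f) /\
    Z = [set p | incidence p /\ forall f, E f -> biev f p = 0].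

Definition inc_closure (S : set (vec * vec)) : set (vec * vec) :=
  [set p | forall Z, inc_closed Z -> S `<=` Z -> Z p].

Definition conormal (Y : set vec) : set (vec * vec) :=
  inc_closure [set p | [/\ smooth_point Y p.1, p.2 != 0 &
                           tangent_space Y p.1 `<=` hyperplane p.2]].

(* The rational map on the incidence variety given by forms t of the same     *)
(* bidegree is also given by the forms w, of possibly another bidegree. It is *)
(* defined at p iff some such w does not vanish at p, with value w(p).        *)
Definition same_rational_map N (t w : 'I_N -> bipoly) : Prop :=
  (exists a b, forall i, bihomog a b (w i)) /\
  (forall p, incidence p -> forall i j,
     biev (w i) p * biev (t j) p = biev (w j) p * biev (t i) p).

Definition rational_image N (t : 'I_N -> bipoly) (S : set (vec * vec)) :
    set 'rV[F]_N :=
  [set q | exists p w, [/\ S p, same_rational_map t w, q != 0 &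
                           q = \row_i biev (w i) p]].

Definition proper_image N (t : 'I_N -> bipoly) (S : set (vec * vec)) :
    set 'rV[F]_N :=
  zclosure (rational_image t S).

Definition xvar (k : nat) : bipoly := 'X_(lshift n.+1 (inord k)).
Definition yvar (k : nat) : bipoly := 'X_(rshift n.+1 (inord k)).

(* For 2 <= k <= n both z_(2k-2) and z_(2k-1) have (index)./2 + 1 = k.        *)
Definition theta (i : 'I_(2 * n)) : bipoly :=
  let k := i./2.+1 in
  if i == 0%N :> nat then xvar 0 * yvar 1
  else if i == 1%N :> nat then
    2^-1 *: (xvar 1 * yvar 1 - xvar 0 * yvar 0)
  else if odd i then - 2^-1 *: (xvar 0 * yvar k)
  else xvar k * yvar 1.

End Incidence.

(* The hypersurfaces of degree d in P^n are parametrized by the projective    *)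
(* space of coefficient vectors, indexed by the monomials of degree d.        *)
Section Hypersurfaces.
Variables (F : fieldType) (n d : nat).

Definition monomials : {set 'X_{1..n.+1 < d.+1}} :=
  [set m : 'X_{1..n.+1 < d.+1} | mdeg m == d]%SET.

Definition form_of_coefs (a : 'rV[F]_#|monomials|) : {mpoly F[n.+1]} :=
  \sum_i a 0 i *: 'X_[val (enum_val i)].

Definition hypersurface (a : 'rV[F]_#|monomials|) : set 'rV[F]_n.+1 :=
  [set x | x != 0 /\ ev (form_of_coefs a) x = 0].

End Hypersurfaces.

(* Main.v *)
(* With z_(2k) and z_(2k+1) as dual coordinates, P^(2n-1) carries a           *)
(* symplectic form omega, for which C is a Legendrian variety, parametrized   *)
(* by X through x |-> theta(x, grad F(x)). In the affine chart x_0 = 1, the   *)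
(* hyperplane omega-orthogonal to theta(x, grad F(x)) cuts out on C, at the   *)
(* point given by X, a function which up to a unit and terms of order three   *)
(* is \sum_i (X_i - x_i) (F_i(X) + F_i(x)), hence by the trapezoidal rule 2   *)
(* (F(X) - F(x)) = 0; so this hyperplane osculates C to order two. When the   *)
(* derivatives of theta along X of order at most two span a hyperplane, no    *)
(* other one does, and then omega, seen as a linear map to the dual space,    *)
(* sends C to its osculating dual. A general F is prime because the products  *)
(* of two forms of positive degrees depend on too few parameters; the         *)
(* condition on the derivatives holds for a general F because it holds for    *)
(* one example.                                                               *)

From HB Require Import structures.
Require Import Defs.
From mathcomp Require Import all_boot all_order all_algebra.
From mathcomp Require Import complex.
From mathcomp Require Import boolp classical_sets reals.
From mathcomp Require Import mpoly ring zify.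

Set Implicit Arguments.
Unset Strict Implicit.
Unset Printing Implicit Defensive.

Import GRing.Theory.

Local Open Scope classical_set_scope.
Local Open Scope ring_scope.

(** * Unique factorization and the Nullstellensatz for a prime *)

(** Everything is transferred to the hypersurface. Let [F] be a prime form with zeros X in P^n,
    where n = [m.+1]. The map [theta_row] sends x to theta(x, grad F(x)), up to a factor 2, and
    [contact_variety] is cut out by the forms whose pullback is a multiple of [F]. By a
    Nullstellensatz for prime polynomials ([prime_nullstellensatz], [generic_zero]) these are all
    the forms vanishing on it ([vanishing_pull]), so irreducibility, density of open subsets and
    equality of closures become divisibility statements, settled by primality. This variety is the
    proper image of the conormal variety ([proper_image_conormal]), because a smooth point of X has
    the gradient as its only tangent hyperplane. Its dimension is found by counting monomials
    ([not_alg_indep_of_growth]).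

    The duality rests on two facts at a point z of the open set [chart], where theta is inverted by
    [unc_row]. Existence: the hyperplane omega(z, .) = 0 osculates to order two
    ([symplectic_osculates]), since its local equation is a trapezoidal sum of differentials of [F],
    which [taylor3] compares with the zero increment of [F]. Uniqueness: an osculating hyperplane
    contains theta and its first and unmixed second Koszul derivatives ([osculates_rows]); where
    [osc_det] is nonzero these 2n-1 vectors are independent ([osculates_symplectic]). So the
    osculating space is that hyperplane ([osc_contact]), and omega maps C onto its osculating dual
    ([osc_dual_contact]). A hyperplane containing C would osculate everywhere, hence correspond to
    every point of the chart, which is absurd ([not_in_hyperplane_contact]).

    For a general [F], primality comes from [generic_irreducible] together with unique factorization
    ([factorial_mpoly]), and [osc_det] is not a multiple of [F] because this is so for [sample]
    ([generic_osc_det]). That example contains cubes, which is where degree at least 3 enters. *)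

Section Factorial.
Variable A : idomainType.
Implicit Types a b p q u : A.

Definition divides p a := exists q, a = q * p.
Definition invertible u := exists v, v * u = 1.
Definition prime_elt p :=
  [/\ p != 0, ~ invertible p &
      forall a b, divides p (a * b) -> divides p a \/ divides p b].

Definition factored a (s : seq A) :=
  exists2 u, invertible u &
    (forall p, p \in s -> prime_elt p) /\ a = u * \prod_(p <- s) p.

Definition factorial_ring := forall a, a != 0 -> exists s, factored a s.

Lemma divides_mull a b p : divides p b -> divides p (a * b).
Proof. by case=> q ->; exists (a * q); rewrite mulrA. Qed.

Lemma divides_mulr a b p : divides p a -> divides p (a * b).
Proof. by rewrite mulrC; apply: divides_mull. Qed.

Lemma divides_add a b p : divides p a -> divides p b -> divides p (a + b).
Proof. by case=> q -> [r ->]; exists (q + r); rewrite mulrDl. Qed.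

Lemma divides_sub a b p : divides p a -> divides p b -> divides p (a - b).
Proof. by case=> q -> [r ->]; exists (q - r); rewrite mulrBl. Qed.

Lemma divides_sum (I : Type) (r : seq I) (P : pred I) (f : I -> A) p :
  (forall i, P i -> divides p (f i)) -> divides p (\sum_(i <- r | P i) f i).
Proof.
move=> h; apply: (big_ind (divides p)) h => //; last by move=> a b; apply: divides_add.
by exists 0; rewrite mul0r.
Qed.

Lemma prime_prod p (s : seq A) : prime_elt p ->
  divides p (\prod_(q <- s) q) -> exists2 q, q \in s & divides p q.
Proof.
move=> pp; elim: s => [|a s IHs].
  by rewrite big_nil => - [q e]; case: pp => _ []; exists q.
rewrite big_cons => /(let: And3 _ _ h := pp in h) [pa|/IHs [q qs pq]].
  by exists a; rewrite ?mem_head.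
by exists q; rewrite // inE qs orbT.
Qed.

Lemma invertibleM a b : invertible a -> invertible b -> invertible (a * b).
Proof. by case=> v ea [w eb]; exists (v * w); rewrite mulrACA ea eb mulr1. Qed.

Lemma invertible1 : invertible 1.
Proof. by exists 1; rewrite mulr1. Qed.

Lemma prime_divides_prime p q : prime_elt p -> prime_elt q -> divides p q ->
  exists2 v, invertible v & q = v * p.
Proof.
move=> [p0 pni _] [q0 _ hq] [v e]; exists v => //.
have /hq [[w ew]|[w ew]] : divides q (v * p) by exists 1; rewrite mul1r -e.
  case: pni; exists w; apply: (mulfI q0).
  by rewrite mulr1 mulrCA mulrA -ew -e.
by exists w; apply: (mulIf p0); rewrite -mulrA -e -ew mul1r.
Qed.

Lemma factored_div_prime p a s : prime_elt p -> factored (a * p) s ->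
  exists2 t, (size t < size s)%N & factored a t.
Proof.
move=> pp [u [u' iu] [hs e]].
have [q qs pq] : exists2 q, q \in s & divides p q.
  apply: (prime_prod pp); exists (u' * a).
  by rewrite -mulrA e mulrA iu mul1r.
have [v iv qE] := prime_divides_prime pp (hs _ qs) pq.
exists (rem q s).
  by rewrite size_rem //; case: (s) qs.
exists (u * v); first by apply: invertibleM => //; exists u'.
split=> [r /mem_rem /hs //|].
have p0 : p != 0 by case: pp.
apply: (mulIf p0); rewrite e (perm_big _ (perm_to_rem qs)) big_cons qE.
by rewrite /=; ring.
Qed.

(** A prime factor [p] of [a] is not invertible, so irreducibility makes the product of the other
    factors a unit, and [a] is associated to [p]. *)
Lemma irreducible_prime a : factorial_ring -> a != 0 -> ~ invertible a ->
  (forall b c, a = b * c -> invertible b \/ invertible c) -> prime_elt a.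
Proof.
move=> fA a0 ani irr; have [[|p s] [u iu [hs e]]] := fA a a0.
  by case: ani; rewrite e big_nil mulr1.
have pp : prime_elt p by apply: hs; rewrite mem_head.
have [p0 pni hp] := pp.
have [w [w' iw] ae] : exists2 w, invertible w & a = w * p.
  exists (u * \prod_(j <- s) j); last by rewrite e big_cons mulrCA mulrC.
  case: (irr (u * \prod_(j <- s) j) p) => //.
  by rewrite e big_cons mulrCA mulrC.
split=> // b c [q eq].
have : divides p (b * c) by exists (q * w); rewrite eq ae mulrA.
by case/hp => - [r ->]; [left|right]; exists (r * w');
  rewrite ae -mulrA [w' * _]mulrA iw mul1r.
Qed.

End Factorial.

Section FactorialPoly.
Variable A : idomainType.
Implicit Types (c p : A) (f g h : {poly A}).

Lemma divides_polyC p f : (forall i, divides p f`_i) -> divides p%:P f.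
Proof.
move=> h; exists (\poly_(i < size f) sval (cid (h i))).
apply/polyP => i; rewrite coefMC coef_poly.
case: ltnP => [_|fi]; first by case: cid.
by rewrite nth_default // mul0r.
Qed.

Lemma divides_polyC_coef p f i : divides p%:P f -> divides p f`_i.
Proof. by case=> q ->; exists q`_i; rewrite coefMC. Qed.

(** Gauss's lemma: if [i] and [j] are the first indices of coefficients of [f] and [g] not divisible
    by [p], the coefficient [i + j] of the product is congruent modulo [p] to the product of these
    two. *)
Lemma prime_polyC p : prime_elt p -> prime_elt p%:P.
Proof.
move=> [p0 pni hp]; split; first by rewrite polyC_eq0.
  by case=> v /(congr1 (coefp 0%N)); rewrite /= coefMC coef1 => e; apply: pni; exists v`_0.
have small f : ~ divides p%:P f ->
    exists2 i, ~ divides p f`_i & forall j, (j < i)%N -> divides p f`_j.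
  move=> nf; have /existsNP [i0 ni0] : ~ forall i, divides p f`_i.
    by move/divides_polyC.
  have ex : exists i, `[< ~ divides p f`_i >] by exists i0; apply/asboolP.
  exists (ex_minn ex); case: ex_minnP => i /asboolP // ni hi j.
  by rewrite ltnNge => /negP hj; apply: contrapT => nj; apply/hj/hi/asboolP.
move=> f g fg; apply: contrapT => /not_orP [nf ng].
have [i ni hi] := small _ nf; have [j nj hj] := small _ ng.
have := divides_polyC_coef (i + j) fg; rewrite coefM.
have lti : (i < (i + j).+1)%N by rewrite ltnS leq_addr.
rewrite (bigD1 (Ordinal lti)) //= addKn => hsum.
suff /hp [//|//] : divides p (f`_i * g`_j).
rewrite -[X in divides p X](addrK (\sum_(k < (i + j).+1 | k != Ordinal lti) f`_k * g`_(i + j - k))).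
apply: divides_sub => //; apply: divides_sum => k kni.
have [ki|ik|e] := ltngtP k i.
- exact/divides_mulr/hi.
- apply/divides_mull/hj; rewrite ltn_subLR; last by rewrite -ltnS.
  by rewrite ltn_add2r.
- by case/eqP: kni; apply: val_inj.
Qed.

Hypothesis fA : factorial_ring A.

(** Clears the denominators of a factorization over the fraction field: each prime factor of [c]
    stays prime among polynomials, so it divides [g] or [h] and is removed there without changing
    degrees. *)
Lemma cancel_scale c f g h : c != 0 -> c *: f = g * h ->
  exists g' h', [/\ f = g' * h', size g' = size g & size h' = size h].
Proof.
move=> c0; have [s [u [u' iu] [hs ->]]] := fA c0.
elim: s g h hs => [|p s IHs] g h hs e.
  exists (u' *: g), h; split=> //; last first.
    by rewrite size_scale //; apply: contra_eq_neq iu => ->; rewrite mul0r eq_sym oner_eq0.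
  by rewrite -scalerAl -e big_nil scalerA mulr1 iu scale1r.
have pp : prime_elt p by apply: hs; rewrite mem_head.
have [p0 _ _] := pp; have [p0P _ hp] := prime_polyC pp.
have hs' q : q \in s -> prime_elt q by move=> qs; apply: hs; rewrite inE qs orbT.
have : divides p%:P (g * h).
  exists ((u * \prod_(j <- s) j) *: f).
  by rewrite -e big_cons -!mul_polyC !polyCM /=; ring.
case/hp => - [q qe].
  have [|g' [h' [-> sg sh]]] := IHs q h hs'.
    apply: (mulfI p0P); rewrite mulrA [_ * q]mulrC -qe -e big_cons.
    by rewrite -!mul_polyC !polyCM /=; ring.
  by exists g', h'; split=> //; rewrite qe sg mulrC mul_polyC size_scale.
have [|g' [h' [-> sg sh]]] := IHs g q hs'.
  apply: (mulfI p0P); rewrite mulrCA [_ * q]mulrC -qe -e big_cons.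
  by rewrite -!mul_polyC !polyCM /=; ring.
by exists g', h'; split=> //; rewrite qe sh mulrC mul_polyC size_scale.
Qed.

(* If no constant prime divides f, then divisibility by f over the fraction   *)
(* field is divisibility over A.                                              *)
Lemma primitive_divides f : (forall p, prime_elt p -> ~ divides p%:P f) ->
  forall c g h, c != 0 -> c *: g = h * f -> divides f g.
Proof.
move=> prim c g h c0; have [s [u [u' iu] [hs ->]]] := fA c0.
elim: s h hs => [|p s IHs] h hs e.
  exists (u' *: h).
  by rewrite -scalerAl -e big_nil scalerA mulr1 iu scale1r.
have pp : prime_elt p by apply: hs; rewrite mem_head.
have [p0 _ _] := pp; have [p0P _ hp] := prime_polyC pp.
have hs' q : q \in s -> prime_elt q by move=> qs; apply: hs; rewrite inE qs orbT.
have : divides p%:P (h * f).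
  exists ((u * \prod_(j <- s) j) *: g).
  by rewrite -e big_cons -!mul_polyC !polyCM /=; ring.
case/hp => [[q qe]|/(prim _ pp) //].
apply: (IHs q hs'); apply: (mulfI p0P).
rewrite mulrA [_ * q]mulrC -qe -e big_cons.
by rewrite -!mul_polyC !polyCM /=; ring.
Qed.

(** Over the fraction field the gcd of [f] and [g] is either [f], up to a constant, or constant. In
    the second case [f] divides [h] over the fractions. Primitivity brings either divisibility back
    to [A]. *)
Lemma primitive_irreducible_prime f :
  (1 < size f)%N -> (forall p, prime_elt p -> ~ divides p%:P f) ->
  (forall c g h, c != 0 -> c *: f = g * h -> size g = 1%N \/ size h = 1%N) ->
  prime_elt f.
Proof.
move=> sf prim irr; have f0 : f != 0 by rewrite -size_poly_gt0 ltnW.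
split=> //.
  case=> v e; have v0 : v != 0 by apply: contra_eq_neq e => ->; rewrite mul0r eq_sym oner_eq0.
  have := size_mul v0 f0; rewrite e size_poly1.
  by move: v0 sf; rewrite -size_poly_gt0; lia.
move=> g h [q e].
have [[c k] /= c0 ek] := Pdiv.Idomain.dvdpP _ _ (dvdp_gcdl f g).
have [[c' k'] /= c0' ek'] := Pdiv.Idomain.dvdpP _ _ (dvdp_gcdr f g).
case: (irr _ _ _ c0 ek) => s1.
  left; have [b b0 kb] := size_poly1P _ (introT eqP s1).
  apply: (primitive_divides prim (c := b * c') (h := k' * c%:P)).
    by rewrite mulf_neq0.
  by rewrite -scalerA ek' scalerAr -mul_polyC -kb -ek -mul_polyC mulrA.
right; have cop : coprimep f g by rewrite coprimep_def s1.
have : f %| g * h.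
  by apply/Pdiv.Idomain.dvdpP; exists (1, q); rewrite ?oner_eq0 ?scale1r.
rewrite Gauss_dvdpr // => /Pdiv.Idomain.dvdpP [[b t] /= b0 eb].
exact: primitive_divides prim _ _ _ b0 eb.
Qed.

(** Induction on the degree and, within it, on the number of prime factors of the leading
    coefficient. A constant prime dividing [f] is split off first; a primitive [f] is then prime, or
    a product of two polynomials of smaller degree. *)
Theorem factorial_poly : factorial_ring {poly A}.
Proof.
move=> f; have [m] := ubnP (size f); elim: m f => // m IHm f; rewrite ltnS => sfm f0.
have l0 : lead_coef f != 0 by rewrite lead_coef_eq0.
have [s fs] := fA l0; have [k] := ubnP (size s).
elim: k s f sfm f0 l0 fs => // k IHk s f sfm f0 l0 fs; rewrite ltnS => sk.
have [[p [pp [g fg]]]|nop] := pselect (exists p, prime_elt p /\ divides p%:P f).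
  have [p0 _ _] := pp; have p0P : p%:P != 0 by rewrite polyC_eq0.
  have g0 : g != 0 by apply: contra_neq f0 => g0; rewrite fg g0 mul0r.
  have lg : lead_coef g != 0 by rewrite lead_coef_eq0.
  move: fs; rewrite fg lead_coefM lead_coefC => /(factored_div_prime pp) [t st ft].
  have sg : (size g <= m)%N.
    by apply: leq_trans sfm; rewrite fg mulrC mul_polyC size_scale.
  have [r [u iu [hr gE]]] := IHk t g sg g0 lg ft (leq_trans st sk).
  exists (p%:P :: r), u => //; split; last by rewrite gE big_cons /=; ring.
  by move=> q; rewrite inE => /orP [/eqP ->|/hr //]; apply: prime_polyC.
have prim p : prime_elt p -> ~ divides p%:P f by move=> pp pf; apply: nop; exists p.
have [s1|s1] := leqP (size f) 1.
  have /size_poly1P [b b0 fb] : size f == 1%N by rewrite eqn_leq s1 size_poly_gt0.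
  have [[|p r] [u [v iu] [hr bE]]] := fA b0.
    exists [::], u%:P; first by exists v%:P; rewrite -polyCM iu.
    by split=> //; rewrite fb bE !big_nil !mulr1.
  case: (prim p); first by apply: hr; rewrite mem_head.
  exists (u * \prod_(j <- r) j)%:P; rewrite fb bE big_cons -polyCM; congr _%:P; rewrite /=; ring.
have [irr|] := pselect (forall c g h, c != 0 -> c *: f = g * h ->
    size g = 1%N \/ size h = 1%N).
  exists [:: f], 1; first exact: invertible1.
  split=> [p|]; last by rewrite big_seq1 mul1r.
  by rewrite inE => /eqP ->; apply: primitive_irreducible_prime.
move=> /existsNP [c /existsNP [g /existsNP [h /not_implyP [c0 /not_implyP [e]]]]].
move=> /not_orP [sg sh]; have [g' [h' [fE sg' sh']]] := cancel_scale c0 e.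
have [g0 h0] : g' != 0 /\ h' != 0.
  by apply/andP; rewrite -negb_or -mulf_eq0 -fE.
have sgh : (size f = (size g' + size h').-1)%N by rewrite fE size_mul.
move: (g0) (h0) sg sh; rewrite -!size_poly_gt0 -sg' -sh' => sg0 sh0 sg1 sh1.
have [|s1' [u1 iu1 [hs1 gE]]] := IHm g' _ g0; first by move: sfm; lia.
have [|s2' [u2 iu2 [hs2 hE]]] := IHm h' _ h0; first by move: sfm; lia.
exists (s1' ++ s2'), (u1 * u2); first exact: invertibleM.
split; last by rewrite fE gE hE big_cat /=; ring.
by move=> p; rewrite mem_cat => /orP [/hs1|/hs2].
Qed.

(** Coprimality holds over the fraction field only; clearing denominators leaves a nonzero constant
    [c] instead of 1. *)
Lemma prime_bezout f g : prime_elt f -> (1 < size f)%N -> ~ divides f g ->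
  exists u v c, c != 0 /\ u * f + v * g = c%:P.
Proof.
move=> [f0 _ hf] sf nfg.
have s1 : size (gcdp f g) = 1%N.
  have [[a k] /= a0 ek] := Pdiv.Idomain.dvdpP _ _ (dvdp_gcdl f g).
  have [[a' k'] /= a0' ek'] := Pdiv.Idomain.dvdpP _ _ (dvdp_gcdr f g).
  have : divides f (k * gcdp f g) by exists a%:P; rewrite -ek mul_polyC.
  case/hf => - [q qe].
    rewrite qe in ek; have : f * (q * gcdp f g) = f * a%:P.
      by rewrite mulrCA mulrA -ek mulrC mul_polyC.
    move/(mulfI f0) => e; have : q * gcdp f g != 0 by rewrite e polyC_eq0.
    rewrite mulf_eq0 negb_or => /andP [q0 g0].
    have : 1%N = (size q + size (gcdp f g)).-1 by rewrite -size_mul // e size_polyC a0.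
    by move: q0 g0; rewrite -!size_poly_gt0; move: (size q) (size (gcdp f g)) => x y; lia.
  have : divides f (a'%:P * g) by exists (k' * q); rewrite mul_polyC ek' qe mulrA.
  case/hf => // - [r re].
  have r0 : r != 0 by apply: contraNneq a0' => r0; rewrite -polyC_eq0 re r0 mul0r.
  have : 1%N = (size r + size f).-1 by rewrite -size_mul // -re size_polyC a0'.
  by move: r0; rewrite -!size_poly_gt0; lia.
have [[u v] /= uv] := Bezoutp f g.
have /size_poly1P [c c0 e] : size (u * f + v * g) == 1%N by rewrite (eqp_size uv) s1.
by exists u, v, c.
Qed.

End FactorialPoly.

Section Morphisms.
Variables (A B : idomainType) (f : {rmorphism A -> B}).

Lemma invertible_morph (u : A) : invertible u -> invertible (f u).
Proof. by case=> v e; exists (f v); rewrite -rmorphM e rmorph1. Qed.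

Lemma divides_morph (a b : A) : divides a b -> divides (f a) (f b).
Proof. by case=> v ->; exists (f v); rewrite rmorphM. Qed.

End Morphisms.

Section FactorialIso.
Variables (A B : idomainType) (f : {rmorphism A -> B}) (g : {rmorphism B -> A}).
Hypotheses (fK : cancel f g) (gK : cancel g f).

Lemma divides_can (a b : A) : divides (f a) (f b) -> divides a b.
Proof. by move=> /(divides_morph g); rewrite !fK. Qed.

Lemma prime_morph (p : A) : prime_elt p -> prime_elt (f p).
Proof.
move=> [p0 pni hp]; split.
- by rewrite -(rmorph0 f) (can_eq fK).
- by move=> /(invertible_morph g); rewrite fK.
move=> a b; rewrite -[a]gK -[b]gK -rmorphM => /(divides_morph g).
by rewrite !fK => /hp [] /(divides_morph f) h; [left|right].
Qed.

Lemma factorial_morph : factorial_ring A -> factorial_ring B.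
Proof.
move=> fA b b0; have gb0 : g b != 0 by rewrite -(rmorph0 g) (can_eq gK).
have [s [u iu [hs e]]] := fA _ gb0.
exists (map f s), (f u); first exact: invertible_morph.
split; first by move=> p /mapP [q qs ->]; apply/prime_morph/hs.
by rewrite big_map -rmorph_prod -rmorphM -e gK.
Qed.

End FactorialIso.

(** * Multivariate polynomials as polynomials in the last variable *)

Section MpolyMorphisms.
Variables (n : nat) (A : comNzRingType) (B : nzRingType).

Lemma mpoly_morph_ext (f g : {rmorphism {mpoly A[n]} -> B}) :
  (forall c, f c%:MP = g c%:MP) -> (forall i, f 'X_i = g 'X_i) -> f =1 g.
Proof.
move=> fgC fgX p; rewrite [p]mpolyE !rmorph_sum /=; apply: eq_bigr => m _.
rewrite -mul_mpolyC !rmorphM fgC mpolyXE_id !rmorph_prod /=; congr (_ * _).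
by apply: eq_bigr => i _; rewrite !rmorphXn fgX.
Qed.

End MpolyMorphisms.

Section Muni.
Variables (n : nat) (A : comNzRingType).
Local Notation widen := (@widen_ord n n.+1 (leqnSn n)).

Lemma muni_widen (i : 'I_n) : muni ('X_(widen i) : {mpoly A[n.+1]}) = ('X_i)%:P.
Proof.
rewrite muniE msuppX big_seq1 mcoeffX eqxx scale1r mnmE.
rewrite (_ : (widen i == ord_max) = false); last first.
  by apply/negbTE; rewrite -val_eqE /= ltn_eqF.
rewrite expr0 alg_polyC; congr ('X_[_])%:P; apply/mnmP => j.
by rewrite !mnmE -!val_eqE.
Qed.

Lemma muni_max : muni ('X_ord_max : {mpoly A[n.+1]}) = 'X.
Proof.
rewrite muniE msuppX big_seq1 mcoeffX eqxx scale1r mnmE eqxx expr1.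
rewrite (_ : [multinom _ | i < n] = 0%MM) ?mpolyX0 ?scale1r //.
by apply/mnmP => j; rewrite !mnmE -val_eqE /= gtn_eqF.
Qed.

(** The inverse of [muni]. As both are ring morphisms, factoriality and primality pass between the
    two presentations, which gives the induction on the number of variables. *)
Definition unmuni : {poly {mpoly A[n]}} -> {mpoly A[n.+1]} :=
  horner_eval 'X_ord_max \o map_poly (@mwiden n A).

HB.instance Definition _ := GRing.RMorphism.on unmuni.

Lemma muniK : cancel (@muni n A) unmuni.
Proof.
move=> p; rewrite -[RHS]/(idfun p) -[LHS]/((unmuni \o @muni n A) p).
apply: mpoly_morph_ext => [c|i] /=.
  by rewrite muniC /unmuni /= map_polyC /horner_eval hornerC /= mwidenC.
have [j ->|->] := unliftP ord_max i; last first.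
  by rewrite muni_max /unmuni /= map_polyX /horner_eval hornerX.
rewrite (_ : lift _ _ = widen j); last by apply: val_inj; rewrite /= /bump leqNgt ltn_ord.
rewrite muni_widen /unmuni /= map_polyC /horner_eval hornerC /= mwidenX.
by rewrite mnmwiden1.
Qed.

Lemma muni_mwiden (c : {mpoly A[n]}) : muni (mwiden c) = c%:P.
Proof.
rewrite -[LHS]/((@muni n A \o @mwiden n A) c) -[RHS]/(polyC c).
apply: mpoly_morph_ext => [a|i] /=; first by rewrite mwidenC muniC.
by rewrite mwidenX mnmwiden1 muni_widen.
Qed.

Lemma unmuniK : cancel unmuni (@muni n A).
Proof.
move=> q; rewrite -{2}[q]coefK poly_def -[q in LHS]coefK poly_def /unmuni /=.
rewrite raddf_sum /horner_eval horner_sum raddf_sum; apply: eq_bigr => i _ /=.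
rewrite -!mul_polyC !rmorphM /= map_polyC map_polyXn hornerM hornerC hornerXn.
by rewrite rmorphM rmorphXn /= muni_max muni_mwiden.
Qed.

Lemma meval_muni (p : {mpoly A[n.+1]}) (x : 'I_n.+1 -> A) :
  (map_poly (meval (x \o widen)) (muni p)).[x ord_max] = p.@[x].
Proof.
rewrite -[LHS]/((horner_eval (x ord_max) \o (map_poly (meval (x \o widen))
  \o @muni n A)) p) -[RHS]/(meval x p).
apply: mpoly_morph_ext => [c|i] /=.
  by rewrite muniC map_polyC /horner_eval hornerC /= !mevalC.
have [j ->|->] := unliftP ord_max i; last first.
  by rewrite muni_max map_polyX /horner_eval hornerX mevalXU.
rewrite (_ : lift _ _ = widen j); last by apply: val_inj; rewrite /= /bump leqNgt ltn_ord.
by rewrite muni_widen map_polyC /horner_eval hornerC /= !mevalXU.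
Qed.

Definition rext (v : 'I_n -> A) t (i : 'I_n.+1) :=
  if unlift ord_max i is Some j then v j else t.

Lemma meval_rext (p : {mpoly A[n.+1]}) v t :
  p.@[rext v t] = (map_poly (meval v) (muni p)).[t].
Proof.
rewrite -meval_muni {2}/rext unlift_none; congr (_.[_]).
apply: eq_map_poly => q /=; apply: meval_eq => i /=.
rewrite /rext (_ : widen i = lift ord_max i) ?liftK //.
by apply: val_inj; rewrite /= /bump leqNgt ltn_ord.
Qed.

End Muni.

Section FactorialMpoly.
Variable K : fieldType.

Lemma factorial_field : factorial_ring K.
Proof.
move=> a a0; exists [::], a; first by exists a^-1; rewrite mulVf.
by rewrite big_nil mulr1.
Qed.

Theorem factorial_mpoly n : factorial_ring {mpoly K[n]}.
Proof.
elim: n => [|n IHn].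
  apply: (@factorial_morph K {mpoly K[0]} (@mpolyC 0 K) (@mcoeff 0 K 0%MM)).
  - exact: mpolyCK.
  - exact: mpolyKC.
  - exact: factorial_field.
apply: (@factorial_morph {poly {mpoly K[n]}} {mpoly K[n.+1]} (@unmuni n K) (@muni n K)).
- exact: unmuniK.
- exact: muniK.
- exact: factorial_poly.
Qed.

End FactorialMpoly.

Section Nonvanishing.
Variable K : numDomainType.

(** In characteristic zero the integers from 1 to [size p] are nonzero and too many to be all
    roots. *)
Lemma poly_nonroot (p : {poly K}) : p != 0 -> exists2 t, t != 0 & p.[t] != 0.
Proof.
move=> p0; apply: contrapT => h.
have := @max_poly_roots _ p (map (fun k => k.+1%:R) (iota 0 (size p))) p0.
rewrite size_map size_iota ltnn => H; apply/notF/H.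
  apply/allP => _ /mapP [k _ ->]; rewrite rootE; apply: contrapT => pk.
  by apply: h; exists k.+1%:R; [rewrite Num.Theory.pnatr_eq0 | exact/negP].
rewrite map_inj_uniq ?iota_uniq // => i j /eqP.
by rewrite Num.Theory.eqr_nat => /eqP [].
Qed.

Lemma mpoly_nonroot n (p : {mpoly K[n]}) : p != 0 -> exists v, p.@[v] != 0.
Proof.
elim: n p => [|n IHn] p p0.
  by exists (fun=> 0); move: p0; rewrite [p]nvar0_mpolyC mevalC mpolyC_eq0.
have q0 : muni p != 0 by rewrite -(rmorph0 (@muni n K)) (can_eq (@muniK _ _)).
have /IHn [v lv] : lead_coef (muni p) != 0 by rewrite lead_coef_eq0.
have /poly_nonroot [t _ pt] : map_poly (meval v) (muni p) != 0.
  by apply: contra_neq lv => /(congr1 (coefp (size (muni p)).-1)) /=;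
    rewrite coef_map coef0.
by exists (rext v t); rewrite meval_rext.
Qed.

End Nonvanishing.

Lemma common_root_const (A B : comNzRingType) (f : {rmorphism A -> B})
    (p q u v : {poly A}) c t : u * p + v * q = c%:P ->
  (map_poly f p).[t] = 0 -> (map_poly f q).[t] = 0 -> f c = 0.
Proof.
move=> e pt qt; rewrite -[LHS](hornerC _ t) -map_polyC -e.
by rewrite rmorphD !rmorphM hornerD !hornerM pt qt !mulr0 addr0.
Qed.

Section Nullstellensatz.
Variables (K : numClosedFieldType) (n : nat).
Implicit Types (F G : {mpoly K[n.+1]}).

(* A prime F which is monic in the last variable is coprime, over the field   *)
(* of rational functions in the other variables, to any G that it does not    *)
(* divide; so some polynomial b in these variables lies in the ideal (F, G),  *)
(* and F has zeros above the points where b does not vanish.                  *)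
Theorem prime_nullstellensatz F G c : prime_elt F -> (1 < size (muni F))%N ->
  c != 0 -> lead_coef (muni F) = c%:MP ->
  (forall x, F.@[x] = 0 -> G.@[x] = 0) -> divides F G.
Proof.
move=> pF sF c0 lF FG; apply: contrapT => nFG.
have [f0 fni hf] : prime_elt (muni F).
  exact: (@prime_morph {mpoly K[n.+1]} {poly {mpoly K[n]}} (@muni n K)
    (@unmuni n K) (@muniK n K) (@unmuniK n K) F pF).
have nfg : ~ divides (muni F) (muni G).
  move=> h; apply: nFG; exact: (@divides_can {mpoly K[n.+1]} {poly {mpoly K[n]}}
    (@muni n K) (@unmuni n K) (@muniK n K) F G h).
have [u [v [b [b0 be]]]] := prime_bezout (And3 f0 fni hf) sF nfg.
have [x bx] := mpoly_nonroot b0.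
(* [F] is monic in the last variable up to a nonzero scalar, so its degree survives the
   specialization at [x] and a root exists. *)
have [t tx] : exists t, root (map_poly (meval x) (muni F)) t.
  apply/closed_rootP; rewrite size_poly_eq -/(lead_coef _) ?lF ?mevalC //.
  by rewrite gtn_eqF.
have Fx : F.@[rext x t] = 0 by rewrite meval_rext (eqP tx).
have := FG _ Fx; rewrite meval_rext => Gx.
by move/negP: bx; apply; apply/eqP/(common_root_const be (eqP tx) Gx).
Qed.

End Nullstellensatz.

(** * Homogeneous polynomials and derivations *)

Section Homogeneous.
Variables (n : nat) (A : comNzRingType).
Implicit Types (p q : {mpoly A[n]}).

Lemma meval_dhomog d p t (x : 'I_n -> A) : p \is d.-homog ->
  p.@[fun i => t * x i] = t ^+ d * p.@[x].
Proof.
move=> /dhomogP hp; rewrite !mevalE mulr_sumr; apply: eq_big_seq => m /hp /= md.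
rewrite mulrCA; congr (_ * _); rewrite -md mdegE -prodrXr -big_split /=.
by apply: eq_bigr => i _; rewrite exprMn.
Qed.

Lemma dhomog_mderiv d p i : p \is d.-homog -> p^`M(i) \is d.-1.-homog.
Proof.
move=> /dhomogP hp; apply/dhomogP => m; rewrite mcoeff_msupp mcoeff_deriv => nz.
have /hp /= : (m + U_(i))%MM \in msupp p.
  by rewrite mcoeff_msupp; apply: contra_neq nz => ->; rewrite mul0rn.
by rewrite mdegD mdeg1 addn1 => <-.
Qed.

Lemma euler_dhomog d p : p \is d.-homog ->
  \sum_i 'X_i * p^`M(i) = d%:R * p.
Proof.
move=> /dhomogP hp; transitivity (\sum_(m <- msupp p) p@_m *: (d%:R * 'X_[m])).
  have pE i : p^`M(i) = \sum_(m <- msupp p) p@_m *: ('X_[m])^`M(i).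
    by rewrite {1}[p]mpolyE raddf_sum; apply: eq_bigr => m _; rewrite /= mderivZ.
  under eq_bigr => i _ do rewrite pE mulr_sumr.
  rewrite exchange_big /=; apply: eq_big_seq => m /hp /= <-.
  under eq_bigr => i _ do rewrite mderivX -scalerAr.
  rewrite -scaler_sumr; congr (_ *: _).
  rewrite mdegE natr_sum mulr_suml; apply: eq_bigr => i _.
  have [->|mi] := eqVneq (m i) 0%N; first by rewrite scale0r mulr0 mul0r.
  rewrite -scalerAr -mpolyXD addmC submK ?lep1mP // -mul_mpolyC.
  by rewrite mpolyC_nat.
rewrite [p in RHS]mpolyE mulr_sumr; apply: eq_bigr => m _.
by rewrite scalerAr.
Qed.

Lemma dhomog_bigprod (I : Type) (r : seq I) (P : pred I) (f : I -> {mpoly A[n]}) e :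
  (forall i, P i -> f i \is (e i).-homog) ->
  \prod_(i <- r | P i) f i \is (\sum_(i <- r | P i) e i)%N.-homog.
Proof.
move=> h; apply: (big_rec2 (fun q k => q \is k.-homog)); first exact: dhomog1.
by move=> i q k /h; apply: dhomogM.
Qed.

Lemma dhomog_det m (M : 'M[{mpoly A[n]}]_m) (e : 'I_m -> nat) :
  (forall i j, M i j \is (e i).-homog) -> \det M \is (\sum_i e i)%N.-homog.
Proof.
move=> hM; apply: rpred_sum => s _; rewrite mulr_sign.
by case: ifP => _; rewrite ?rpredN; apply: dhomog_bigprod.
Qed.

Lemma dhomog_comp k d e (p : {mpoly A[k]}) (q : k.-tuple {mpoly A[n]}) :
  p \is d.-homog -> (forall i, tnth q i \is e.-homog) ->
  p \mPo q \is (d * e).-homog.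
Proof.
move=> /dhomogP hp hq; rewrite comp_mpolyE big_seq; apply: rpred_sum => m /hp /= <-.
apply: rpredZ; rewrite mdegE big_distrl /=; apply: dhomog_bigprod => i _.
by rewrite mulnC; apply: dhomogMn.
Qed.

End Homogeneous.

Section HomogeneousMuni.
Variables (n : nat) (A : comNzRingType).

(** Only the pure power of the last variable has exponent [d] there, so the top coefficient is a
    scalar. This makes [muni] of a form monic, up to this scalar, as the Nullstellensatz
    requires. *)
Lemma muni_dhomog d (p : {mpoly A[n.+1]}) : p \is d.-homog ->
  (size (muni p) <= d.+1)%N /\ (muni p)`_d = (p@_(U_(ord_max) *+ d))%:MP.
Proof.
move=> /dhomogP hp; have hm m : m \in msupp p -> (m ord_max <= d)%N.
  by move/hp => /= <-; rewrite mdegE (bigD1 ord_max) //= leq_addr.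
split.
  rewrite muniE big_seq; apply: (big_ind (fun q : {poly {mpoly A[n]}} => size q <= d.+1)%N).
  - by rewrite size_poly0.
  - by move=> q r sq sr; apply: leq_trans (size_polyD _ _) _; rewrite geq_max sq.
  move=> m /hm md; apply: leq_trans (size_scale_leq _ _) _.
  by rewrite size_polyXn.
rewrite muniE coef_sum.
have mE m : m \in msupp p -> m ord_max = d -> m = (U_(ord_max) *+ d)%MM.
  move=> /hp /= md mm; apply/mnmP => i; rewrite mulmnE mnm1E.
  have [<-|/negbTE ni] := eqVneq ord_max i; first by rewrite mul1n.
  move: md; rewrite mdegE (bigD1 ord_max) //= mm (bigD1 i) /= 1?eq_sym ?ni //.
  by rewrite mul0n; lia.
have coefE m : (p@_m *: 'X_[[multinom m (widen_ord (leqnSn n) i) | i < n]] *: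
    'X^(m ord_max) : {poly {mpoly A[n]}})`_d =
    if m ord_max == d then p@_m *: 'X_[[multinom m (widen_ord (leqnSn n) i) | i < n]] else 0.
  by rewrite coefZ coefXn eq_sym; case: eqP => _; rewrite ?mulr1 ?mulr0.
under eq_bigr => m _ do rewrite coefE.
rewrite -big_mkcond /=.
have [mp|mp] := boolP ((U_(ord_max) *+ d)%MM \in msupp p); last first.
  rewrite (memN_msupp_eq0 mp) mpolyC0 big_seq_cond big1 // => m /andP [hm' /eqP md].
  by rewrite -(mE _ hm' md) hm' in mp.
rewrite (big_rem _ mp) /= mulmnE mnm1E eqxx mul1n eqxx.
rewrite big_seq_cond big1 ?addr0 => [|m /andP []]; last first.
  rewrite mem_rem_uniq ?msupp_uniq // inE => /andP [ne hm'] /eqP md.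
  by rewrite (mE _ hm' md) eqxx in ne.
rewrite -mul_mpolyC (_ : [multinom _ | i < n] = 0%MM) ?mpolyX0 ?mulr1 //.
apply/mnmP => i; rewrite !mnmE mulmnE mnm1E (_ : (ord_max == _) = false) //.
by rewrite -val_eqE /= gtn_eqF.
Qed.

End HomogeneousMuni.

Section ChainRule.
Variables (n : nat) (A : comNzRingType).

Lemma mpoly_ring_ind (P : {mpoly A[n]} -> Prop) :
  (forall c, P c%:MP) -> (forall i, P 'X_i) ->
  (forall p q, P p -> P q -> P (p + q)) -> (forall p q, P p -> P q -> P (p * q)) ->
  forall p, P p.
Proof.
move=> PC PX PD PM p; rewrite [p]mpolyE; apply: (big_ind P) => [||m _]; [by rewrite -mpolyC0 | exact: PD |].
rewrite -mul_mpolyC; apply: (PM) => //; rewrite mpolyXE_id.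
apply: (big_ind P) => [||i _]; [by rewrite -mpolyC1 | exact: PM |].
by elim: (m i) => [|k IHk]; [rewrite expr0 -mpolyC1 | rewrite exprS; apply: PM].
Qed.

Variables (B : comNzRingType) (D : B -> B).
Hypotheses (DD : {morph D : x y / x + y})
  (DM : forall x y, D (x * y) = D x * y + x * D y).

(** The chain rule for an arbitrary derivation, which serves both for partial derivatives and for
    the Koszul derivations. *)
Lemma derivation_mmap (f : {rmorphism A -> B}) (h : 'I_n -> B) (p : {mpoly A[n]}) :
  (forall c, D (f c) = 0) ->
  D (mmap f h p) = \sum_i mmap f h p^`M(i) * D (h i).
Proof.
move=> DC; move: p; apply: mpoly_ring_ind => [c|j|p q IHp IHq|p q IHp IHq].
- by rewrite mmapC DC big1 // => i _; rewrite mderivC raddf0 mul0r.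
- rewrite (bigD1 j) //= mmapX mmap1U mderivX mnm1E eqxx scale1r.
  rewrite (_ : (U_(j) - U_(j))%MM = 0%MM) ?mpolyX0 ?rmorph1 ?mul1r; last first.
    by apply/mnmP => k; rewrite !mnmE subnn.
  rewrite big1 ?addr0 // => i /negbTE ij.
  by rewrite mderivX mnm1E eq_sym ij scale0r raddf0 mul0r.
- rewrite raddfD DD IHp IHq -big_split /=; apply: eq_bigr => i _.
  by rewrite mderivD raddfD mulrDl.
rewrite rmorphM DM IHp IHq mulr_suml mulr_sumr -big_split /=; apply: eq_bigr => i _.
by rewrite mderivM rmorphD !rmorphM /=; ring.
Qed.

End ChainRule.

(** * Dimension by counting monomials *)

Section Counting.
Variable K : fieldType.

Lemma dependent_of_card (I J : finType) (T : Type) (u : I -> T -> K)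
    (b : J -> T -> K) :
  (forall i, exists c : J -> K, forall t, u i t = \sum_j c j * b j t) ->
  (#|J| < #|I|)%N ->
  exists c : I -> K, (exists i, c i != 0) /\ forall t, \sum_i c i * u i t = 0.
Proof.
move=> /choice [c uE] JI.
pose M : 'M[K]_(#|I|, #|J|) := \matrix_(i, j) c (enum_val i) (enum_val j).
have : kermx M != 0.
  rewrite kermx_eq0 -row_leq_rank -ltnNge.
  exact: leq_ltn_trans (rank_leq_col _) JI.
case/rowV0Pn => v /sub_kermxP vM v0; exists (fun i => v 0 (enum_rank i)); split.
  apply: contrapT => h; case/eqP: v0; apply/rowP => i; rewrite mxE.
  apply: contrapT => /eqP vi; apply: h; exists (enum_val i).
  by rewrite enum_valK.
move=> t; under eq_bigr => i _ do rewrite uE mulr_sumr.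
rewrite exchange_big /= big1 // => j _.
transitivity ((v *m M) 0 (enum_rank j) * b j t); last by rewrite vM mxE mul0r.
rewrite mxE mulr_suml (reindex (fun i : 'I_#|I| => enum_val i)) /=; last first.
  by exists enum_rank => ? _; rewrite ?enum_valK ?enum_rankK.
by apply: eq_bigr => i _; rewrite mxE enum_valK enum_rankK mulrA.
Qed.

(** Bounding each exponent, rather than the total degree, makes the number of monomials exactly
    [T ^ k]. *)
Definition box_mnm k T (e : {ffun 'I_k -> 'I_T}) : 'X_{1..k} :=
  [multinom (e i : nat) | i < k].

Definition box_mpoly k T (c : {ffun 'I_k -> 'I_T} -> K) : {mpoly K[k]} :=
  \sum_e c e *: 'X_[box_mnm e].

Lemma box_mnm_inj k T : injective (@box_mnm k T).
Proof.
move=> e e' /mnmP h; apply/ffunP => i; apply: val_inj.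
by have := h i; rewrite !mnmE.
Qed.

Lemma box_mpoly_neq0 k T (c : {ffun 'I_k -> 'I_T} -> K) e :
  c e != 0 -> box_mpoly c != 0.
Proof.
apply: contra_neq => /(congr1 (mcoeff (box_mnm e))); rewrite mcoeff0 => <-.
rewrite raddf_sum (bigD1 e) //= mcoeffZ mcoeffX eqxx mulr1 big1 ?addr0 // => e' ne.
by rewrite mcoeffZ mcoeffX (inj_eq (@box_mnm_inj k T)) (negbTE ne) mulr0.
Qed.

Lemma meval_box k T (c : {ffun 'I_k -> 'I_T} -> K) x :
  (box_mpoly c).@[x] = \sum_e c e * \prod_i x i ^+ e i.
Proof.
rewrite raddf_sum; apply: eq_bigr => e _; rewrite /= mevalZ mevalX.
by congr (_ * _); apply: eq_bigr => i _; rewrite mnmE.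
Qed.

Lemma meval_box_coef k T (p : {mpoly K[k]}) : (msize p <= T)%N ->
  exists c : {ffun 'I_k -> 'I_T} -> K,
    forall x, p.@[x] = \sum_e c e * \prod_i x i ^+ e i.
Proof.
move=> sp; exists (fun e => p@_(box_mnm e)) => x.
rewrite -meval_box; congr (_.@[_]); apply/mpolyP => m.
rewrite raddf_sum /=.
have [[e ->]|ne] := pselect (exists e : {ffun 'I_k -> 'I_T}, m = box_mnm e).
  rewrite (bigD1 e) //= mcoeffZ mcoeffX eqxx mulr1 big1 ?addr0 // => e' ne.
  by rewrite mcoeffZ mcoeffX (inj_eq (@box_mnm_inj k T)) (negbTE ne) mulr0.
rewrite big1 => [|e _]; last first.
  rewrite mcoeffZ mcoeffX; case: eqP => [e'|_]; last by rewrite mulr0.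
  by case: ne; exists e.
apply: contrapT => /eqP; rewrite -mcoeff_msupp => /msize_mdeg_lt mp; apply: ne.
have hm i : (m i < T)%N.
  apply: leq_ltn_trans (leq_trans mp sp).
  by rewrite mdegE (bigD1 i) //= leq_addr.
by exists [ffun i => Ordinal (hm i)]; apply/mnmP => i; rewrite mnmE ffunE.
Qed.

(** Since [(T * D).+1 <= T * D.+1], it is enough that [c * D.+1 ^ k < T], which is how [T] is
    chosen. *)
Lemma box_count c k D (T := (c * D.+1 ^ k).+1) :
  (c * (T * D).+1 ^ k < T ^ k.+1)%N.
Proof.
have TD : ((T * D).+1 <= T * D.+1)%N by rewrite mulnS /T; lia.
apply: (@leq_ltn_trans (c * (T * D.+1) ^ k)%N).
  by rewrite leq_mul2l; apply/orP; right; case: (k) => // k'; rewrite leq_exp2r.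
rewrite expnMn expnS mulnCA mulnC ltn_pmul2r ?expn_gt0 //; exact: ltnSn.
Qed.

Lemma msizeM_leq k (p q : {mpoly K[k]}) : (msize (p * q) <= (msize p + msize q).-1)%N.
Proof.
have [->|p0] := eqVneq p 0; first by rewrite mul0r msize0.
have [->|q0] := eqVneq q 0; first by rewrite mulr0 msize0.
by rewrite msizeM.
Qed.

(** The [T ^ N] products of powers of the [f i] with exponents less than [T] lie in the span of the
    monomials in [M] variables with exponents at most [T * D], which are fewer. *)
Theorem algebraic_dependence N M (f : 'I_N -> {mpoly K[M]}) : (M < N)%N ->
  exists2 P : {mpoly K[N]}, P != 0 & forall x, P.@[fun i => (f i).@[x]] = 0.
Proof.
move=> MN; pose D := (\sum_i msize (f i))%N; pose T := (1 * D.+1 ^ M).+1.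
have [e||c [[e ce] hc]] := @dependent_of_card {ffun 'I_N -> 'I_T}
    {ffun 'I_M -> 'I_(T * D).+1} ('I_M -> K)
    (fun e x => \prod_i (f i).@[x] ^+ e i) (fun e x => \prod_i x i ^+ e i).
- have [|c hc] := @meval_box_coef M (T * D).+1 (\prod_i f i ^+ e i); last first.
    exists c => x; rewrite -hc rmorph_prod; apply: eq_bigr => i _.
    by rewrite rmorphXn.
  have hX (p : {mpoly K[M]}) k : (msize (p ^+ k) <= (k * msize p).+1)%N.
    elim: k => [|k IHk]; first by rewrite expr0 msize1.
    rewrite exprS; apply: leq_trans (msizeM_leq _ _) _.
    by rewrite mulSn; move: IHk; rewrite -(leq_add2l (msize p)); lia.
  suff : (msize (\prod_i f i ^+ e i) <= (\sum_i e i * msize (f i)).+1)%N.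
    move=> h; apply: leq_trans h _; rewrite ltnS /D big_distrr /=.
    by apply: leq_sum => i _; rewrite leq_mul2r (ltnW (ltn_ord _)) orbT.
  apply: (big_rec2 (fun (q : {mpoly K[M]}) k => msize q <= k.+1)%N); first by rewrite msize1.
  move=> i q k _ hq; apply: leq_trans (msizeM_leq _ _) _.
  by move: (leq_add (hX (f i) (e i)) hq); rewrite addnS addSn; lia.
- rewrite !card_ffun !card_ord; have := box_count 1 M D; rewrite -/T /= mul1n => h.
  by apply: leq_trans h _; rewrite leq_pexp2l.
exists (box_mpoly c); first exact: box_mpoly_neq0 ce.
by move=> x; rewrite meval_box hc.
Qed.

(* Homogenizing a relation between the k.+1 functions f_i / g_i gives forms   *)
(* of degree T * D, with T ^ k.+1 coefficients at our disposal.               *)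
Theorem not_alg_indep_of_growth N (T : Type) (x : T -> 'rV[K]_N) (Y : set 'rV[K]_N)
    (c k : nat) :
  (forall d (f : {mpoly K[N]}), f \is d.-homog ->
     (forall t, ev f (x t) = 0) -> forall y, Y y -> ev f y = 0) ->
  (forall d, exists (J : finType) (b : J -> T -> K), (#|J| <= c * d.+1 ^ k)%N /\
     forall f : {mpoly K[N]}, f \is d.-homog ->
       exists a : J -> K, forall t, ev f (x t) = \sum_j a j * b j t) ->
  ~ has_alg_indep Y k.+1.
Proof.
move=> hY hJ [d [f [g [fg indep]]]].
pose D := (\sum_i d i)%N; pose m := (c * D.+1 ^ k).+1.
pose u (e : {ffun 'I_k.+1 -> 'I_m}) := \prod_i (f i ^+ e i * g i ^+ (m - e i)).
have hu e : u e \is (m * D)%N.-homog.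
  rewrite /D big_distrr; apply: dhomog_bigprod => i _ /=.
  have [hf hg] := fg i; rewrite [(m * _)%N]mulnC.
  have -> : (d i * m = d i * e i + d i * (m - e i))%N.
    by rewrite -mulnDr subnKC // ltnW.
  by apply: dhomogM; apply: dhomogMn.
have [J [b [cJ hb]]] := hJ (m * D)%N.
have [e||a [[e ae] ha]] := @dependent_of_card {ffun 'I_k.+1 -> 'I_m} J T
   (fun e t => ev (u e) (x t)) b.
- exact: hb.
- rewrite card_ffun !card_ord; exact: leq_ltn_trans cJ (box_count c k D).
have [y [Yy gy]] := indep _ (box_mpoly_neq0 ae).
have g0 : \prod_i ev (g i) y ^+ m != 0.
  by apply/prodf_neq0 => i _; rewrite expf_neq0.
case/eqP; apply: (mulfI g0).
rewrite mulr0 meval_box mulr_sumr.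
transitivity (ev (\sum_e a e *: u e) y); last first.
  apply: (hY (m * D)%N) => //; first by apply: rpred_sum => i _; apply: rpredZ.
  by move=> t; rewrite -[RHS](ha t) /ev raddf_sum; apply: eq_bigr => i _; rewrite /= mevalZ.
rewrite /ev raddf_sum; apply: eq_bigr => i _ /=; rewrite mevalZ mulrCA; congr (_ * _).
rewrite -big_split rmorph_prod; apply: eq_bigr => j _ /=.
have -> : ev (g j) y ^+ m = ev (g j) y ^+ i j * ev (g j) y ^+ (m - i j).
  by rewrite -exprD subnKC // ltnW.
rewrite rmorphM !rmorphXn /=.
rewrite expr_div_n mulrAC [_ ^+ i j * _]mulrC divfK //.
by rewrite expf_neq0 //; apply: gy.
Qed.

Lemma has_alg_indep_anti N (Y : set 'rV[K]_N) k k' : (k <= k')%N ->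
  has_alg_indep Y k' -> has_alg_indep Y k.
Proof.
move=> kk' [d [f [g [fg indep]]]]; pose w := widen_ord kk'.
exists (d \o w), (f \o w), (g \o w); split=> [i|P P0]; first exact: fg.
have [|y [Yy gy Py]] := indep (P \mPo [tuple 'X_(w i) | i < k]).
  (* [s] kills the additional variables and so is a left inverse of the inclusion of variables,
     which therefore keeps [P] nonzero. *)
  pose s : k'.-tuple {mpoly K[k]} := [tuple if insub (val j) is Some i then 'X_i else 0 | j < k'].
  apply: contra_neq P0 => P0; rewrite -[P]/(idfun P).
  rewrite -(_ : (comp_mpoly s \o comp_mpoly [tuple 'X_(w i) | i < k]) P = idfun P).
    by rewrite /= P0 comp_mpoly0.
  apply: mpoly_morph_ext => [a|i] /=; first by rewrite !comp_mpolyC.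
  rewrite comp_mpolyXU -tnth_nth tnth_mktuple comp_mpolyXU -tnth_nth tnth_mktuple /=.
  case: insubP => [j _ /val_inj -> //|]; by rewrite ltn_ord.
exists y; split=> // [i|]; first exact: gy.
move: Py; rewrite comp_mpoly_meval; congr (_ != 0); apply: meval_eq => i.
by rewrite tnth_mktuple mevalXU.
Qed.

Lemma has_dim_inj N (Y : set 'rV[K]_N) k k' : has_dim Y k -> has_dim Y k' -> k = k'.
Proof.
move=> [h1 h2] [h1' h2']; have [h|h|//] := ltngtP k k'.
  by case: h2; apply: has_alg_indep_anti h h1'.
by case: h2'; apply: has_alg_indep_anti h h1.
Qed.

End Counting.

(** * Linear subspaces, Zariski topology and restriction to lines *)

Section LinearSubspaces.
Variable K : fieldType.

Lemma linear_of_dim_rank N r (V : 'M[K]_(r, N)) d : \rank V = d.+1 ->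
  linear_of_dim [set v : 'rV_N | v != 0 /\ (v <= V)%MS] d.
Proof.
move=> rV; have := row_base_free V; have := eq_row_base V.
move: (row_base V); rewrite rV => B BV fB; exists B; split=> //.
by apply/seteqP; split => v /= [v0]; rewrite BV.
Qed.

Lemma pairingE N (h v : 'rV[K]_N) : pairing h v = (v *m h^T) 0 0.
Proof. by rewrite mxE; apply: eq_bigr => i _; rewrite mxE mulrC. Qed.

Lemma pairing_eq0 N (h v : 'rV[K]_N) : (pairing h v = 0) <-> (v <= kermx h^T)%MS.
Proof.
rewrite pairingE; split => [e|/sub_kermxP ->]; last by rewrite mxE.
by apply/sub_kermxP/rowP => i; rewrite ord1 e mxE.
Qed.

Lemma linear_of_dim_hyperplane d (h : 'rV[K]_d.+2) : h != 0 ->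
  linear_of_dim (hyperplane h) d.
Proof.
move=> h0; rewrite (_ : hyperplane h = [set v | v != 0 /\ (v <= kermx h^T)%MS]).
  apply: linear_of_dim_rank; rewrite mxrank_ker mxrank_tr.
  by rewrite rank_rV h0 subn1.
by apply/seteqP; split => v /= [v0 /pairing_eq0].
Qed.

(** A linear form vanishing on the kernel of [h] is a multiple of [h]; the columns of [cokermx h]
    provide enough vectors of this kernel. *)
Lemma hyperplane_sub N (h k : 'rV[K]_N) : h != 0 -> k != 0 ->
  hyperplane h `<=` hyperplane k -> exists2 c, c != 0 & k = c *: h.
Proof.
move=> h0 k0 hk.
have /sub_rVP [c kc] : (k <= h)%MS.
  rewrite submxE; apply/eqP; apply/rowP => j.
  rewrite [RHS]mxE.
  pose v : 'rV_N := (col j (cokermx h))^T.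
  have e : k *m cokermx h = \row_j pairing k (col j (cokermx h))^T.
    by apply/rowP => i; rewrite !mxE; apply: eq_bigr => l _; rewrite !mxE.
  rewrite e mxE -/v; have [->|v0] := eqVneq v 0.
    by rewrite /pairing big1 // => i _; rewrite mxE mulr0.
  have [] // := hk v; split=> //; have := mulmx_coker h.
  move=> /rowP /(_ j); rewrite [in RHS]mxE => <-.
  by rewrite !mxE; apply: eq_bigr => l _; rewrite !mxE.
exists c => //; by apply: contra_neq k0 => c0; rewrite kc c0 scale0r.
Qed.

Lemma linear_of_dim_full N d :
  linear_of_dim [set v : 'rV[K]_N | v != 0] d -> (N <= d.+1)%N.
Proof.
move=> [A [fA e]]; apply: leq_trans (rank_leq_row A).
rewrite -{1}(mxrank1 K N); apply: mxrankS.
apply/row_subP => i.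
have [->|ri] := eqVneq (row i (1%:M : 'M[K]_N)) 0; first exact: sub0mx.
suff /= [] : [set v : 'rV[K]_N | v != 0 /\ (v <= A)%MS] (row i (1%:M : 'M[K]_N)) by [].
by rewrite -e.
Qed.

End LinearSubspaces.

Section Zariski.
Variables (K : fieldType) (N : nat).
Implicit Types (S Z U : set 'rV[K]_N) (f g : {mpoly K[N]}).

Lemma zclosed_homog (E : set {mpoly K[N]}) :
  (forall f, E f -> exists d, f \is d.-homog) ->
  zclosed [set v | v != 0 /\ forall f, E f -> ev f v = 0].
Proof. by exists E. Qed.

Definition basic_open g : set 'rV[K]_N := [set v | v != 0 /\ ev g v != 0].

Lemma zopen_basic d g : g \is d.-homog -> zopen (basic_open g).
Proof.
move=> hg; exists [set v | v != 0 /\ forall f, [set g] f -> ev f v = 0].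
  by apply: zclosed_homog => f ->; exists d.
apply/seteqP; split => v /= [v0 gv]; split => //.
  by move=> [_ /(_ g erefl)] e; rewrite e eqxx in gv.
by apply/eqP => e; apply: gv; split=> // f ->.
Qed.

Lemma zopen_basic_sub U v : zopen U -> U v ->
  exists d g, [/\ g \is d.-homog, ev g v != 0 & basic_open g `<=` U].
Proof.
move=> [Z [E [hE ->]] ->] [/= v0 /not_andP [//|/existsNP [g /not_implyP [Eg gv]]]].
have [d hd] := hE _ Eg; exists d, g; split=> //; first exact/eqP.
move=> w [w0 gw]; split=> // - [_ /(_ _ Eg) e]; by rewrite e eqxx in gw.
Qed.

Lemma ev_scale d f t (v : 'rV[K]_N) : f \is d.-homog ->
  ev f (t *: v) = t ^+ d * ev f v.
Proof.
move=> hf; rewrite /ev -(meval_dhomog _ _ hf); apply: meval_eq => i.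
by rewrite mxE.
Qed.

End Zariski.

Section Slice.
Variables (n : nat) (A : comNzRingType).

Lemma mnm_le_mdeg (m : 'X_{1..n}) i : (m i <= mdeg m)%N.
Proof. by rewrite mdegE (bigD1 i) //= leq_addr. Qed.

Lemma mnm_eq_mdeg (m : 'X_{1..n}) i : m i = mdeg m -> m = (U_(i) *+ mdeg m)%MM.
Proof.
move=> mi; apply/mnmP => j; rewrite mulmnE mnm1E.
have [<-|/negbTE ni] := eqVneq i j; first by rewrite mul1n.
move: mi; rewrite mdegE (bigD1 i) //= (bigD1 j) /= 1?eq_sym ?ni //.
by rewrite mul0n; lia.
Qed.

Variables (F : {mpoly A[n]}) (i : 'I_n) (h : 'I_n -> A).

(** The restriction of [F] to the line through [h] parallel to the [i]-th axis. If the pure power of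
    the [i]-th variable occurs in the form [F], its degree is that of [F] for every [h]. *)
Definition slice : {poly A} := mmap polyC (fun j => if j == i then 'X else (h j)%:P) F.

Lemma horner_slice t : slice.[t] = F.@[fun j => if j == i then t else h j].
Proof.
rewrite -[LHS]/((horner_eval t \o mmap polyC (fun j => if j == i then 'X else (h j)%:P)) F).
apply: mpoly_morph_ext => [c|j] /=.
  by rewrite mmapC /horner_eval hornerC mevalC.
by rewrite mmapX mmap1U /horner_eval mevalXU; case: ifP; rewrite ?hornerX ?hornerC.
Qed.

Lemma sliceE : slice =
  \sum_(m <- msupp F) F@_m *: ((\prod_(j | j != i) h j ^+ m j) *: 'X^(m i)).
Proof.
apply: eq_bigr => m _; rewrite mul_polyC; congr (_ *: _).
rewrite /mmap1 (bigD1 i) //= eqxx mulrC -mul_polyC; congr (_ * _).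
rewrite rmorph_prod; apply: eq_bigr => j /negbTE ->.
by rewrite rmorphXn.
Qed.

Variable d : nat.
Hypothesis hF : F \is d.-homog.

Lemma size_slice : (size slice <= d.+1)%N.
Proof.
rewrite sliceE big_seq; apply: (big_ind (fun q : {poly A} => size q <= d.+1)%N).
- by rewrite size_poly0.
- by move=> q r sq sr; apply: leq_trans (size_polyD _ _) _; rewrite geq_max sq.
move=> m /(dhomogP _ _ _ hF) /= <-; apply: leq_trans (size_scale_leq _ _) _.
by apply: leq_trans (size_scale_leq _ _) _; rewrite size_polyXn ltnS mnm_le_mdeg.
Qed.

Lemma coef_slice : slice`_d = F@_(U_(i) *+ d).
Proof.
have hm m : m \in msupp F -> mdeg m = d by move/(dhomogP _ _ _ hF).
rewrite sliceE coef_sum.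
have coefE m : (F@_m *: ((\prod_(j | j != i) h j ^+ m j) *: 'X^(m i) : {poly A}))`_d =
    if m i == d then F@_m * \prod_(j | j != i) h j ^+ m j else 0.
  by rewrite !coefZ coefXn eq_sym; case: eqP => _; rewrite ?mulr1 ?mulr0 ?mulr0.
under eq_bigr => m _ do rewrite coefE.
rewrite -big_mkcond /=.
have mE m : m \in msupp F -> m i = d -> m = (U_(i) *+ d)%MM.
  by move=> /hm md mi; rewrite -md; apply: mnm_eq_mdeg; rewrite md.
have [mp|mp] := boolP ((U_(i) *+ d)%MM \in msupp F); last first.
  rewrite (memN_msupp_eq0 mp) big_seq_cond big1 // => m /andP [hm' /eqP md].
  by rewrite -(mE _ hm' md) hm' in mp.
rewrite (big_rem _ mp) /= mulmnE mnm1E eqxx mul1n eqxx.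
rewrite [X in _ * X + _]big1 ?mulr1 => [|j ji]; last first.
  by rewrite mulmnE mnm1E eq_sym (negbTE ji) mul0n expr0.
rewrite big_seq_cond big1 ?addr0 => [//|m /andP []].
rewrite mem_rem_uniq ?msupp_uniq // inE => /andP [ne hm'] /eqP md.
by rewrite (mE _ hm' md) eqxx in ne.
Qed.

End Slice.

Lemma size_slice_eq n (A : comNzRingType) (F : {mpoly A[n]}) i h d :
  F \is d.-homog -> F@_(U_(i) *+ d) != 0 -> size (slice F i h) = d.+1.
Proof.
move=> hF c0; apply/eqP; rewrite eqn_leq (size_slice _ _ hF) ltnNge.
by apply: contra c0 => s; rewrite -(coef_slice i h hF) nth_default.
Qed.

Section Monic.
Variables (K : fieldType) (m d : nat) (F : {mpoly K[m.+2]}).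
Notation x0 := (ord0 : 'I_m.+2).
Notation x1 := (lift ord0 ord0 : 'I_m.+2).
Notation xr j := (lift ord0 (lift ord0 j) : 'I_m.+2).

Lemma var_ind (P : 'I_m.+2 -> Prop) :
  P x0 -> P x1 -> (forall j : 'I_m, P (xr j)) -> forall i, P i.
Proof.
move=> P0 P1 Pr i; have [j ->|-> //] := unliftP ord0 i.
by have [k ->|->] := unliftP ord0 j.
Qed.

Lemma big_var (R : Type) (idx : R) (op : Monoid.law idx) (f : 'I_m.+2 -> R) :
  \big[op/idx]_i f i = op (f x0) (op (f x1) (\big[op/idx]_(j < m) f (xr j))).
Proof. by rewrite !big_ord_recl. Qed.

(* As the last exponent of a monomial of given degree is determined by the    *)
(* others, the forms of degree e are spanned on the zeros of F by at most     *)
(* d * e.+1 ^ m monomials, those of degree less than d in the variable x1.    *)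
Lemma monic_growth : F \is d.-homog -> F@_(U_(x1) *+ d) != 0 -> forall e,
  exists (J : finType) (b : J -> {x : 'rV_m.+2 | ev F x = 0} -> K),
    (#|J| <= d * e.+1 ^ m)%N /\
    forall f : {mpoly K[m.+2]}, f \is e.-homog ->
      exists a : J -> K, forall t, ev f (sval t) = \sum_j a j * b j t.
Proof.
move=> hF c0 e; pose J := ('I_d * {ffun 'I_m -> 'I_e.+1})%type.
pose b (j : J) (t : {x : 'rV_m.+2 | ev F x = 0}) :=
  sval t 0 x0 ^+ (e - j.1 - \sum_k j.2 k) * (sval t 0 x1 ^+ j.1 *
    \prod_k sval t 0 (xr k) ^+ j.2 k).
exists J, b; split; first by rewrite card_prod card_ffun !card_ord.
pose spanned (f : {mpoly K[m.+2]}) :=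
  exists a : J -> K, forall t, ev f (sval t) = \sum_j a j * b j t.
have spZ c f : spanned f -> spanned (c *: f).
  case=> a ha; exists (fun j => c * a j) => t.
  by rewrite /ev mevalZ [X in _ * X]ha mulr_sumr; apply: eq_bigr => j _; rewrite mulrA.
have spD f g : spanned f -> spanned g -> spanned (f + g).
  case=> a ha [a' ha']; exists (fun j => a j + a' j) => t.
  rewrite /ev rmorphD /= [X in X + _]ha [X in _ + X]ha' -big_split /=.
  by apply: eq_bigr => j _; rewrite mulrDl.
have sp0 : spanned 0.
  by exists (fun=> 0) => t; rewrite /ev meval0 big1 // => j _; rewrite mul0r.
have spX mu : mdeg mu = e -> spanned 'X_[mu].
  have [k] := ubnP (mu x1); elim: k mu => // k IHk mu; rewrite ltnS => muk mue.
  have [mud|mud] := ltnP (mu x1) d.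
    have hmu j : (mu (xr j) < e.+1)%N by rewrite ltnS -mue mnm_le_mdeg.
    pose jm : J := (Ordinal mud, [ffun j => Ordinal (hmu j)]).
    exists (fun j => (j == jm)%:R) => t.
    rewrite (bigD1 jm) //= eqxx mul1r big1 ?addr0 => [|j /negbTE ->]; last by rewrite mul0r.
    rewrite /b /ev mevalX big_var /=; congr (_ ^+ _ * (_ * _)).
      have -> : (\sum_(k0 < m) [ffun j => Ordinal (hmu j)] k0 = \sum_(k0 < m) mu (xr k0))%N.
        by apply: eq_bigr => j _; rewrite ffunE.
      by rewrite -mue mdegE big_var /=; lia.
    by apply: eq_bigr => j _; rewrite ffunE.
  pose mu' := (mu - U_(x1) *+ d)%MM.
  have muE : (mu' + U_(x1) *+ d)%MM = mu.
    apply: submK; apply/mnm_lepP => i; rewrite mulmnE mnm1E.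
    by case: eqP => [<-|_]; rewrite ?mul1n ?mul0n.
  (* On the zeros of [F] the power x_1^d equals [- c^-1] times [F'], whose monomials have smaller
     exponents of x_1, so the induction on this exponent applies. *)
  set c := F@_(U_(x1) *+ d) in c0.
  pose F' := F - c *: 'X_[U_(x1) *+ d].
  have F'E : spanned (- c^-1 *: ('X_[mu'] * F')).
    apply: (spZ); rewrite [F']mpolyE mulr_sumr big_seq; apply: (big_ind spanned) => // nu.
    rewrite mcoeff_msupp /F' mcoeffB mcoeffZ mcoeffX => hnu.
    have nu1 : nu != (U_(x1) *+ d)%MM.
      by apply: contra_neq hnu => ->; rewrite eqxx mulr1 subrr.
    have nuF : nu \in msupp F.
      by move: hnu; rewrite [_%MM == nu]eq_sym (negbTE nu1) mulr0 subr0 -mcoeff_msupp.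
    have nud : mdeg nu = d := dhomogP _ _ _ hF _ nuF.
    rewrite -scalerAr -mpolyXD; apply: (spZ); apply: IHk.
      have : nu x1 != d.
        apply: contra_neq nu1 => e1; rewrite -[in RHS]nud; apply: mnm_eq_mdeg.
        by rewrite e1 nud.
      have := mnm_le_mdeg nu x1; rewrite nud mnmDE /mu' mnmBE mulmnE mnm1E eqxx mul1n.
      by move: muk mud; lia.
    by rewrite -mue -[in RHS]muE !mdegD mdegMn mdeg1 mul1n nud.
  case: F'E => a ha; exists a => t; rewrite -ha -muE mpolyXD /ev mevalZ !mevalM.
  rewrite /F' rmorphB /= mevalZ -[F.@[_]]/(ev F (sval t)) (svalP t) sub0r.
  by rewrite !mulrN !mulNr opprK mulrCA mulKf.
move=> f /dhomogP hf; rewrite [f]mpolyE big_seq; apply: (big_ind spanned) => // mu.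
by move=> /hf /= mue; apply/spZ/spX.
Qed.

End Monic.

Local Notation var0 := (@ord0 _).
Local Notation var1 := (lift ord0 (@ord0 _)).
Local Notation varr j := (lift ord0 (lift ord0 j)).

Lemma dhomog_size n (K : fieldType) (f : {mpoly K[n]}) e : f != 0 -> f \is e.-homog ->
  msize f = e.+1.
Proof.
by move=> f0 /dhomogP hf; rewrite -mlead_deg //; congr _.+1; apply/hf/mlead_supp.
Qed.

Lemma vanishing_homogenization (K : fieldType) m (P : {mpoly K[m]}) :
  exists (Q : {mpoly K[m.+2]}) (s : nat), forall x : 'rV_m.+2, x 0 var0 != 0 ->
    ev Q x = x 0 var0 ^+ s * P.@[fun j => x 0 (varr j) / x 0 var0].
Proof.
exists (\sum_(mu <- msupp P) P@_mu *:
  ('X_var0 ^+ (msize P - mdeg mu) * \prod_j 'X_(varr j) ^+ mu j)), (msize P).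
move=> x x0; rewrite /ev raddf_sum mevalE mulr_sumr; apply: eq_big_seq => mu hmu /=.
rewrite mevalZ mevalM [RHS]mulrCA; congr (_ * _).
have -> : ('X_var0 ^+ (msize P - mdeg mu) : {mpoly K[m.+2]}).@[x 0] =
    x 0 var0 ^+ (msize P - mdeg mu) by rewrite rmorphXn /= mevalXU.
have -> : (\prod_j 'X_(varr j) ^+ mu j : {mpoly K[m.+2]}).@[x 0] =
    \prod_j x 0 (varr j) ^+ mu j.
  by rewrite rmorph_prod; apply: eq_bigr => i _; rewrite rmorphXn /= mevalXU.
have -> : \prod_i (x 0 (varr i) / x 0 var0) ^+ mu i =
    (\prod_i x 0 (varr i) ^+ mu i) / x 0 var0 ^+ mdeg mu.
  rewrite mdegE -prodrXr -prodf_div; apply: eq_bigr => i _; exact: expr_div_n.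
rewrite mulrCA mulrC; congr (_ * _).
have := ltnW (msize_mdeg_lt hmu) => /subnK {2}<-.
by rewrite exprD mulfK // expf_neq0.
Qed.

(** * Hypersurfaces *)

Section Hypersurface.
Variables (K : numClosedFieldType) (m d : nat) (F : {mpoly K[m.+2]}).
Hypotheses (hd : (1 < d)%N) (hF : F \is d.-homog) (pF : prime_elt F).
Hypotheses (c1 : F@_(U_(var1) *+ d) != 0) (cn : F@_(U_(ord_max) *+ d) != 0).

Definition zeros := [set x : 'rV[K]_m.+2 | x != 0 /\ ev F x = 0].

Let F0 : F != 0. Proof. by case: pF. Qed.

Lemma not_divides_small (G : {mpoly K[m.+2]}) :
  G != 0 -> (msize G <= d)%N -> ~ divides F G.
Proof.
move=> G0 sG [q e]; have q0 : q != 0 by apply: contra_neq G0 => q0; rewrite e q0 mul0r.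
move: sG; rewrite e msizeM // (dhomog_size F0 hF) addnS /= leqNgt => /negP; apply.
by rewrite -[X in (X < _)%N]add0n ltn_add2r lt0n msize_poly_eq0.
Qed.

Lemma prime_mul (G H : {mpoly K[m.+2]}) :
  ~ divides F G -> ~ divides F H -> ~ divides F (G * H).
Proof. by case: pF => _ _ h nG nH /h []. Qed.

Lemma not_divides_var i : ~ divides F 'X_i.
Proof.
apply: not_divides_small; last by rewrite msizeX mdeg1.
by rewrite -msize_poly_eq0 msizeX mdeg1.
Qed.

(** The Nullstellensatz is applied to [G] times x_0: a zero of [F] at which this product is nonzero
    is not the origin, hence is a point of the projective space. *)
Lemma generic_zero (G : {mpoly K[m.+2]}) : ~ divides F G ->
  exists x, [/\ x != 0, ev F x = 0 & ev G x != 0].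
Proof.
move=> nG; have := prime_mul nG (@not_divides_var var0).
apply: contra_notP => nx.
have [sF cF] := muni_dhomog hF.
have sF' : size (muni F) = d.+1.
  apply/eqP; rewrite eqn_leq sF ltnNge; apply: contra cn => s.
  by rewrite -(mpolyC_eq0 m.+1) -cF nth_default.
apply: (prime_nullstellensatz (c := F@_(U_(ord_max) *+ d)) pF) => //.
- by rewrite sF'; apply: ltnW.
- by rewrite lead_coefE sF'.
move=> x Fx; rewrite mevalM mevalXU; have [->|x0] := eqVneq (x var0) 0.
  by rewrite mulr0.
have xE (H : {mpoly K[m.+2]}) : ev H (\row_i x i) = H.@[x].
  by apply: meval_eq => i; rewrite mxE.
rewrite -xE; have [->|Gx] := eqVneq (ev G (\row_i x i)) 0; first by rewrite mul0r.
case: nx; exists (\row_i x i); split=> //; last by rewrite xE.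
by apply: contra_neq x0 => /rowP /(_ var0); rewrite !mxE.
Qed.

Lemma vanishing_divides (G : {mpoly K[m.+2]}) :
  (forall x, x != 0 -> ev F x = 0 -> ev G x = 0) -> divides F G.
Proof.
move=> h; apply: contrapT => /generic_zero [x [x0 Fx]].
by rewrite h ?eqxx.
Qed.

Lemma divides_ev (G : {mpoly K[m.+2]}) x : divides F G -> ev F x = 0 -> ev G x = 0.
Proof. by case=> q -> Fx; rewrite /ev mevalM -/(ev F x) Fx mulr0. Qed.

Lemma generic_zero_independent (G : {mpoly K[m.+2]}) (P : {mpoly K[m]}) :
  ~ divides F G -> P != 0 ->
  exists x, [/\ x != 0, ev F x = 0, x 0 var0 != 0, ev G x != 0 &
    P.@[fun j => x 0 (varr j) / x 0 var0] != 0].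
Proof.
move=> nG P0; have [Q [s QP]] := vanishing_homogenization P.
have nQ : ~ divides F Q.
  have [v Pv] := mpoly_nonroot P0.
  (* The line over [v] in the direction of x_1 meets the zeros of [F], as the restriction of [F] to
     it has degree [d]; [Q] is nonzero there, so it is not a multiple of [F]. *)
  pose h (i : 'I_m.+2) : K :=
    if unlift ord0 i is Some j then if unlift ord0 j is Some k then v k else 0 else 1.
  have [t /rootP ft] : exists t, root (slice F var1 h) t.
    by apply/closed_rootP; rewrite (size_slice_eq _ hF c1) eqSS -lt0n ltnW.
  pose x : 'rV_m.+2 := \row_i if i == var1 then t else h i.
  have Fx : ev F x = 0.
    by rewrite -ft horner_slice; apply: meval_eq => i; rewrite mxE.
  move=> /divides_ev /(_ Fx); rewrite QP.
    rewrite (_ : x 0 var0 = 1) ?expr1n ?mul1r; last by rewrite mxE /h unlift_none.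
    apply/eqP; rewrite (meval_eq (v2 := v)) // => j.
    by rewrite mxE /h !liftK divr1.
  by rewrite mxE /h unlift_none oner_eq0.
have /generic_zero [x [x0 Fx]] := prime_mul (prime_mul nG nQ) (@not_divides_var var0).
rewrite /ev !mevalM mevalXU !mulf_eq0 !negb_or => /andP [/andP [Gx Qx] x00].
exists x; split=> //; move: Qx; rewrite -[_.@[_]]/(ev Q x) QP // mulf_eq0 negb_or.
by case/andP.
Qed.

Lemma has_dim_zeros : has_dim zeros m.
Proof.
split.
  (* The functions x_j / x_0 with j at least 2 are independent on the hypersurface. *)
  exists (fun=> 1%N), (fun j => 'X_(varr j)), (fun=> 'X_var0); split.
    by move=> j; split; rewrite dhomogX /= mdeg1.
  move=> P P0; have [x [x0 Fx x00 _ Px]] := generic_zero_independent (@not_divides_var var0) P0.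
  exists x; split=> // [i|]; first by rewrite /ev mevalXU.
  by move: Px; congr (_ != 0); apply: meval_eq => j; rewrite /ev !mevalXU.
apply: (@not_alg_indep_of_growth _ _ {x : 'rV[K]_m.+2 | ev F x = 0} sval _ d).
  by move=> e f _ hf y [_ Fy]; apply: (hf (exist _ y Fy)).
by move=> e; apply: monic_growth.
Qed.

Definition gradient (x : 'rV[K]_m.+2) : 'rV[K]_m.+2 := \row_i ev F^`M(i) x.

Lemma gradient_zeros x : ev F x = 0 -> pairing (gradient x) x = 0.
Proof.
move=> Fx; have /(congr1 (fun p => ev p x)) := euler_dhomog hF.
rewrite /ev mevalM -/(ev F x) Fx mulr0 raddf_sum /= => <-.
by apply: eq_bigr => i _; rewrite mxE mevalM mevalXU mulrC.
Qed.

(** The vanishing ideal is generated by [F], so at a zero of [F] the differential of any of its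
    members is a multiple of the gradient. *)
Lemma tangent_zeros x : ev F x = 0 ->
  tangent_space zeros x = [set v | v != 0 /\ pairing (gradient x) v = 0].
Proof.
move=> Fx; apply/seteqP; split => v /= [v0 h]; split=> //.
  rewrite -(h d F hF); last by move=> y [].
  by apply: eq_bigr => i _; rewrite mxE.
move=> e f hf /= fX; have [q ->] : divides F f.
  by apply: vanishing_divides => y y0 Fy; apply: fX.
transitivity (ev q x * pairing (gradient x) v); last by rewrite h mulr0.
rewrite mulr_sumr; apply: eq_bigr => i _; rewrite mderivM mxE /ev mevalD !mevalM.
by rewrite -/(ev F x) Fx mulr0 add0r mulrA.
Qed.

(** Where the gradient vanishes the tangent space is the whole projective space, of dimension
    [m.+1], whereas the hypersurface has dimension [m]. *)
Lemma smooth_zeros x : smooth_point zeros x <-> zeros x /\ gradient x != 0.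
Proof.
split=> [[Xx [e [dimX linT]]]|[Xx gx]].
  split=> //; apply/eqP => gx; have em := has_dim_inj has_dim_zeros dimX.
  move: linT; rewrite -em tangent_zeros ?gx; last by case: Xx.
  rewrite (_ : [set _ | _] = [set v | v != 0]); first by move/linear_of_dim_full; rewrite ltnn.
  apply/seteqP; split => v /=; first by case.
  by split=> //; rewrite /pairing big1 // => i _; rewrite mxE mul0r.
split=> //; exists m; split; first exact: has_dim_zeros.
rewrite tangent_zeros; last by case: Xx.
exact: linear_of_dim_hyperplane.
Qed.

End Hypersurface.

(** * The contact variety *)

Section PairIndices.
Variable n : nat.

Lemma evn_subproof (k : 'I_n) : (k.*2 < 2 * n)%N.
Proof. by rewrite mul2n ltn_double. Qed.

Lemma odn_subproof (k : 'I_n) : (k.*2.+1 < 2 * n)%N.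
Proof. by rewrite mul2n ltn_Sdouble. Qed.

Lemma half_subproof (i : 'I_(2 * n)) : (i./2 < n)%N.
Proof. by rewrite ltn_half_double -mul2n. Qed.

Definition evn k : 'I_(2 * n) := Ordinal (evn_subproof k).
Definition odn k : 'I_(2 * n) := Ordinal (odn_subproof k).
Definition half_ord i : 'I_n := Ordinal (half_subproof i).

Lemma evnK : cancel evn half_ord.
Proof. by move=> k; apply: val_inj; rewrite /= doubleK. Qed.

Lemma odnK : cancel odn half_ord.
Proof. by move=> k; apply: val_inj; rewrite /= uphalf_double. Qed.

Lemma pair_index (i : 'I_(2 * n)) : i = if odd i then odn (half_ord i) else evn (half_ord i).
Proof.
by apply: val_inj; case: ifP => oi; rewrite -[LHS]odd_double_half oi.
Qed.

Lemma pair_ind (P : 'I_(2 * n) -> Prop) :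
  (forall k, P (evn k)) -> (forall k, P (odn k)) -> forall i, P i.
Proof. by move=> Pe Po i; rewrite (pair_index i); case: ifP. Qed.

Lemma odd_evn k : odd (evn k) = false. Proof. by rewrite /= odd_double. Qed.
Lemma odd_odn k : odd (odn k) = true. Proof. by rewrite /= odd_double. Qed.

Lemma evn_odn k l : (evn k == odn l) = false.
Proof. by apply/eqP => /(congr1 (fun i : 'I_(2 * n) => odd i)); rewrite odd_evn odd_odn. Qed.

Lemma big_pair (V : nmodType) (f : 'I_(2 * n) -> V) :
  \sum_i f i = \sum_k (f (evn k) + f (odn k)).
Proof.
rewrite big_split (bigID (fun i : 'I_(2 * n) => odd i)) /= addrC; congr (_ + _).
  rewrite (reindex_onto evn half_ord) => [|i /negbTE oi]; last first.
    by rewrite [RHS]pair_index oi.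
  by apply: eq_bigl => k; rewrite evnK eqxx odd_double.
rewrite (reindex_onto odn half_ord) => [|i oi]; last by rewrite [RHS]pair_index oi.
by apply: eq_bigl => k; rewrite odnK eqxx /= odd_double.
Qed.

Definition pairf (T : Type) (a b : 'I_n -> T) (i : 'I_(2 * n)) : T :=
  if odd i then b (half_ord i) else a (half_ord i).

Lemma pairf_evn T (a b : 'I_n -> T) k : pairf a b (evn k) = a k.
Proof. by rewrite /pairf odd_evn evnK. Qed.

Lemma pairf_odn T (a b : 'I_n -> T) k : pairf a b (odn k) = b k.
Proof. by rewrite /pairf odd_odn odnK. Qed.

End PairIndices.

(** * The symplectic form, and the map theta with its inverse *)

Section Symplectic.
Variables (K : fieldType) (n : nat).
Implicit Types z v : 'rV[K]_(2 * n).

(** Set up so that [z *m symplectic_mx] is the coefficient vector of the linear form omega(z, .). *)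
Definition symplectic_mx : 'M[K]_(2 * n) :=
  \matrix_(i, j) pairf (fun k => - (i == odn k)%:R) (fun k => (i == evn k)%:R) j.

Lemma symplectic_evn z k : (z *m symplectic_mx) 0 (evn k) = - z 0 (odn k).
Proof.
rewrite mxE (bigD1 (odn k)) //= mxE pairf_evn eqxx mulrN mulr1 big1 ?addr0 // => i.
by rewrite mxE pairf_evn => /negbTE ->; rewrite oppr0 mulr0.
Qed.

Lemma symplectic_odn z k : (z *m symplectic_mx) 0 (odn k) = z 0 (evn k).
Proof.
rewrite mxE (bigD1 (evn k)) //= mxE pairf_odn eqxx mulr1 big1 ?addr0 // => i.
by rewrite mxE pairf_odn => /negbTE ->; rewrite mulr0.
Qed.

Lemma symplectic_invol z : z *m symplectic_mx *m symplectic_mx = - z.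
Proof.
apply/rowP; apply: pair_ind => k; by rewrite !(symplectic_evn, symplectic_odn) [RHS]mxE.
Qed.

Lemma symplectic_unit : symplectic_mx \in unitmx.
Proof.
suff h : symplectic_mx *m (- symplectic_mx) = 1%:M by case/mulmx1_unit: h.
apply/row_matrixP => i; rewrite row_mul rowE mulmxN symplectic_invol opprK.
by rewrite row1.
Qed.

Lemma pairing_symplectic z v : pairing (z *m symplectic_mx) v =
  \sum_k (z 0 (evn k) * v 0 (odn k) - z 0 (odn k) * v 0 (evn k)).
Proof.
rewrite /pairing big_pair; apply: eq_bigr => k _.
by rewrite symplectic_evn symplectic_odn mulNr addrC.
Qed.

End Symplectic.

Local Notation ev0 := (evn (@ord0 _)).
Local Notation od0 := (odn (@ord0 _)).
Local Notation evr j := (evn (lift ord0 j)).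
Local Notation odr j := (odn (lift ord0 j)).

Section Contact.
Variables (m : nat) (A : comNzRingType).

Lemma index_ind (P : 'I_(2 * m.+1) -> Prop) : P ev0 -> P od0 ->
  (forall j : 'I_m, P (evr j)) -> (forall j : 'I_m, P (odr j)) -> forall i, P i.
Proof.
move=> P0 P1 Pe Po; apply: pair_ind => k; by have [j ->|->] := unliftP ord0 k.
Qed.

(** Coordinates come in four kinds: z_0 and z_1, for which theta has separate formulas, then the
    even and the odd ones of the other pairs. *)
Definition four_cases (T : Type) (a b : T) (f g : 'I_m -> T) : 'I_(2 * m.+1) -> T :=
  pairf (fun k => if unlift ord0 k is Some j then f j else a)
        (fun k => if unlift ord0 k is Some j then g j else b).

Lemma four_casesE T (a b : T) f g : ((four_cases a b f g ev0 = a) *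
  (four_cases a b f g od0 = b) * (forall j, four_cases a b f g (evr j) = f j) *
  (forall j, four_cases a b f g (odr j) = g j))%type.
Proof.
rewrite /four_cases !pairf_evn !pairf_odn !unlift_none; split; [split=> // j|move=> j].
  by rewrite pairf_evn liftK.
by rewrite pairf_odn liftK.
Qed.

(* Twice theta, so that no division by 2 is needed. *)
Definition contact (x y : 'I_m.+2 -> A) : 'I_(2 * m.+1) -> A :=
  four_cases (2%:R * (x var0 * y var1)) (x var1 * y var1 - x var0 * y var0)
    (fun j => 2%:R * (x (varr j) * y var1)) (fun j => - (x var0 * y (varr j))).

(* From z = contact x y with \sum_i x_i y_i = 0 this recovers z_0 ^ 2 / x_0 *: x. *)
Definition uncontact (z : 'I_(2 * m.+1) -> A) (i : 'I_m.+2) : A :=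
  if unlift ord0 i is Some j then
    if unlift ord0 j is Some k then z ev0 * z (evr k)
    else z ev0 * z od0 + \sum_k z (evr k) * z (odr k)
  else z ev0 * z ev0.

Lemma uncontactE z : ((uncontact z var0 = (z ev0 * z ev0)%R) *
  (uncontact z var1 = (z ev0 * z od0 + \sum_k z (evr k) * z (odr k))%R) *
  (forall k, uncontact z (varr k) = (z ev0 * z (evr k))%R))%type.
Proof.
rewrite /uncontact !unlift_none liftK unlift_none; split=> // k.
by rewrite !liftK.
Qed.

Lemma sum_var (f : 'I_m.+2 -> A) :
  \sum_i f i = f var0 + f var1 + \sum_(j < m) f (varr j).
Proof. by rewrite big_var /= addrA. Qed.

Lemma contactK (x y : 'I_m.+2 -> A) : \sum_i y i * x i = 0 -> forall i,
  uncontact (contact x y) i = 4%:R * (x var0 * y var1 ^+ 2) * x i.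
Proof.
rewrite sum_var => xy; apply: var_ind => [||j]; rewrite !uncontactE /contact !four_casesE.
- by ring.
- under eq_bigr => k _ do rewrite !four_casesE.
  transitivity (2%:R * x var0 * y var1 * (x var1 * y var1 - x var0 * y var0
    - \sum_k y (varr k) * x (varr k))).
    rewrite [RHS]mulrBr mulr_sumr -sumrN; congr (_ + _); first by ring.
    by apply: eq_bigr => k _; ring.
  have -> : \sum_k y (varr k) * x (varr k) = - (y var0 * x var0) - y var1 * x var1.
    by apply/eqP; rewrite -subr_eq0; apply/eqP; rewrite -[RHS]xy; ring.
  by ring.
by ring.
Qed.

(** Where z_0 and y_1 are nonzero, the two hypotheses determine from [z] the ratios y_j / y_1, first
    for j at least 2 and then for j = 0; so the pair of [uncontact z] and [y] lies over [z]. *)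
Lemma uncontactK (z : 'I_(2 * m.+1) -> A) (y : 'I_m.+2 -> A) :
  \sum_i y i * uncontact z i = 0 ->
  (forall j, 2%:R * z (odr j) * y var1 + y (varr j) * z ev0 = 0) -> forall i,
  contact (uncontact z) y i = 2%:R * z ev0 * y var1 * z i.
Proof.
move=> xy hz; apply: index_ind => [||j|j]; rewrite /contact !four_casesE; last 1 first.
- have := hz j; rewrite !uncontactE => e.
  apply/eqP; rewrite -subr_eq0; apply/eqP.
  transitivity (- z ev0 * (2%:R * z (odr j) * y var1 + y (varr j) * z ev0)); first by ring.
  by rewrite e mulr0.
- by rewrite !uncontactE; ring.
- have e0 : uncontact z var0 * y var0 = - (y var1 * uncontact z var1 +
      \sum_j y (varr j) * uncontact z (varr j)).
    by apply/eqP; rewrite -subr_eq0; apply/eqP; rewrite -[RHS]xy sum_var; ring.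
  rewrite e0 opprK addrA !uncontactE.
  have -> : \sum_j y (varr j) * uncontact z (varr j) =
      - (2%:R * y var1 * \sum_k z (evr k) * z (odr k)).
    rewrite mulr_sumr -sumrN; apply: eq_bigr => j _; rewrite uncontactE.
    apply/eqP; rewrite -subr_eq0; apply/eqP.
    transitivity (z (evr j) * (2%:R * z (odr j) * y var1 + y (varr j) * z ev0)); first by ring.
    by rewrite hz mulr0.
  by ring.
by rewrite !uncontactE; ring.
Qed.

End Contact.

Lemma four_cases_morph m (T U : Type) (f : T -> U) a b g h (i : 'I_(2 * m.+1)) :
  f (four_cases a b g h i) = four_cases (f a) (f b) (f \o g) (f \o h) i.
Proof. by move: i; apply: index_ind => [||j|j]; rewrite !four_casesE. Qed.

Lemma contact_morph m (A B : comNzRingType) (f : {rmorphism A -> B})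
    (x y : 'I_m.+2 -> A) i :
  f (contact x y i) = contact (f \o x) (f \o y) i.
Proof.
rewrite /contact four_cases_morph; move: i; apply: index_ind => [||j|j];
  by rewrite !four_casesE /= ?(rmorphM, rmorphB, rmorphN, rmorph_nat).
Qed.

Lemma uncontact_morph m (A B : comNzRingType) (f : {rmorphism A -> B})
    (z : 'I_(2 * m.+1) -> A) i :
  f (uncontact z i) = uncontact (f \o z) i.
Proof.
move: i; apply: var_ind => [||j]; rewrite !uncontactE ?rmorphD ?rmorphM //=.
by rewrite rmorph_sum; congr (_ + _); apply: eq_bigr => k _; rewrite rmorphM.
Qed.

(** * Koszul derivations and the osculation matrix *)

Section Osculation.
Variables (m : nat) (A : comNzRingType) (F : {mpoly A[m.+2]}).
Implicit Types (p q : {mpoly A[m.+2]}).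

Definition theta_poly : 'I_(2 * m.+1) -> {mpoly A[m.+2]} :=
  contact (fun k => 'X_k) (fun k => F^`M(k)).

(* The Koszul derivations, which are tangent to the zeros of F. *)
Definition koszul k p := F^`M(var1) * p^`M(k) - F^`M(k) * p^`M(var1).

Lemma koszulD k p q : koszul k (p + q) = koszul k p + koszul k q.
Proof. by rewrite /koszul !mderivD; ring. Qed.

Lemma koszulB k p q : koszul k (p - q) = koszul k p - koszul k q.
Proof. by rewrite /koszul !mderivB; ring. Qed.

Lemma koszulM k p q : koszul k (p * q) = koszul k p * q + p * koszul k q.
Proof. by rewrite /koszul !mderivM; ring. Qed.

Lemma koszulC k c : koszul k c%:MP = 0.
Proof. by rewrite /koszul !mderivC !mulr0 subrr. Qed.

Lemma koszulF k : koszul k F = 0.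
Proof. by rewrite /koszul mulrC subrr. Qed.

Lemma koszul_comp k n (p : {mpoly A[n]}) (q : n.-tuple {mpoly A[m.+2]}) :
  koszul k (p \mPo q) = \sum_i (p^`M(i) \mPo q) * koszul k (tnth q i).
Proof.
apply: (derivation_mmap (koszulD k) (koszulM k)) => c.
exact: koszulC.
Qed.

Lemma koszul_sum k (I : Type) (r : seq I) (f : I -> {mpoly A[m.+2]}) :
  koszul k (\sum_(i <- r) f i) = \sum_(i <- r) koszul k (f i).
Proof.
elim: r => [|i r IHr]; last by rewrite !big_cons koszulD IHr.
by rewrite !big_nil -mpolyC0 koszulC.
Qed.

(* The derivatives of theta along the hypersurface, of order at most two, and *)
(* a coordinate vector which makes the matrix square: when it is invertible   *)
(* the other rows span a hyperplane.                                          *)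
Definition osc_mx : 'M[{mpoly A[m.+2]}]_(2 * m.+1) :=
  \matrix_(i, j) four_cases (theta_poly j) (j == od0)%:R
    (fun l => koszul (varr l) (theta_poly j))
    (fun l => koszul (varr l) (koszul (varr l) (theta_poly j))) i.

Definition osc_det := \det osc_mx.

Lemma dhomog_theta_poly d i : F \is d.+1.-homog -> theta_poly i \is d.+1.-homog.
Proof.
move=> hF; have h j k : 'X_j * F^`M(k) \is d.+1.-homog.
  apply: (@dhomogM _ _ _ 1%N); first by rewrite dhomogX /= mdeg1.
  exact: dhomog_mderiv hF.
have h2 j k : 2%:R * ('X_j * F^`M(k)) \is d.+1.-homog.
  by rewrite mulr_natl rpredMn.
move: i; apply: index_ind => [||j|j]; rewrite /theta_poly /contact !four_casesE //.
  exact: rpredB.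
by rewrite rpredN.
Qed.

Lemma dhomog_koszul d e k p : F \is d.-homog -> p \is e.-homog ->
  koszul k p \is (d.-1 + e.-1)%N.-homog.
Proof. by move=> hF hp; apply: rpredB; apply: dhomogM; apply: dhomog_mderiv. Qed.

(** The entries of a row all have the same degree: the coordinates of theta do, a Koszul derivation
    changes all degrees alike, and the coordinate vector has degree 0. *)
Lemma dhomog_osc_det d : F \is d.+1.-homog -> exists e, osc_det \is e.-homog.
Proof.
move=> hF; pose e1 := (d.+1.-1 + d.+1.-1)%N; pose e2 := (d.+1.-1 + e1.-1)%N.
exists (\sum_(i < 2 * m.+1) four_cases d.+1 0%N (fun=> e1) (fun=> e2) i)%N.
apply: dhomog_det => i j; rewrite mxE; move: i; have ht := dhomog_theta_poly _ hF.
apply: index_ind => [||l|l]; rewrite !four_casesE.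
- exact: ht.
- by case: (_ == _); [exact: dhomog1 | exact: rpred0].
- exact: dhomog_koszul.
by apply: dhomog_koszul => //; apply: dhomog_koszul.
Qed.

End Osculation.

Lemma map_mpoly_deriv n (A B : comNzRingType) (f : {rmorphism A -> B})
    (p : {mpoly A[n]}) i : map_mpoly f p^`M(i) = (map_mpoly f p)^`M(i).
Proof.
by apply/mpolyP => mu; rewrite mcoeff_map_mpoly !mcoeff_deriv mcoeff_map_mpoly raddfMn.
Qed.

Section MapOsculation.
Variables (m : nat) (A B : comNzRingType) (f : {rmorphism A -> B}).
Variable F : {mpoly A[m.+2]}.

Lemma map_theta_poly i : map_mpoly f (theta_poly F i) = theta_poly (map_mpoly f F) i.
Proof.
rewrite /theta_poly contact_morph; move: i; apply: index_ind => [||j|j];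
  by rewrite /contact !four_casesE /= ?map_mpolyX ?map_mpoly_deriv.
Qed.

Lemma map_koszul k p : map_mpoly f (koszul F k p) = koszul (map_mpoly f F) k (map_mpoly f p).
Proof. by rewrite /koszul rmorphB !rmorphM /= !map_mpoly_deriv. Qed.

Lemma map_osc_det : map_mpoly f (osc_det F) = osc_det (map_mpoly f F).
Proof.
rewrite /osc_det -det_map_mx; congr (\det _); apply/matrixP => i j; rewrite !mxE.
rewrite four_cases_morph; move: i; apply: index_ind => [||l|l];
  by rewrite !four_casesE /= ?map_koszul ?map_theta_poly // rmorph_nat.
Qed.

End MapOsculation.

Section ContactVariety.
Variables (K : numClosedFieldType) (m d : nat) (F : {mpoly K[m.+2]}).
Hypotheses (hd : (1 < d.+1)%N) (hF : F \is d.+1.-homog) (pF : prime_elt F).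
Hypotheses (c1 : F@_(U_(var1) *+ d.+1) != 0) (cn : F@_(U_(ord_max) *+ d.+1) != 0).
Local Notation N := (2 * m.+1)%N.
Implicit Types (x : 'rV[K]_m.+2) (z v h : 'rV[K]_N) (f : {mpoly K[N]}).

Definition theta_tuple : N.-tuple {mpoly K[m.+2]} := [tuple theta_poly F i | i < N].
Definition theta_row x : 'rV[K]_N := \row_i contact (x 0) (gradient F x 0) i.
Definition pull f : {mpoly K[m.+2]} := f \mPo theta_tuple.

(* The closure of the image of the zeros of F. *)
Definition contact_variety : set 'rV[K]_N :=
  [set z | z != 0 /\ forall f, [set f | (exists e, f \is e.-homog) /\ divides F (pull f)] f ->
    ev f z = 0].

Lemma ev_theta_poly i x : ev (theta_poly F i) x = theta_row x 0 i.
Proof.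
rewrite /ev contact_morph mxE; move: i; apply: index_ind => [||j|j];
  by rewrite /contact !four_casesE /= ?mevalXU ?mxE.
Qed.

Lemma ev_pull f x : ev (pull f) x = ev f (theta_row x).
Proof.
rewrite /ev comp_mpoly_meval; apply: meval_eq => i.
by rewrite tnth_mktuple -/(ev _ _) ev_theta_poly.
Qed.

Lemma theta_row_ev0 x : theta_row x 0 ev0 = 2%:R * (x 0 var0 * ev F^`M(var1) x).
Proof. by rewrite mxE /contact four_casesE mxE. Qed.

(** The pure power of x_1 occurs in [F], so in characteristic zero the derivative is nonzero; its
    degree is too small for a multiple of [F]. *)
Lemma not_divides_deriv1 : ~ divides F F^`M(var1).
Proof.
have n0 : F^`M(var1) != 0.
  apply: contra_neq c1 => /(congr1 (mcoeff (U_(var1) *+ d))).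
  rewrite mcoeff0 mcoeff_deriv -mulmSr => /eqP; rewrite Num.Theory.mulrn_eq0.
  by case/orP => // /eqP.
apply: (not_divides_small hF pF n0).
by rewrite (dhomog_size n0 (dhomog_mderiv _ hF)).
Qed.

Lemma not_divides_theta0 : ~ divides F (theta_poly F ev0).
Proof.
have [x [x0 Fx nz]] := generic_zero hd hF pF cn
  (prime_mul pF (not_divides_var hd hF pF (i := var0)) not_divides_deriv1).
move=> /divides_ev /(_ Fx); rewrite ev_theta_poly theta_row_ev0 => /eqP.
move: nz; rewrite /ev mevalM mevalXU => nz.
by rewrite mulf_eq0 (negbTE nz) Num.Theory.pnatr_eq0.
Qed.

Lemma zclosed_contact_variety : zclosed contact_variety.
Proof. by apply: zclosed_homog => f []. Qed.

Lemma theta_in_variety x : ev F x = 0 -> theta_row x != 0 -> contact_variety (theta_row x).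
Proof.
move=> Fx t0; split=> // f [_ /divides_ev /(_ Fx)].
by rewrite ev_pull.
Qed.

Lemma theta_row_neq0 x : ev (theta_poly F ev0) x != 0 -> theta_row x != 0.
Proof.
by rewrite ev_theta_poly; apply: contra_neq => ->; rewrite mxE.
Qed.

(* A form vanishing on C pulls back into the ideal of F, so C inherits the    *)
(* irreducibility of the zeros of F.                                          *)
Lemma vanishing_pull f : (forall z, contact_variety z -> ev f z = 0) -> divides F (pull f).
Proof.
move=> hf; have : divides F (theta_poly F ev0 * pull f).
  apply: (vanishing_divides hd hF pF cn) => x x0 Fx.
  rewrite {1}/ev mevalM -!/(ev _ _); have [->|t0] := eqVneq (ev (theta_poly F ev0) x) 0.
    by rewrite mul0r.
  by rewrite ev_pull hf ?mulr0 //; apply/theta_in_variety/theta_row_neq0.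
by case: pF => _ _ h /h [/not_divides_theta0|].
Qed.

Lemma variety_contact : variety contact_variety.
Proof.
split; first exact: zclosed_contact_variety.
split.
  have [x [x0 Fx nz]] := generic_zero hd hF pF cn not_divides_theta0.
  by exists (theta_row x); apply/theta_in_variety/theta_row_neq0.
have witness Z : zclosed Z -> ~ contact_variety `<=` Z ->
    exists2 f, (exists e, f \is e.-homog) /\ ~ divides F (pull f) &
      forall z, Z z -> ev f z = 0.
  move=> [E [hE ->]] /existsNP [z /not_implyP [Cz /not_andP [nz|]]].
    by case: nz; case: Cz.
  move=> /existsNP [f /not_implyP [Ef fz]]; exists f; last by move=> w [_ /(_ _ Ef)].
  split; first exact: hE.
  by move=> df; apply: fz; case: Cz => _; apply; split=> //; apply: hE.
move=> Z1 Z2 cZ1 cZ2 C12; apply: contrapT => /not_orP [/(witness _ cZ1) [f1 [_ n1] h1]].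
move=> /(witness _ cZ2) [f2 [_ n2] h2]; apply: (prime_mul pF n1 n2).
rewrite -rmorphM; apply: vanishing_pull => z /C12 [/h1|/h2] e.
  by rewrite /ev mevalM [X in X * _]e mul0r.
by rewrite /ev mevalM [X in _ * X]e mulr0.
Qed.

Lemma generic_contact f : ~ divides F (pull f) ->
  exists x, [/\ ev F x = 0, ev f (theta_row x) != 0 & contact_variety (theta_row x)].
Proof.
move=> nf; have [x [x0 Fx]] := generic_zero hd hF pF cn (prime_mul pF nf not_divides_theta0).
rewrite {1}/ev mevalM -!/(ev _ _) mulf_eq0 negb_or ev_pull => /andP [fx tx].
by exists x; split=> //; apply/theta_in_variety/theta_row_neq0.
Qed.

Lemma vanishing_theta f : (forall x, ev F x = 0 -> ev f (theta_row x) = 0) ->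
  divides F (pull f).
Proof.
by move=> h; apply: (vanishing_divides hd hF pF cn) => x x0 Fx; rewrite ev_pull h.
Qed.

Lemma has_dim_contact : has_dim contact_variety m.
Proof.
split.
  (* On the image of theta these quotients of coordinates are the functions x_j / x_0 with j at
     least 2. *)
  exists (fun=> 1%N), (fun j => 'X_(evr j)), (fun=> 'X_ev0); split.
    by move=> j; split; rewrite dhomogX /= mdeg1.
  move=> P P0.
  have [x [x0 Fx x00 t0 Px]] := generic_zero_independent hd hF pF c1 cn not_divides_theta0 P0.
  exists (theta_row x); split.
  - exact/theta_in_variety/theta_row_neq0.
  - by move=> _; rewrite /ev mevalXU -ev_theta_poly.
  move: Px t0; rewrite ev_theta_poly theta_row_ev0 !mulf_eq0 !negb_or.
  move=> Px /andP [n2 /andP [_ y1]]; move: Px; congr (_ != 0); apply: meval_eq => j.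
  rewrite /ev !mevalXU !mxE /contact !four_casesE !mxE.
  by field; rewrite x00 y1.
(* A form of degree e pulls back to a form of degree [d.+1 * e]; this accounts for the factor
   [d.+1 ^ m] in the constant. *)
apply: (@not_alg_indep_of_growth _ _ {x : 'rV[K]_m.+2 | ev F x = 0}
  (theta_row \o sval) _ (d.+1 * d.+1 ^ m)).
  move=> e f hf hv z [_ hz]; apply: hz; split; first by exists e.
  by apply: vanishing_theta => x Fx; apply: (hv (exist _ x Fx)).
move=> e; have [J [b [cJ hb]]] := monic_growth hF c1 (d.+1 * e).
exists J, b; split.
  apply: leq_trans cJ _; rewrite -mulnA -expnMn leq_mul2l /=.
  by case: (m) => // m'; rewrite leq_exp2r //; lia.
move=> f hf; have [|a ha] := hb (pull f).
  rewrite mulnC; apply: dhomog_comp hf _ => i; rewrite tnth_mktuple.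
  exact: dhomog_theta_poly.
by exists a => t; rewrite -ha ev_pull.
Qed.

End ContactVariety.

(** * Bihomogeneous forms and the proper image of the conormal variety *)

Section Bihomogeneous.
Variables (K : fieldType) (n : nat).
Implicit Types (f g : {mpoly K[n.+1 + n.+1]}).

Lemma bihomogM a b a' b' f g : bihomog a b f -> bihomog a' b' g ->
  bihomog (a + a') (b + b') (f * g).
Proof.
move=> hf hg mu /msuppM_le /allpairsP [[m1 m2] /= [/hf [<- <-] /hg [<- <-] ->]].
by split; rewrite -big_split; apply: eq_bigr => i _; rewrite mnmDE.
Qed.

Lemma bihomogD a b f g : bihomog a b f -> bihomog a b g -> bihomog a b (f + g).
Proof. by move=> hf hg mu /msuppD_le; rewrite mem_cat => /orP [/hf|/hg]. Qed.

Lemma bihomogZ a b c f : bihomog a b f -> bihomog a b (c *: f).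
Proof. by move=> hf mu /msuppZ_le /hf. Qed.

Lemma bihomogN a b f : bihomog a b f -> bihomog a b (- f).
Proof. by move=> hf mu; rewrite (perm_mem (msuppN f)) => /hf. Qed.

Lemma bihomog1 : bihomog 0 0 (1 : {mpoly K[n.+1 + n.+1]}).
Proof.
move=> mu; rewrite msupp1 inE => /eqP ->.
by split; rewrite big1 // => i _; rewrite mnm0E.
Qed.

Lemma bihomog_comp N e a b (f : {mpoly K[N]}) (w : 'I_N -> {mpoly K[n.+1 + n.+1]}) :
  f \is e.-homog -> (forall i, bihomog a b (w i)) ->
  bihomog (e * a) (e * b) (f \mPo [tuple w i | i < N]).
Proof.
move=> /dhomogP hf hw; rewrite comp_mpolyE big_seq.
apply: (big_ind (bihomog (e * a) (e * b))) => [mu||mu /hf /= <-].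
- by rewrite msupp0.
- by move=> p q; apply: bihomogD.
apply: bihomogZ; rewrite mdegE !big_distrl /=.
apply: (big_rec3 (fun (p : {mpoly K[n.+1 + n.+1]}) k l => bihomog l k p)).
  exact: bihomog1.
move=> i k l p _ hp; apply: bihomogM => //; rewrite tnth_mktuple.
elim: (mu i) => [|s IHs]; first by rewrite expr0; apply: bihomog1.
by rewrite exprS !mulSn; apply: bihomogM.
Qed.

Lemma bihomog_xvar k : bihomog 1 0 (xvar K n k).
Proof.
move=> mu; rewrite msuppX inE => /eqP ->; split.
  rewrite (bigD1 (inord k)) //= mnm1E eqxx big1 // => i ik.
  by rewrite mnm1E (inj_eq (@lshift_inj _ _)) eq_sym (negbTE ik).
by rewrite big1 // => i _; rewrite mnm1E eq_lrshift.
Qed.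

Lemma bihomog_yvar k : bihomog 0 1 (yvar K n k).
Proof.
move=> mu; rewrite msuppX inE => /eqP ->; split.
  by rewrite big1 // => i _; rewrite mnm1E eq_rlshift.
rewrite (bigD1 (inord k)) //= mnm1E eqxx big1 // => i ik.
by rewrite mnm1E (inj_eq (@rshift_inj _ _)) eq_sym (negbTE ik).
Qed.

Lemma biev_scale a b f (x y : 'rV[K]_n.+1) t : bihomog a b f ->
  biev f (x, t *: y) = t ^+ b * biev f (x, y).
Proof.
move=> hf; rewrite /biev !mevalE mulr_sumr; apply: eq_big_seq => mu /hf /= [_ <-].
rewrite mulrCA; congr (_ * _); rewrite !big_split_ord /= mulrCA; congr (_ * _).
  by apply: eq_bigr => i _; rewrite !row_mxEl.
rewrite -prodrXr -big_split; apply: eq_bigr => i _.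
by rewrite !row_mxEr mxE exprMn.
Qed.

Lemma biev_comp N (f : {mpoly K[N]}) (w : 'I_N -> {mpoly K[n.+1 + n.+1]}) p :
  biev (f \mPo [tuple w i | i < N]) p = ev f (\row_i biev (w i) p).
Proof.
rewrite /biev comp_mpoly_meval; apply: meval_eq => i.
by rewrite tnth_mktuple mxE.
Qed.

End Bihomogeneous.

Section Theta.
Variables (K : numClosedFieldType) (m : nat).

Lemma theta_four_cases (i : 'I_(2 * m.+1)) : theta K i = four_cases
  (xvar K _ 0 * yvar K _ 1) (2^-1 *: (xvar K _ 1 * yvar K _ 1 - xvar K _ 0 * yvar K _ 0))
  (fun j : 'I_m => xvar K _ j.+2 * yvar K _ 1)
  (fun j : 'I_m => - 2^-1 *: (xvar K _ 0 * yvar K _ j.+2)) i.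
Proof.
move: i; apply: index_ind => [||j|j]; rewrite four_casesE // /theta /=.
  by rewrite odd_double doubleK.
by rewrite odd_double /= uphalf_double.
Qed.

Lemma bihomog_theta (i : 'I_(2 * m.+1)) : bihomog 1 1 (theta K i).
Proof.
have h k l : bihomog 1 1 (xvar K m.+1 k * yvar K m.+1 l).
  by apply: (@bihomogM _ _ 1 0 0 1); [apply: bihomog_xvar | apply: bihomog_yvar].
rewrite theta_four_cases; move: i; apply: index_ind => [||j|j]; rewrite four_casesE //.
  by apply/bihomogZ/bihomogD => //; apply: bihomogN.
by apply: bihomogZ.
Qed.

Lemma biev_theta (i : 'I_(2 * m.+1)) p :
  biev (theta K i) p = 2%:R^-1 * contact (p.1 0) (p.2 0) i.
Proof.
have i0 : inord 0 = var0 :> 'I_m.+2 by apply: val_inj; rewrite /= inordK.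
have i1 : inord 1 = var1 :> 'I_m.+2 by apply: val_inj; rewrite /= inordK.
have ir (j : 'I_m) : inord j.+2 = varr j :> 'I_m.+2.
  by apply: val_inj; rewrite /= inordK ?ltnS.
have n2 : 2%:R != 0 :> K by rewrite Num.Theory.pnatr_eq0.
rewrite theta_four_cases /biev /contact; move: i; apply: index_ind => [||j|j];
  rewrite !four_casesE ?mevalZ ?mevalB !mevalM !mevalXU ?i0 ?i1 ?ir !(row_mxEl, row_mxEr).
- by rewrite mulKf.
- by [].
- by rewrite mulKf.
by rewrite mulrN mulNr.
Qed.

End Theta.

Section ProperImage.
Variables (K : numClosedFieldType) (m d : nat) (F : {mpoly K[m.+2]}).
Hypotheses (hd : (1 < d.+1)%N) (hF : F \is d.+1.-homog) (pF : prime_elt F).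
Hypotheses (c1 : F@_(U_(var1) *+ d.+1) != 0) (cn : F@_(U_(ord_max) *+ d.+1) != 0).

Definition conormal_base : set ('rV[K]_m.+2 * 'rV[K]_m.+2) :=
  [set p | [/\ smooth_point (zeros F) p.1, p.2 != 0 &
               tangent_space (zeros F) p.1 `<=` hyperplane p.2]].

Lemma conormal_base_gradient x : zeros F x -> gradient F x != 0 ->
  conormal_base (x, gradient F x).
Proof.
move=> Xx gx; split=> //=; first exact/(smooth_zeros hd hF pF c1 cn).
by rewrite (tangent_zeros hd hF pF cn) //; case: Xx.
Qed.

Lemma conormal_baseP p : conormal_base p -> zeros F p.1 /\
  exists2 c, c != 0 & p.2 = c *: gradient F p.1.
Proof.
case=> /(smooth_zeros hd hF pF c1 cn) [Xx gx] p2.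
rewrite (tangent_zeros hd hF pF cn); last by case: Xx.
by move=> /(hyperplane_sub gx p2).
Qed.

Lemma conormal_base_incidence : conormal_base `<=` @incidence K m.+1.
Proof.
move=> p cp; have [[x0 Fx] [c c0 e]] := conormal_baseP cp; case: cp => _ p2 _; split=> //.
rewrite e /pairing; under eq_bigr => i _ do rewrite mxE -mulrA.
by rewrite -mulr_sumr -/(pairing _ _) (gradient_zeros hF Fx) mulr0.
Qed.

(** By [conormal_baseP], each point of [conormal_base] is a pair (x, grad F(x)) up to scaling the
    second component, so a bihomogeneous form is tested on these pairs. *)
Definition restrict_gradient (g : {mpoly K[m.+2 + m.+2]}) : {mpoly K[m.+2]} :=
  g \mPo [tuple match split i with inl j => 'X_j | inr j => F^`M(j) end | i < m.+2 + m.+2].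

Lemma ev_restrict_gradient g x : ev (restrict_gradient g) x = biev g (x, gradient F x).
Proof.
rewrite /ev /restrict_gradient comp_mpoly_meval; apply: meval_eq => i.
rewrite tnth_mktuple; case: splitP => j ij.
  by rewrite (_ : i = lshift _ j) ?row_mxEl ?mevalXU //; apply: val_inj.
by rewrite (_ : i = rshift _ j) ?row_mxEr ?mxE //; apply: val_inj.
Qed.

Lemma gradient_neq0 x : theta_row F x 0 ev0 != 0 -> gradient F x != 0.
Proof.
apply: contra_neq => gx.
have g1 : ev F^`M(var1) x = 0 by have /rowP /(_ var1) := gx; rewrite !mxE.
by rewrite theta_row_ev0 g1 !mulr0.
Qed.

(** A point of the rational image is the value at a point of the closure of some representative [w]
    of theta. On the incidence variety [w] is proportional to [theta], so equations are exchanged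
    between the two at the cost of factors which primality removes. Conversely, a form vanishing on
    the rational image vanishes at each [theta_row F x] whose first coordinate is nonzero. *)
Theorem proper_image_conormal :
  proper_image (@theta K m.+1) (conormal (zeros F)) = contact_variety F.
Proof.
have thetaE x : \row_i biev (theta K i) (x, gradient F x) = 2%:R^-1 *: theta_row F x.
  by apply/rowP => i; rewrite !mxE biev_theta.
have n2 : (2%:R : K)^-1 != 0 by rewrite invr_eq0 Num.Theory.pnatr_eq0.
apply/seteqP; split => [z hz|z [z0 hz] Z [E [hE ->]] sub].
  apply: hz; first exact: zclosed_contact_variety.
  move=> q [p [w [cp [[a [b hw]] tw] q0 qE]]]; split=> // f [[e hf] Ff].
  rewrite qE -biev_comp; set g := f \mPo _.
  have hg : bihomog (e * a) (e * b) g by apply: bihomog_comp.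
  have Fg : divides F (restrict_gradient g).
    (* Up to powers of 2, proportionality gives theta_0^e f(w) = w_0^e f(theta), where f(theta)
       vanishes on the hypersurface. The extra factor theta_0 covers the zeros of theta_0 even if
       [e] is 0. *)
    have : divides F (theta_poly F ev0 ^+ e.+1 * restrict_gradient g).
      apply: (vanishing_divides hd hF pF cn) => x x0 Fx.
      have evX : ev (theta_poly F ev0 ^+ e.+1) x = theta_row F x 0 ev0 ^+ e.+1.
        by rewrite -ev_theta_poly /ev rmorphXn.
      rewrite {1}/ev mevalM -!/(ev _ _) evX.
      have [->|t0] := eqVneq (theta_row F x 0 ev0) 0; first by rewrite exprS mul0r mul0r.
      have gx := gradient_neq0 t0.
      rewrite ev_restrict_gradient biev_comp exprS -mulrA -(ev_scale _ _ hf).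
      set r := \row_i _.
      have -> : theta_row F x 0 ev0 *: r = biev (w ev0) (x, gradient F x) *: theta_row F x.
        have inc := conormal_base_incidence (conormal_base_gradient (conj x0 Fx) gx).
        apply/rowP => i; have := tw _ inc i ev0; rewrite !biev_theta !mxE /= => h.
        by apply: (mulfI n2); rewrite [LHS]mulrA [LHS]mulrC h mulrCA.
      by rewrite (ev_scale _ _ hf) -ev_pull (divides_ev Ff Fx) !mulr0.
    case: pF => _ _ h; elim: (e.+1) => [|k IHk]; first by rewrite expr0 mul1r.
    by rewrite exprS -mulrA => /h [/(not_divides_theta0 hd hF pF c1 cn)//|].
  (* As [g] vanishes on [conormal_base], it vanishes on its closure, in particular at [p]. *)
  have [] // := cp [set p | incidence p /\ forall f, [set g] f -> biev f p = 0].
  - by exists [set g]; split=> // _ ->; exists (e * a)%N, (e * b)%N.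
  - move=> p' cp'; split; first exact: conormal_base_incidence.
    move=> _ ->; have [[x0 Fx] [c _]] := conormal_baseP cp'.
    case: p' {cp'} x0 Fx => x y /= x0 Fx ->.
    by rewrite (biev_scale _ _ _ hg) -ev_restrict_gradient (divides_ev Fg Fx) mulr0.
  by move=> _; apply.
split=> // f Ef; apply: hz; split; first exact: hE.
have [e hf] := hE _ Ef.
have : divides F (theta_poly F ev0 * pull F f).
  apply: (vanishing_divides hd hF pF cn) => x x0 Fx.
  rewrite {1}/ev mevalM -!/(ev _ _) ev_theta_poly.
  have [->|t0] := eqVneq (theta_row F x 0 ev0) 0; first by rewrite mul0r.
  have tx : theta_row F x != 0 by apply: contra_neq t0 => ->; rewrite mxE.
  have gx := gradient_neq0 t0.
  have [] := sub (2%:R^-1 *: theta_row F x).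
    exists (x, gradient F x), (@theta K m.+1); split.
    - by move=> Z' _; apply; apply: conormal_base_gradient.
    - split; first by exists 1%N, 1%N => i; apply: bihomog_theta.
      by move=> p _ i j; rewrite mulrC.
    - by rewrite scaler_eq0 negb_or n2.
    - by rewrite thetaE.
  move=> _ /(_ _ Ef) /eqP; rewrite (ev_scale _ _ hf) mulf_eq0 expf_eq0 (negbTE n2) andbF /=.
  by rewrite ev_pull => /eqP ->; rewrite mulr0.
by case: pF => _ _ h /h [/(not_divides_theta0 hd hF pF c1 cn)|].
Qed.

End ProperImage.

(** * The chart of the contact variety and its tangent spaces *)

Section DirectionalDerivative.
Variables (K : fieldType) (n : nat) (z : 'rV[K]_n).
Implicit Types (p q : {mpoly K[n]}) (w : 'rV[K]_n).

Definition dir p w : K := \sum_i ev p^`M(i) z * w 0 i.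

Lemma dirD p q w : dir (p + q) w = dir p w + dir q w.
Proof.
rewrite -big_split; apply: eq_bigr => i _ /=.
by rewrite mderivD /ev mevalD mulrDl.
Qed.

Lemma dirM p q w : dir (p * q) w = dir p w * ev q z + ev p z * dir q w.
Proof.
rewrite mulr_suml mulr_sumr -big_split; apply: eq_bigr => i _ /=.
by rewrite mderivM /ev mevalD !mevalM; ring.
Qed.

Lemma dirX i w : dir 'X_i w = w 0 i.
Proof.
rewrite /dir (bigD1 i) //= mderivX mnm1E eqxx scale1r big1 => [|j /negbTE ji].
  rewrite (_ : (U_(i) - U_(i))%MM = 0%MM) ?mpolyX0 ?/ev ?meval1 ?mul1r ?addr0 //.
  by apply/mnmP => j; rewrite !mnmE subnn.
by rewrite mderivX mnm1E eq_sym ji scale0r /ev meval0 mul0r.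
Qed.

Lemma dir_sum (I : Type) (r : seq I) (f : I -> {mpoly K[n]}) w :
  dir (\sum_(i <- r) f i) w = \sum_(i <- r) dir (f i) w.
Proof.
elim: r => [|i r IHr]; last by rewrite !big_cons dirD IHr.
by rewrite !big_nil /dir big1 // => i _; rewrite mderiv0 /ev meval0 mul0r.
Qed.

Lemma dirC c w : dir c%:MP w = 0.
Proof. by rewrite /dir big1 // => i _; rewrite mderivC /ev meval0 mul0r. Qed.

Lemma dir_comp k (p : {mpoly K[k]}) (q : k.-tuple {mpoly K[n]}) w :
  dir (p \mPo q) w = \sum_l ev (p^`M(l) \mPo q) z * dir (tnth q l) w.
Proof.
rewrite /dir; under [RHS]eq_bigr => l _ do rewrite mulr_sumr.
rewrite exchange_big; apply: eq_bigr => i _ /=.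
rewrite (derivation_mmap (D := mderiv i) (mderivD i) (mderivM i)) => [|c]; last exact: mderivC.
rewrite /ev raddf_sum mulr_suml; apply: eq_bigr => l _ /=.
by rewrite mevalM mulrA.
Qed.

Lemma dir_linear p a w w' : dir p (a *: w + w') = a * dir p w + dir p w'.
Proof.
rewrite /dir mulr_sumr -big_split; apply: eq_bigr => i _ /=.
by rewrite !mxE; ring.
Qed.

End DirectionalDerivative.

Section Chart.
Variables (K : numClosedFieldType) (m d : nat) (F : {mpoly K[m.+2]}).
Hypotheses (hd : (1 < d.+1)%N) (hF : F \is d.+1.-homog) (pF : prime_elt F).
Hypotheses (c1 : F@_(U_(var1) *+ d.+1) != 0) (cn : F@_(U_(ord_max) *+ d.+1) != 0).
Hypothesis (nD : ~ divides F (osc_det F)).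
Local Notation N := (2 * m.+1)%N.
Local Notation C := (contact_variety F).
Implicit Types (x : 'rV[K]_m.+2) (z v w h : 'rV[K]_N) (f : {mpoly K[N]}).

Definition unc_row z : 'rV[K]_m.+2 := \row_i uncontact (z 0) i.
Definition unc_tuple : m.+2.-tuple {mpoly K[N]} :=
  [tuple uncontact (fun i => 'X_i) i | i < m.+2].

Lemma ev_unc g z : ev (g \mPo unc_tuple) z = ev g (unc_row z).
Proof.
rewrite /ev comp_mpoly_meval; apply: meval_eq => i.
rewrite tnth_mktuple mxE uncontact_morph; move: i.
by apply: var_ind => [||j]; rewrite !uncontactE /= ?mevalXU //;
  congr (_ + _); apply: eq_bigr => k _; rewrite !mevalXU.
Qed.

Lemma dhomog_unc e g : g \is e.-homog -> g \mPo unc_tuple \is (e * 2).-homog.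
Proof.
move=> hg; apply: dhomog_comp hg _ => i; rewrite tnth_mktuple.
have h k l : ('X_k * 'X_l : {mpoly K[N]}) \is 2.-homog.
  by apply: (@dhomogM _ _ _ 1%N _ 1%N); rewrite dhomogX /= mdeg1.
move: i; apply: var_ind => [||j]; rewrite !uncontactE //.
by apply: rpredD => //; apply: rpred_sum.
Qed.

Lemma unc_theta x : ev F x = 0 ->
  unc_row (theta_row F x) = (4%:R * (x 0 var0 * ev F^`M(var1) x ^+ 2)) *: x.
Proof.
move=> Fx; apply/rowP => i; rewrite mxE [RHS]mxE.
have -> : theta_row F x 0 = contact (x 0) (gradient F x 0).
  by apply/funext => j; rewrite mxE.
by rewrite contactK ?[gradient _ _ _ _]mxE //; apply: (gradient_zeros hF Fx).
Qed.

(** These equations of the variety say that the odd coordinates of [z] record the slopes of the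
    hypersurface at the recovered point [unc_row z]. *)
Definition unc_eq (j : 'I_m) : {mpoly K[N]} :=
  2%:R * 'X_(odr j) * (F^`M(var1) \mPo unc_tuple) + (F^`M(varr j) \mPo unc_tuple) * 'X_ev0.

Lemma dhomog_unc_eq j : unc_eq j \is (d * 2).+1.-homog.
Proof.
have hX i : ('X_i : {mpoly K[N]}) \is 1.-homog by rewrite dhomogX /= mdeg1.
rewrite /unc_eq -mulrA mulr_natl; apply: rpredD.
  by apply: rpredMn; apply: (@dhomogM _ _ _ 1%N _ _) => //; apply: dhomog_unc (dhomog_mderiv _ hF).
rewrite mulrC; apply: (@dhomogM _ _ _ 1%N _ _) => //; apply: dhomog_unc (dhomog_mderiv _ hF).
Qed.

Lemma ev_unc_eq j z : ev (unc_eq j) z = 2%:R * z 0 (odr j) * ev F^`M(var1) (unc_row z) +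
  ev F^`M(varr j) (unc_row z) * z 0 ev0.
Proof. by rewrite -!ev_unc /ev mevalD !mevalM !mevalXU rmorph_nat. Qed.

Lemma divides_unc_F : divides F (pull F (F \mPo unc_tuple)).
Proof.
apply: (vanishing_theta hd hF pF cn) => x Fx.
by rewrite ev_unc (unc_theta Fx) (ev_scale _ _ hF) Fx mulr0.
Qed.

Lemma divides_unc_eq j : divides F (pull F (unc_eq j)).
Proof.
apply: (vanishing_theta hd hF pF cn) => x Fx.
rewrite ev_unc_eq (unc_theta Fx) !(ev_scale _ _ (dhomog_mderiv _ hF)) !mxE.
by rewrite /contact !four_casesE !mxE; ring.
Qed.

Lemma contact_unc_F z : C z -> ev F (unc_row z) = 0.
Proof.
case=> _ /(_ (F \mPo unc_tuple)); rewrite -ev_unc; apply.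
by split; [exists (d.+1 * 2)%N; apply: dhomog_unc | apply: divides_unc_F].
Qed.

Lemma contact_unc_eq z : C z -> forall j,
  2%:R * z 0 (odr j) * ev F^`M(var1) (unc_row z) + ev F^`M(varr j) (unc_row z) * z 0 ev0 = 0.
Proof.
case=> _ hz j; rewrite -ev_unc_eq; apply: hz.
by split; [exists (d * 2).+1%N; apply: dhomog_unc_eq | apply: divides_unc_eq].
Qed.

Lemma theta_unc z : C z ->
  theta_row F (unc_row z) = (2%:R * z 0 ev0 * ev F^`M(var1) (unc_row z)) *: z.
Proof.
move=> Cz; have e := contact_unc_eq Cz.
have Fx := gradient_zeros hF (contact_unc_F Cz).
apply/rowP => i; rewrite mxE [RHS]mxE.
have -> : unc_row z 0 = uncontact (z 0) by apply/funext => j; rewrite mxE.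
rewrite uncontactK ?mxE //.
  by rewrite -[RHS]Fx; apply: eq_bigr => j _; rewrite [X in _ = _ * X]mxE.
by move=> j; rewrite !mxE.
Qed.

(** Where z_0 and the derivative by x_1 are nonzero, [theta_unc] recovers [z] up to a nonzero
    scalar; where [osc_det] is nonzero as well, the osculating hyperplane is unique. *)
Definition chart_eq : {mpoly K[N]} :=
  'X_ev0 * ((F^`M(var1) * osc_det F) \mPo unc_tuple).

Definition chart := basic_open chart_eq.

Lemma chartP z : chart z <-> [/\ z != 0, z 0 ev0 != 0, ev F^`M(var1) (unc_row z) != 0 &
  ev (osc_det F) (unc_row z) != 0].
Proof.
rewrite -[chart z]/(z != 0 /\ ev chart_eq z != 0).
have -> : ev chart_eq z =
    z 0 ev0 * (ev F^`M(var1) (unc_row z) * ev (osc_det F) (unc_row z)).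
  by rewrite {1}/ev mevalM mevalXU -/(ev _ _) ev_unc /ev mevalM.
rewrite !mulf_eq0 !negb_or; split=> [[z0 /and3P [? ? ?]]|[z0 ? ? ?]]; split=> //.
exact/and3P.
Qed.

Lemma dhomog_chart_eq : exists e, chart_eq \is e.-homog.
Proof.
have [e he] := dhomog_osc_det hF; exists (1 + (d + e) * 2)%N.
apply: dhomogM; first by rewrite dhomogX /= mdeg1.
by apply: dhomog_unc; apply: dhomogM he; apply: dhomog_mderiv hF.
Qed.

Lemma zopen_chart : zopen chart.
Proof. by have [e he] := dhomog_chart_eq; apply: zopen_basic he. Qed.

(** At [theta_row F x] the recovered point is a multiple of [x], so by homogeneity the condition
    turns into one on [x], which a general zero of [F] satisfies. *)
Lemma not_divides_chart : ~ divides F (pull F chart_eq).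
Proof.
have nd := prime_mul pF (prime_mul pF (not_divides_theta0 hd hF pF c1 cn)
  (not_divides_deriv1 hF pF c1)) nD.
have [x [x0 Fx]] := generic_zero hd hF pF cn nd.
rewrite /ev !mevalM -!/(ev _ _) ev_theta_poly !mulf_eq0 !negb_or.
move=> /andP [/andP [t0 y1] D0] /divides_ev /(_ Fx); rewrite ev_pull.
have [e he] := dhomog_osc_det hF.
have s0 : 4%:R * (x 0 var0 * ev F^`M(var1) x ^+ 2) != 0.
  have x00 : x 0 var0 != 0.
    by apply: contra_neq t0 => e0; rewrite theta_row_ev0 e0 mul0r mulr0.
  by rewrite !mulf_neq0 ?expf_neq0 ?Num.Theory.pnatr_eq0.
rewrite {1}/ev mevalM mevalXU -/(ev _ _) ev_unc (unc_theta Fx) /ev mevalM -!/(ev _ _).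
rewrite (ev_scale _ _ (dhomog_mderiv _ hF)) (ev_scale _ _ he) => /eqP.
by rewrite !mulf_eq0 !expf_eq0 (negbTE t0) (negbTE y1) (negbTE D0) (negbTE s0) !andbF.
Qed.

Lemma chart_nonempty : C `&` chart !=set0.
Proof.
have [x [Fx nz Cx]] := generic_contact hd hF pF c1 cn not_divides_chart.
by exists (theta_row F x); split=> //; split=> //; case: Cx.
Qed.

End Chart.

Lemma row_free_rowsub (K : fieldType) p n (V : 'M[K]_n) (f : 'I_p -> 'I_n) :
  injective f -> V \in unitmx -> row_free (rowsub f V).
Proof.
move=> fi uV; apply/row_freeP; exists (invmx V *m (rowsub f 1%:M)^T).
rewrite mulmxA mul_rowsub_mx mulmxV //.
apply/matrixP => i j; rewrite !mxE (bigD1 (f i)) //= !mxE eqxx mul1r (inj_eq fi) eq_sym.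
rewrite big1 ?addr0 // => k /negbTE ki.
by rewrite !mxE eq_sym ki mul0r.
Qed.

Section Tangent.
Variables (K : numClosedFieldType) (m d : nat) (F : {mpoly K[m.+2]}).
Hypotheses (hd : (1 < d.+1)%N) (hF : F \is d.+1.-homog) (pF : prime_elt F).
Hypotheses (c1 : F@_(U_(var1) *+ d.+1) != 0) (cn : F@_(U_(ord_max) *+ d.+1) != 0).
Local Notation N := (2 * m.+1)%N.
Local Notation C := (contact_variety F).
Implicit Types (x : 'rV[K]_m.+2) (z v w h : 'rV[K]_N) (f : {mpoly K[N]}).

Definition osc_at x : 'M[K]_N := map_mx (fun p => ev p x) (osc_mx F).

Lemma osc_at_unit x : ev (osc_det F) x != 0 -> osc_at x \in unitmx.
Proof. by rewrite unitmxE unitfE /osc_at det_map_mx. Qed.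

(** The even rows are theta and its first Koszul derivatives, which span the cone over the tangent
    space. *)
Definition tangent_mx x : 'M[K]_(m.+1, N) := rowsub (@evn m.+1) (osc_at x).

Lemma tangent_mx_free x : ev (osc_det F) x != 0 -> row_free (tangent_mx x).
Proof.
move=> /osc_at_unit u; apply: row_free_rowsub u.
exact: (can_inj (@evnK m.+1)).
Qed.

Variable z : 'rV[K]_N.
Hypotheses (Cz : C z) (Uz : chart F z).
Let x := unc_row z.
Let Fx : ev F x = 0. Proof. exact: (contact_unc_F hd hF pF cn Cz). Qed.
Let c := 2%:R * z 0 ev0 * ev F^`M(var1) x.
Let c0 : c != 0.
Proof.
by have [_ z0 y1 _] := (chartP F z).1 Uz; rewrite !mulf_neq0 // Num.Theory.pnatr_eq0.
Qed.
Let thetaE : theta_row F x = c *: z.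
Proof. exact: (theta_unc hd hF pF cn Cz). Qed.

(** To first order the even coordinates determine everything: the recovered point apart from x_1,
    then x_1 because the derivative of [F] by it is nonzero, then the odd coordinates by [unc_eq]
    and by the formula for x_1. *)
Lemma tangent_rigid w :
  (forall f, (exists e, f \is e.-homog) -> (forall y, C y -> ev f y = 0) -> dir z f w = 0) ->
  (forall k, w 0 (evn k) = 0) -> w = 0.
Proof.
have [_ z0 y1 _] := (chartP F z).1 Uz.
move=> hw wev.
have dF : dir z (F \mPo unc_tuple K m) w = 0.
  apply: hw; first by exists (d.+1 * 2)%N; apply: dhomog_unc.
  by move=> y Cy; rewrite ev_unc; apply: (contact_unc_F hd hF pF cn).
have dE j : dir z (unc_eq F j) w = 0.
  apply: hw; first by exists (d * 2).+1%N; apply: dhomog_unc_eq.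
  by move=> y Cy; rewrite ev_unc_eq; apply: (contact_unc_eq hd hF pF cn Cy).
have dU i : i != var1 -> dir z (tnth (unc_tuple K m) i) w = 0.
  rewrite tnth_mktuple; move: i; apply: var_ind => [||j] // _; rewrite !uncontactE dirM !dirX.
    by rewrite !wev mul0r mulr0 addr0.
  by rewrite !wev mul0r mulr0 addr0.
have dU1 : dir z (tnth (unc_tuple K m) var1) w = 0.
  move: dF; rewrite dir_comp (bigD1 var1) //= big1 => [|i ni]; last by rewrite dU ?mulr0.
  rewrite addr0 ev_unc => /eqP; rewrite mulf_eq0 (negbTE y1) => /eqP //.
have dg g : dir z (g \mPo unc_tuple K m) w = 0.
  rewrite dir_comp big1 // => i _; have [->|/dU ->] := eqVneq i var1; last exact: mulr0.
  by rewrite dU1 mulr0.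
have wor j : w 0 (odr j) = 0.
  have := dE j; rewrite /unc_eq dirD !dirM !dg !dirX wev !mulr0 !addr0 mul0r addr0.
  have -> : dir z 2%:R w = 0 by rewrite -mpolyC_nat dirC.
  rewrite mul0r add0r ev_unc => /eqP; rewrite mulf_eq0 (negbTE y1) orbF /ev rmorph_nat.
  by rewrite mulf_eq0 Num.Theory.pnatr_eq0 => /eqP.
have wo0 : w 0 od0 = 0.
  move: dU1; rewrite tnth_mktuple uncontactE dirD dirM !dirX wev mul0r add0r.
  rewrite dir_sum big1 => [|j _]; last by rewrite dirM !dirX wev wor mul0r mulr0 addr0.
  by rewrite addr0 /ev mevalXU => /eqP; rewrite mulf_eq0 (negbTE z0) => /eqP.
apply/rowP; apply: index_ind => [||j|j]; rewrite [RHS]mxE ?wev //.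
Qed.

(** A Koszul derivative of a multiple of [F] vanishes on the zeros of [F]. The chain rule expresses
    it by the derivatives of [f] at [theta_row F x], and homogeneity moves these to [z]. *)
Lemma dir_pull f (e : nat) k : f \is e.-homog -> divides F (pull F f) ->
  \sum_i ev f^`M(i) z * ev (koszul F k (theta_poly F i)) x = 0.
Proof.
move=> hf [q qe].
have := congr1 (fun p => ev p x) (koszul_comp F k f (theta_tuple F)).
rewrite -/(pull F f) qe koszulM koszulF mulr0 addr0 {1}/ev mevalM -!/(ev _ _) Fx mulr0.
rewrite /ev raddf_sum /= => /esym.
under eq_bigr => i _ do
  rewrite mevalM -!/(ev _ _) ev_pull thetaE (ev_scale _ _ (dhomog_mderiv i hf)) -mulrA tnth_mktuple.
rewrite -mulr_sumr => /eqP; rewrite mulf_eq0 expf_eq0 (negbTE c0) andbF /=.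
by move/eqP.
Qed.

Lemma dir_euler f (e : nat) : f \is e.-homog -> ev f z = 0 -> dir z f z = 0.
Proof.
move=> hf fz; have /(congr1 (fun p => ev p z)) := euler_dhomog hf.
rewrite /ev mevalM -/(ev f z) fz mulr0 raddf_sum /= => <-.
by apply: eq_bigr => i _; rewrite mevalM mevalXU mulrC.
Qed.

Lemma dir_tangent_mx f v : (exists e, f \is e.-homog) ->
  (forall y, C y -> ev f y = 0) -> (v <= tangent_mx x)%MS -> dir z f v = 0.
Proof.
move=> [e hf] fC /submxP [u ->].
have Ff := vanishing_pull hd hF pF c1 cn fC.
have -> : dir z f (u *m tangent_mx x) = \sum_k u 0 k * dir z f (row k (tangent_mx x)).
  rewrite /dir; under [RHS]eq_bigr => k _ do rewrite mulr_sumr.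
  rewrite exchange_big; apply: eq_bigr => i _; rewrite mxE mulr_sumr.
  by apply: eq_bigr => k _; rewrite !mxE mulrCA.
rewrite big1 // => k _.
suff -> : dir z f (row k (tangent_mx x)) = 0 by rewrite mulr0.
have [l ->|->] := unliftP ord0 k.
  rewrite -[RHS](dir_pull (varr l) hf Ff); apply: eq_bigr => i _.
  by rewrite !mxE four_casesE.
rewrite (_ : row _ _ = c *: z + 0); last first.
  by rewrite addr0 -thetaE; apply/rowP => i; rewrite !mxE four_casesE ev_theta_poly mxE.
rewrite dir_linear (dir_euler hf) ?fC // mulr0 add0r.
by rewrite /dir big1 // => i _; rewrite mxE mulr0.
Qed.

(** The rows are tangent by [dir_tangent_mx]. By [tangent_rigid] a tangent vector is determined by
    its [m.+1] even coordinates, and a combination of the [m.+1] rows has the same ones. *)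
Lemma tangent_contact :
  tangent_space C z = [set v | v != 0 /\ (v <= tangent_mx x)%MS].
Proof.
have [_ z0 y1 D0] := (chartP F z).1 Uz.
have inj (u : 'rV_m.+1) : (forall k, (u *m tangent_mx x) 0 (evn k) = 0) -> u = 0.
  move=> hu; apply: (row_free_inj (tangent_mx_free D0)); rewrite mul0mx.
  by apply: tangent_rigid => // f hf fC; apply: dir_tangent_mx; rewrite ?submxMl.
have uS : colsub (@evn m.+1) (tangent_mx x) \in unitmx.
  rewrite -row_free_unit -kermx_eq0; apply/rowV0P => u /sub_kermxP uS.
  apply: inj => k; have /rowP /(_ k) := uS; rewrite mxE [RHS]mxE => <-.
  by rewrite mxE; apply: eq_bigr => i _; rewrite !mxE.
apply/seteqP; split => v /= [v0 hv]; split => //; last first.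
  by move=> e f hf fC; apply: dir_tangent_mx hv => //; exists e.
pose u := colsub (@evn m.+1) v *m invmx (colsub (@evn m.+1) (tangent_mx x)).
have : v - u *m tangent_mx x = 0.
  apply: tangent_rigid => [f [e hf] fC|k].
    rewrite -scaleN1r addrC dir_linear (dir_tangent_mx _ _ (submxMl _ _)) //; last by exists e.
    by rewrite mulr0 add0r; apply: (hv e f hf).
  have : u *m colsub (@evn m.+1) (tangent_mx x) = colsub (@evn m.+1) v by rewrite mulmxKV.
  move=> /rowP /(_ k); rewrite mxE [RHS]mxE => e.
  rewrite mxE -e [X in _ + X]mxE mxE; apply/eqP; rewrite subr_eq0; apply/eqP.
  by apply: eq_bigr => i _; rewrite !mxE.
by move/eqP; rewrite subr_eq0 => /eqP ->; apply: submxMl.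
Qed.

Lemma smooth_contact : smooth_point C z.
Proof.
have [_ _ _ D0] := (chartP F z).1 Uz.
split=> //; exists m; split; first exact: (has_dim_contact hd hF pF c1 cn).
by rewrite tangent_contact; exists (tangent_mx x); split; first exact: tangent_mx_free.
Qed.

End Tangent.

(** * Local rings and osculation *)

Section LocalRing.
Variables (K : numFieldType) (N : nat) (Y : set 'rV[K]_N) (z : 'rV[K]_N).
Hypothesis z0 : z != 0.
Implicit Types (phi psi a c : 'rV[K]_N -> K).

(** Neighbourhoods are taken to be basic open sets, so that intersecting two of them amounts to
    multiplying their forms. *)
Definition near_pt (P : 'rV[K]_N -> Prop) := exists e s,
  [/\ s \is e.-homog, ev s z != 0 & forall v, Y v -> v != 0 -> ev s v != 0 -> P v].

Lemma near_ptT (P : 'rV[K]_N -> Prop) : (forall v, Y v -> P v) -> near_pt P.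
Proof.
move=> h; exists 0%N, 1; split; first exact: dhomog1; first by rewrite /ev meval1 oner_neq0.
by move=> v /h.
Qed.

Lemma near_pt2 (P Q R : 'rV[K]_N -> Prop) : near_pt P -> near_pt Q ->
  (forall v, Y v -> P v -> Q v -> R v) -> near_pt R.
Proof.
move=> [e [s [hs sz sP]]] [e' [s' [hs' sz' sQ]]] PQR; exists (e + e')%N, (s * s').
split; [exact: dhomogM | by rewrite /ev mevalM mulf_neq0 |] => v Yv v0.
rewrite /ev mevalM mulf_eq0 negb_or => /andP [sv sv'].
by apply: PQR => //; [apply: sP | apply: sQ].
Qed.

Lemma near_pt_neq0 e s : s \is e.-homog -> ev s z != 0 -> near_pt (fun v => ev s v != 0).
Proof. by move=> hs sz; exists e, s. Qed.

Lemma germ_eqP phi psi : germ_eq Y z phi psi <-> near_pt (fun v => phi v = psi v).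
Proof.
split=> [[U [oU Uz h]]|[e [s [hs sz h]]]].
  have [e [s [hs sz sU]]] := zopen_basic_sub oU Uz.
  by exists e, s; split=> // v Yv v0 sv; apply/h/sU.
exists (basic_open s); split; [exact: zopen_basic hs | by [] |].
by move=> v Yv [v0 sv]; apply: h.
Qed.

Lemma regularP phi : regular_at Y z phi <-> exists e f g,
  [/\ f \is e.-homog, g \is e.-homog, ev g z != 0 &
      near_pt (fun v => ev g v != 0 /\ phi v = ev f v / ev g v)].
Proof.
split=> [] [e [f [g [hf hg gz]]]].
  move/germ_eqP => h; exists e, f, g; split=> //.
  by apply: near_pt2 h (near_pt_neq0 hg gz) _.
by move=> h; exists e, f, g; split=> //; apply/germ_eqP; apply: (near_pt2 h h) => v _ [].
Qed.

Lemma regular_near phi psi : regular_at Y z phi ->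
  near_pt (fun v => phi v = psi v) -> regular_at Y z psi.
Proof.
move=> /regularP [e [f [g [hf hg gz h]]]] e'; apply/regularP; exists e, f, g; split=> //.
by apply: near_pt2 h e' _ => v _ [? ->] <-.
Qed.

Lemma regular_quot e f g : f \is e.-homog -> g \is e.-homog -> ev g z != 0 ->
  regular_at Y z (fun v => ev f v / ev g v).
Proof.
by move=> hf hg gz; exists e, f, g; split=> //; apply/germ_eqP; apply: near_ptT.
Qed.

Lemma regular_cst t : regular_at Y z (fun=> t).
Proof.
apply: (@regular_near (fun v => ev t%:MP v / ev 1 v)).
  apply: (@regular_quot 0%N); last by rewrite /ev meval1 oner_neq0.
    by rewrite -[t%:MP]mulr1 mul_mpolyC; apply/rpredZ/dhomog1.
  exact: dhomog1.
by apply: near_ptT => v _; rewrite /ev mevalC meval1 divr1.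
Qed.

Lemma regularD phi psi : regular_at Y z phi -> regular_at Y z psi ->
  regular_at Y z (fun v => phi v + psi v).
Proof.
move=> /regularP [e [f [g [hf hg gz h]]]] /regularP [e' [f' [g' [hf' hg' gz' h']]]].
apply/regularP; exists (e + e')%N, (f * g' + f' * g), (g * g'); split.
- by apply: rpredD; [|rewrite addnC]; apply: dhomogM.
- exact: dhomogM.
- by rewrite /ev mevalM mulf_neq0.
apply: near_pt2 h h' _ => v _ [gv ->] [gv' ->]; rewrite /ev mevalD !mevalM.
by split; [rewrite mulf_neq0 | rewrite addf_div].
Qed.

Lemma regularM phi psi : regular_at Y z phi -> regular_at Y z psi ->
  regular_at Y z (fun v => phi v * psi v).
Proof.
move=> /regularP [e [f [g [hf hg gz h]]]] /regularP [e' [f' [g' [hf' hg' gz' h']]]].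
apply/regularP; exists (e + e')%N, (f * f'), (g * g'); split; try exact: dhomogM.
- by rewrite /ev mevalM mulf_neq0.
apply: near_pt2 h h' _ => v _ [gv ->] [gv' ->]; rewrite /ev !mevalM.
by split; [rewrite mulf_neq0 | rewrite mulf_div].
Qed.

Lemma near_pt_self (P : 'rV[K]_N -> Prop) : Y z -> near_pt P -> P z.
Proof. by move=> Yz [e [s [_ sz]]]; apply. Qed.

Hypothesis Yz : Y z.

Lemma near_regular_neq0 phi : regular_at Y z phi -> phi z != 0 ->
  near_pt (fun v => phi v != 0).
Proof.
move=> /regularP [e [f [g [hf hg gz h]]]] pz.
have fz : ev f z != 0.
  by have [_ e1] := near_pt_self Yz h; apply: contra_neq pz => fz; rewrite e1 fz mul0r.
apply: near_pt2 h (near_pt_neq0 hf fz) _ => v _ [gv ->] fv.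
by rewrite mulf_neq0 // invr_eq0.
Qed.

Lemma regularV phi : regular_at Y z phi -> phi z != 0 ->
  regular_at Y z (fun v => (phi v)^-1).
Proof.
move=> /regularP [e [f [g [hf hg gz h]]]] pz.
have fz : ev f z != 0.
  by have [_ e1] := near_pt_self Yz h; apply: contra_neq pz => fz; rewrite e1 fz mul0r.
apply/regularP; exists e, g, f; split=> //.
by apply: near_pt2 h (near_pt_neq0 hf fz) _ => v _ [gv ->] fv; rewrite invf_div.
Qed.

Local Notation mpow := (max_ideal_pow Y z).

Lemma mpow_near s phi psi : mpow s phi -> near_pt (fun v => phi v = psi v) -> mpow s psi.
Proof.
move=> [k [c [a [hc ha /germ_eqP h]]]] e; exists k, c, a; split=> //.
by apply/germ_eqP; apply: near_pt2 h e _ => v _ <-.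
Qed.

Lemma mpow_regular phi : regular_at Y z phi -> mpow 0 phi.
Proof.
move=> hphi; exists 1%N, (fun=> phi), (fun _ _ => phi); split=> //; first by move=> i [].
by apply/germ_eqP; apply: near_ptT => v _; rewrite big_ord1 big_ord0 mulr1.
Qed.

Lemma mpowD s phi psi : mpow s phi -> mpow s psi -> mpow s (fun v => phi v + psi v).
Proof.
move=> [k [c [a [hc ha /germ_eqP h]]]] [k' [c' [a' [hc' ha' /germ_eqP h']]]].
exists (k + k')%N, (fun i => match split i with inl j => c j | inr j => c' j end),
  (fun i => match split i with inl j => a j | inr j => a' j end).
split=> [i|i j|]; try by case: split.
apply/germ_eqP; apply: near_pt2 h h' _ => v _ -> ->.
rewrite big_split_ord; congr (_ + _); apply: eq_bigr => i _.
  by rewrite -[lshift _ _]/(unsplit (inl _)) unsplitK.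
by rewrite -[rshift _ _]/(unsplit (inr _)) unsplitK.
Qed.

Lemma mpowM_regular s phi psi : regular_at Y z psi -> mpow s phi ->
  mpow s (fun v => psi v * phi v).
Proof.
move=> hpsi [k [c [a [hc ha /germ_eqP h]]]].
exists k, (fun i v => psi v * c i v), a; split=> // [i|]; first exact: regularM.
apply/germ_eqP; apply: (near_pt2 h h) => v _ -> _; rewrite mulr_sumr.
by apply: eq_bigr => i _; rewrite mulrA.
Qed.

Lemma mpowS s phi b : max_ideal Y z b -> mpow s phi -> mpow s.+1 (fun v => b v * phi v).
Proof.
move=> hb [k [c [a [hc ha /germ_eqP h]]]].
exists k, c, (fun i j => if unlift ord0 j is Some j' then a i j' else b); split=> // [i j|].
  by case: unliftP.
apply/germ_eqP; apply: (near_pt2 h h) => v _ -> _; rewrite mulr_sumr.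
apply: eq_bigr => i _; rewrite mulrCA; congr (_ * _); rewrite big_ord_recl unlift_none.
by congr (_ * _); apply: eq_bigr => j _; rewrite liftK.
Qed.

Lemma mpow1 b : max_ideal Y z b -> mpow 1 b.
Proof.
move=> hb; apply: (@mpow_near 1 (fun v => b v * 1)); last by apply: near_ptT => v _; rewrite mulr1.
exact/mpowS/mpow_regular/regular_cst.
Qed.

Lemma mpow0 s : mpow s (fun=> 0).
Proof.
exists 0%N, (fun _ _ => 0), (fun _ _ _ => 0); split=> [[]|[]|] //.
by apply/germ_eqP; apply: near_ptT => v _; rewrite big_ord0.
Qed.

Lemma mpow_sum s (I : Type) (r : seq I) (f : I -> 'rV[K]_N -> K) :
  (forall i, mpow s (f i)) -> mpow s (fun v => \sum_(i <- r) f i v).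
Proof.
move=> hf; elim: r => [|i r IHr].
  by apply: mpow_near (mpow0 s) _; apply: near_ptT => v _; rewrite big_nil.
apply: mpow_near (mpowD (hf i) IHr) _; apply: near_ptT => v _.
by rewrite big_cons.
Qed.

Section Taylor.
Variables (n : nat) (X : 'I_n -> 'rV[K]_N -> K).
Hypothesis hX : forall i, regular_at Y z (X i).
Implicit Types G H : {mpoly K[n]}.

(** Polynomials in regular functions X_i. Below, [diff_X] and [diff_z] apply the differential of
    [G], taken at the moving point and at [z] respectively, to the displacement. *)
Definition at_X G v := G.@[X^~ v].
Definition incr G v := at_X G v - at_X G z.
Definition diff_X G v := \sum_i at_X G^`M(i) v * (X i v - X i z).
Definition diff_z G v := \sum_i at_X G^`M(i) z * (X i v - X i z).

Lemma regular_at_X G : regular_at Y z (at_X G).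
Proof.
move: G; apply: mpoly_ring_ind => [c|i|p q hp hq|p q hp hq].
- by apply: regular_near (regular_cst c) _; apply: near_ptT => v _; rewrite /at_X mevalC.
- by apply: regular_near (hX i) _; apply: near_ptT => v _; rewrite /at_X mevalXU.
- by apply: regular_near (regularD hp hq) _; apply: near_ptT => v _; rewrite /at_X mevalD.
by apply: regular_near (regularM hp hq) _; apply: near_ptT => v _; rewrite /at_X mevalM.
Qed.

Lemma max_ideal_shift phi : regular_at Y z phi -> max_ideal Y z (fun v => phi v - phi z).
Proof.
by move=> h; split; [apply: regularD h (regular_cst _) | rewrite subrr].
Qed.

Lemma max_ideal_incr G : max_ideal Y z (incr G).
Proof. exact/max_ideal_shift/regular_at_X. Qed.

Lemma diff_XM G H v : diff_X (G * H) v = at_X G v * diff_X H v + at_X H v * diff_X G v.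
Proof.
rewrite !mulr_sumr -big_split; apply: eq_bigr => i _ /=.
by rewrite /at_X mderivM mevalD !mevalM; ring.
Qed.

Lemma diff_zM G H v : diff_z (G * H) v = at_X G z * diff_z H v + at_X H z * diff_z G v.
Proof.
rewrite !mulr_sumr -big_split; apply: eq_bigr => i _ /=.
by rewrite /at_X mderivM mevalD !mevalM; ring.
Qed.

(** The error for a product is a combination of the errors for the factors, minus the product of the
    two increments, which has order two. *)
Lemma taylor2_X G : mpow 2 (fun v => incr G v - diff_X G v).
Proof.
move: G; apply: mpoly_ring_ind => [c|i|p q hp hq|p q hp hq].
- apply: mpow_near (mpow0 2) _; apply: near_ptT => v _.
  rewrite /incr /diff_X /at_X !mevalC subrr big1 ?subrr // => j _.
  by rewrite mderivC meval0 mul0r.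
- apply: mpow_near (mpow0 2) _; apply: near_ptT => v _.
  rewrite /incr /diff_X /at_X !mevalXU (bigD1 i) //= mderivX mnm1E eqxx scale1r.
  rewrite (_ : (U_(i) - U_(i))%MM = 0%MM) ?mpolyX0 ?meval1; last first.
    by apply/mnmP => j; rewrite !mnmE subnn.
  rewrite big1 ?addr0 ?mul1r ?subrr // => j /negbTE ji.
  by rewrite mderivX mnm1E eq_sym ji scale0r meval0 mul0r.
- apply: mpow_near (mpowD hp hq) _; apply: near_ptT => v _.
  rewrite /incr /diff_X /at_X !mevalD.
  under [X in _ = _ - X]eq_bigr => j _ do rewrite mderivD mevalD mulrDl.
  by rewrite big_split /=; ring.
have h1 := mpowM_regular (regular_at_X p) hq.
have h2 := mpowM_regular (regular_at_X q) hp.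
have h3 := mpowM_regular (regular_cst (-1))
  (mpowS (max_ideal_incr p) (mpow1 (max_ideal_incr q))).
apply: mpow_near (mpowD (mpowD h1 h2) h3) _; apply: near_ptT => v _.
by rewrite diff_XM /incr /at_X !mevalM; ring.
Qed.

(** Moving the gradient from v to [z] changes the differential by a sum of products of two functions
    vanishing at [z]. *)
Lemma taylor2_z G : mpow 2 (fun v => incr G v - diff_z G v).
Proof.
have h : mpow 2 (fun v => \sum_i incr G^`M(i) v * (X i v - X i z)).
  by apply: mpow_sum => i; apply: mpowS (max_ideal_incr _) (mpow1 (max_ideal_shift (hX i))).
apply: mpow_near (mpowD (taylor2_X G) h) _; apply: near_ptT => v _.
rewrite -addrA; congr (_ + _); rewrite /diff_X /diff_z -!sumrN -big_split.
by apply: eq_bigr => i _; rewrite /incr /=; ring.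
Qed.

(* The trapezoidal rule is exact to order two. *)
Lemma taylor3 G : mpow 3 (fun v => incr G v - 2%:R^-1 * (diff_X G v + diff_z G v)).
Proof.
have n2 : (2%:R : K) != 0 by rewrite Num.Theory.pnatr_eq0.
move: G; apply: mpoly_ring_ind => [c|i|p q hp hq|p q hp hq].
- apply: mpow_near (mpow0 3) _; apply: near_ptT => v _.
  rewrite /incr /diff_X /diff_z /at_X !mevalC subrr !big1 ?addr0 ?mulr0 ?subrr // => j _;
  by rewrite mderivC meval0 mul0r.
- apply: mpow_near (mpow0 3) _; apply: near_ptT => v _.
  have e (u : 'rV[K]_N) : \sum_j at_X 'X_i^`M(j) u * (X j v - X j z) = X i v - X i z.
    rewrite /at_X (bigD1 i) //= mderivX mnm1E eqxx scale1r.
    rewrite (_ : (U_(i) - U_(i))%MM = 0%MM) ?mpolyX0 ?meval1; last first.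
      by apply/mnmP => j; rewrite !mnmE subnn.
    rewrite big1 ?addr0 ?mul1r ?subrr // => j /negbTE ji.
    by rewrite mderivX mnm1E eq_sym ji scale0r meval0 mul0r.
  by rewrite /diff_X /diff_z !e /incr /at_X !mevalXU; field.
- apply: mpow_near (mpowD hp hq) _; apply: near_ptT => v _.
  have e (u : 'rV[K]_N) : \sum_j at_X (p + q)^`M(j) u * (X j v - X j z) =
      \sum_j at_X p^`M(j) u * (X j v - X j z) + \sum_j at_X q^`M(j) u * (X j v - X j z).
    by rewrite -big_split; apply: eq_bigr => j _; rewrite /at_X mderivD mevalD mulrDl.
  by rewrite /diff_X /diff_z !e /incr /at_X !mevalD; ring.
(* The error for [p * q] is p(v) times the error for q, plus q(z) times the error for p, plus half
   an increment of q times the first-order error for p at v, minus half an increment of p times that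
   for q at z. *)
have h1 := mpowM_regular (regular_at_X p) hq.
have h2 := mpowM_regular (regular_cst (at_X q z)) hp.
have h3 := mpowM_regular (regular_cst (2%:R^-1)) (mpowS (max_ideal_incr q) (taylor2_X p)).
have h4 := mpowM_regular (regular_cst (- 2%:R^-1)) (mpowS (max_ideal_incr p) (taylor2_z q)).
apply: mpow_near (mpowD (mpowD h1 h2) (mpowD h3 h4)) _; apply: near_ptT => v _.
rewrite diff_XM diff_zM /incr.
have -> : at_X (p * q) v = at_X p v * at_X q v by rewrite /at_X mevalM.
have -> : at_X (p * q) z = at_X p z * at_X q z by rewrite /at_X mevalM.
by field.
Qed.

End Taylor.
End LocalRing.

(** * Orders of vanishing and uniqueness of the osculating hyperplane *)

Section OrderOfVanishing.
Variables (K : fieldType) (m : nat) (F : {mpoly K[m.+2]}) (x : 'rV[K]_m.+2).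
Hypothesis Fx : ev F x = 0.
Implicit Types p q : {mpoly K[m.+2]}.

(** The counterpart, for polynomials on the hypersurface, of the powers of the maximal ideal:
    iterated Koszul derivatives of order less than [s] vanish at [x]. *)
Fixpoint vanishes s p : Prop :=
  if s is s'.+1 then ev p x = 0 /\ forall k, vanishes s' (koszul F k p) else True.

Lemma vanishesW s p : vanishes s.+1 p -> vanishes s p.
Proof. by elim: s p => // s IHs p [px hp]; split=> // k; apply: IHs. Qed.

Lemma vanishesD s p q : vanishes s p -> vanishes s q -> vanishes s (p + q).
Proof.
elim: s p q => // s IHs p q [px hp] [qx hq]; split.
  by move: px qx; rewrite /ev mevalD => -> ->; rewrite addr0.
by move=> k; rewrite koszulD; apply: IHs; [apply: hp | apply: hq].
Qed.

Lemma vanishesN s p : vanishes s p -> vanishes s (- p).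
Proof.
elim: s p => // s IHs p [px hp]; split; first by move: px; rewrite /ev mevalN => ->; rewrite oppr0.
by move=> k; rewrite -sub0r koszulB -mpolyC0 koszulC sub0r; apply: IHs; apply: hp.
Qed.

Lemma vanishesM s t p q : vanishes s p -> vanishes t q -> vanishes (s + t) (p * q).
Proof.
have [k] := ubnP (s + t); elim: k s t p q => // k IHk [|s] [|t] p q //; rewrite ltnS => hk hp hq.
- split; first by case: hq; rewrite /ev mevalM => -> _; rewrite mulr0.
  move=> l; rewrite koszulM; apply: vanishesD.
    by apply: (IHk 0%N t) => //; apply: vanishesW.
  by apply: (IHk 0%N t) => //; case: hq => _; apply.
- rewrite addn0; split; first by case: hp; rewrite /ev mevalM => -> _; rewrite mul0r.
  move=> l; rewrite koszulM -[s]addn0; apply: vanishesD; apply: IHk => //.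
    by case: hp => _; apply.
  exact: vanishesW.
rewrite addSn; split; first by case: hp; rewrite /ev mevalM => -> _; rewrite mul0r.
move=> l; rewrite koszulM; apply: vanishesD; first by apply: (IHk s t.+1) => //; case: hp => _; apply.
rewrite -addSnnS; apply: (IHk s.+1 t); [by rewrite addSnnS| by [] |by case: hq => _; apply].
Qed.

Lemma vanishes_ideal s q : vanishes s (q * F).
Proof.
elim: s q => // s IHs q; split; first by move: Fx; rewrite /ev mevalM => ->; rewrite mulr0.
by move=> k; rewrite koszulM koszulF mulr0 addr0.
Qed.

(** By induction [p] vanishes to the order below; this controls the Leibniz term in which [q] is
    differentiated, and leaves the derivative of [p] times [q]. *)
Lemma vanishes_cancel s p q : ev q x != 0 -> vanishes s (p * q) -> vanishes s p.
Proof.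
move=> qx; elim: s p => // s IHs p hpq; have [px hk] := hpq; split.
  by move/eqP: px; rewrite /ev mevalM mulf_eq0 (negbTE qx) orbF => /eqP.
have hp := IHs _ (vanishesW hpq); move=> k; apply: IHs.
have hpk : vanishes (s + 0) (p * koszul F k q) by apply: vanishesM.
rewrite addn0 in hpk; have := vanishesD (hk k) (vanishesN hpk).
by rewrite koszulM addrK.
Qed.

End OrderOfVanishing.

Section Osculating.
Variables (K : numClosedFieldType) (m d : nat) (F : {mpoly K[m.+2]}).
Hypotheses (hd : (1 < d.+1)%N) (hF : F \is d.+1.-homog) (pF : prime_elt F).
Hypotheses (c1 : F@_(U_(var1) *+ d.+1) != 0) (cn : F@_(U_(ord_max) *+ d.+1) != 0).
Local Notation N := (2 * m.+1)%N.
Local Notation C := (contact_variety F).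
Implicit Types (x : 'rV[K]_m.+2) (v w h : 'rV[K]_N) (f : {mpoly K[N]}).

Variable z : 'rV[K]_N.
Hypotheses (Cz : C z) (Uz : chart F z).
Let x := unc_row z.
Let Fx : ev F x = 0. Proof. exact: (contact_unc_F hd hF pF cn Cz). Qed.
Let c := 2%:R * z 0 ev0 * ev F^`M(var1) x.
Let c0 : c != 0.
Proof.
by have [_ z0 y1 _] := (chartP F z).1 Uz; rewrite !mulf_neq0 // Num.Theory.pnatr_eq0.
Qed.
Let thetaE : theta_row F x = c *: z.
Proof. exact: (theta_unc hd hF pF cn Cz). Qed.
Let z0 : z != 0. Proof. by case: Cz. Qed.

Let ev_pull_z e f : f \is e.-homog -> ev (pull F f) x = c ^+ e * ev f z.
Proof. by move=> hf; rewrite ev_pull thetaE (ev_scale _ _ hf). Qed.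

(* The function phi on C is, near z, a quotient whose numerator vanishes to   *)
(* order s along the zeros of F.                                              *)
Definition jet s (phi : 'rV[K]_N -> K) := exists p q e g,
  [/\ ev q x != 0, vanishes F x s p, g \is e.-homog, ev g z != 0 &
    forall y, ev F y = 0 -> theta_row F y != 0 -> ev g (theta_row F y) != 0 ->
      phi (theta_row F y) * ev q y = ev p y].

Lemma jet_germ s phi psi : jet s phi -> germ_eq C z psi phi -> jet s psi.
Proof.
move=> [p [q [e [g [qx hp hg gz h]]]]] /(germ_eqP _ z0) [e' [g' [hg' gz' h']]].
exists p, q, (e + e')%N, (g * g'); split=> //; first exact: dhomogM.
  by rewrite /ev mevalM mulf_neq0.
move=> y Fy ty; rewrite /ev mevalM mulf_eq0 negb_or => /andP [gy gy'].
by rewrite h' ?h //; apply: theta_in_variety.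
Qed.

Lemma jet_regular phi : regular_at C z phi -> jet 0 phi.
Proof.
move=> [e [f [g [hf hg gz h]]]]; apply: jet_germ h.
exists (pull F f), (pull F g), e, g; split=> //.
  by rewrite (ev_pull_z hg) mulf_neq0 ?expf_neq0.
by move=> y Fy ty gy; rewrite !ev_pull divfK.
Qed.

Lemma jet_max phi : max_ideal C z phi -> jet 1 phi.
Proof.
move=> [[e [f [g [hf hg gz h]]]] phiz]; apply: jet_germ (h).
exists (pull F f), (pull F g), e, g; split=> //.
- by rewrite (ev_pull_z hg) mulf_neq0 ?expf_neq0.
- split=> //; rewrite (ev_pull_z hf); have := near_pt_self z0 Cz ((germ_eqP _ z0 _ _).1 h).
  by rewrite phiz => /esym/eqP; rewrite mulf_eq0 invr_eq0 (negbTE gz) orbF => /eqP ->; rewrite mulr0.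
by move=> y Fy ty gy; rewrite !ev_pull divfK.
Qed.

Lemma jetM s t phi psi : jet s phi -> jet t psi -> jet (s + t) (fun v => phi v * psi v).
Proof.
move=> [p [q [e [g [qx hp hg gz h]]]]] [p' [q' [e' [g' [qx' hp' hg' gz' h']]]]].
exists (p * p'), (q * q'), (e + e')%N, (g * g'); split.
- by rewrite /ev mevalM mulf_neq0.
- exact: vanishesM.
- exact: dhomogM.
- by rewrite /ev mevalM mulf_neq0.
move=> y Fy ty; rewrite /ev mevalM mulf_eq0 negb_or => /andP [gy gy'].
by rewrite !mevalM -[p.@[_]]h // -[p'.@[_]]h' // mulrACA.
Qed.

Lemma jetD s phi psi : jet s phi -> jet s psi -> jet s (fun v => phi v + psi v).
Proof.
move=> [p [q [e [g [qx hp hg gz h]]]]] [p' [q' [e' [g' [qx' hp' hg' gz' h']]]]].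
exists (p * q' + p' * q), (q * q'), (e + e')%N, (g * g'); split.
- by rewrite /ev mevalM mulf_neq0.
- by apply: vanishesD; rewrite -[s]addn0; apply: vanishesM.
- exact: dhomogM.
- by rewrite /ev mevalM mulf_neq0.
move=> y Fy ty; rewrite /ev mevalM mulf_eq0 negb_or => /andP [gy gy'].
by rewrite mevalD !mevalM -[p.@[_]]h // -[p'.@[_]]h' // -!/(ev _ _); ring.
Qed.

Lemma jet_cst s t : (s == 0)%N || (t == 0) -> jet s (fun=> t).
Proof.
move=> st; exists t%:MP, 1, 0%N, 1; split; rewrite ?dhomog1 ?/ev ?meval1 ?oner_neq0 //.
  case/orP: st => /eqP -> //; rewrite mpolyC0 -[0](mul0r F); exact: vanishes_ideal.
by move=> y _ _ _; rewrite !mevalC ?meval1 mulr1.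
Qed.

Lemma jet_prod s (a : 'I_s -> 'rV[K]_N -> K) : (forall j, max_ideal C z (a j)) ->
  jet s (fun v => \prod_(j < s) a j v).
Proof.
elim: s a => [|s IHs] a ha.
  suff -> : (fun v => \prod_(j < 0) a j v) = fun=> 1 by apply: jet_cst.
  by apply/funext => v; rewrite big_ord0.
suff -> : (fun v => \prod_(j < s.+1) a j v) =
    fun v => a ord0 v * \prod_(j < s) a (lift ord0 j) v.
  by apply: (@jetM 1 s); [apply: jet_max | apply: IHs].
by apply/funext => v; rewrite big_ord_recl.
Qed.

Lemma jet_sum s k (u : 'I_k -> 'rV[K]_N -> K) : (forall i, jet s (u i)) ->
  jet s (fun v => \sum_(i < k) u i v).
Proof.
elim: k u => [|k IHk] u hu.
  suff -> : (fun v => \sum_(i < 0) u i v) = fun=> 0 by apply: jet_cst; rewrite eqxx orbT.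
  by apply/funext => v; rewrite big_ord0.
suff -> : (fun v => \sum_(i < k.+1) u i v) =
    fun v => u ord0 v + \sum_(i < k) u (lift ord0 i) v.
  by apply: jetD => //; apply: IHk.
by apply/funext => v; rewrite big_ord_recl.
Qed.

Lemma jet_pow s phi : max_ideal_pow C z s phi -> jet s phi.
Proof.
move=> [k [b [a [hb ha h]]]]; apply: jet_germ h; apply: jet_sum => i.
by apply: (@jetM 0); [apply: jet_regular | apply: jet_prod].
Qed.

Definition linear_poly h : {mpoly K[N]} := \sum_i h 0 i *: 'X_i.

Lemma ev_linear_poly h v : ev (linear_poly h) v = pairing h v.
Proof.
rewrite /ev raddf_sum; apply: eq_bigr => i _ /=.
by rewrite mevalZ mevalXU.
Qed.

Lemma dhomog_linear_poly h : linear_poly h \is 1.-homog.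
Proof. by apply: rpred_sum => i _; apply: rpredZ; rewrite dhomogX /= mdeg1. Qed.

Lemma pull_linear_poly h : pull F (linear_poly h) = \sum_i (h 0 i)%:MP * theta_poly F i.
Proof.
rewrite /pull raddf_sum; apply: eq_bigr => i _.
by rewrite /= comp_mpolyZ comp_mpolyXU -tnth_nth tnth_mktuple mul_mpolyC.
Qed.

(** The local equation H / L is a jet p / q of order three, so H q = p L on the zeros of [F] away
    from those of theta_0, of the denominator [g] and of L. Multiplying by these three makes the
    identity valid everywhere; primality then drops them, as they are nonzero at [x], and
    [vanishes_cancel] drops q. *)
Lemma osculates_vanishes h : osculates C z 2 h -> vanishes F x 3 (pull F (linear_poly h)).
Proof.
move=> [h0 hz [l lz /jet_pow [p [q [e [g [qx hp hg gz hj]]]]]]].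
set H := pull F (linear_poly h); set L := pull F (linear_poly l).
have Lx : ev L x != 0.
  by rewrite (ev_pull_z (dhomog_linear_poly l)) ev_linear_poly mulf_neq0 ?expf_neq0.
have gx : ev (pull F g) x != 0 by rewrite (ev_pull_z hg) mulf_neq0 ?expf_neq0.
have tx : ev (theta_poly F ev0) x != 0.
  by rewrite ev_theta_poly thetaE mxE mulf_neq0 //; case: ((chartP F z).1 Uz).
have nd (G : {mpoly K[m.+2]}) : ev G x != 0 -> ~ divides F G.
  by move=> Gx /divides_ev /(_ Fx) /eqP; rewrite (negbTE Gx).
have : divides F ((H * q - p * L) * (theta_poly F ev0 * (pull F g * L))).
  apply: (vanishing_divides hd hF pF cn) => y y0 Fy.
  rewrite {1}/ev !mevalM -!/(ev _ _) [ev (_ - _) y]/ev mevalB !mevalM -!/(ev _ _).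
  have [->|ty] := eqVneq (ev (theta_poly F ev0) y) 0; first by rewrite mul0r mulr0.
  have [->|gy] := eqVneq (ev (pull F g) y) 0; first by rewrite mul0r !mulr0.
  have [->|Ly] := eqVneq (ev L y) 0; first by rewrite !mulr0.
  rewrite -hj //; last by rewrite -ev_pull.
    move: Ly; rewrite /L /H !ev_pull !ev_linear_poly => Ly.
    by rewrite mulrAC divfK // subrr mul0r.
  exact: theta_row_neq0.
case: pF => _ _ hmul /hmul [[r re]|/(nd _) []]; last first.
  by rewrite /ev !mevalM !mulf_neq0.
apply: (vanishes_cancel qx); rewrite -[H * q](subrK (p * L)) re.
apply: vanishesD; first exact: vanishes_ideal.
by rewrite -[3%N]addn0; apply: vanishesM.
Qed.

(* The linear conditions on h given by the rows of osc_at, all but one.       *)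
Lemma osculates_rows h : osculates C z 2 h -> forall i, i != od0 ->
  (h *m (osc_at F x)^T) 0 i = 0.
Proof.
move=> /osculates_vanishes; rewrite pull_linear_poly => - [v0 hv].
have rowE (G : 'I_N -> {mpoly K[m.+2]}) : ev (\sum_i (h 0 i)%:MP * G i) x = 0 ->
    \sum_i h 0 i * ev (G i) x = 0.
  by rewrite /ev raddf_sum /= => e; rewrite -[RHS]e; apply: eq_bigr => i _; rewrite mevalM mevalC.
have koszulE k (G : 'I_N -> {mpoly K[m.+2]}) : koszul F k (\sum_i (h 0 i)%:MP * G i) =
    \sum_i (h 0 i)%:MP * koszul F k (G i).
  by rewrite koszul_sum; apply: eq_bigr => i _; rewrite koszulM koszulC mul0r add0r.
have entry i : (h *m (osc_at F x)^T) 0 i = \sum_j h 0 j * ev (osc_mx F i j) x.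
  by rewrite mxE; apply: eq_bigr => j _; rewrite !mxE.
apply: index_ind => [||j|j]; rewrite ?eqxx // entry => _;
  under eq_bigr => l _ do rewrite mxE four_casesE.
- exact: rowE.
- by apply: rowE; rewrite -koszulE; case: (hv (varr j)).
- by apply: rowE; rewrite -!koszulE; case: (hv (varr j)) => _ /(_ (varr j)) [].
Qed.

(** The row left out is the coordinate vector of [od0], so the second hypothesis is the missing
    condition, and the matrix is invertible on the chart. *)
Lemma osc_rows_inj h : (forall i, i != od0 -> (h *m (osc_at F x)^T) 0 i = 0) ->
  h 0 od0 = 0 -> h = 0.
Proof.
move=> hrow h1; have [_ _ _ D0] := (chartP F z).1 Uz.
have u : (osc_at F x)^T \in unitmx by rewrite unitmx_tr osc_at_unit.
rewrite -[h](mulmxK u); suff -> : h *m (osc_at F x)^T = 0 by rewrite mul0mx.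
apply/rowP => i; rewrite [RHS]mxE; have [->|/hrow //] := eqVneq i od0.
rewrite mxE (bigD1 od0) //= h1 mul0r add0r big1 // => j /negbTE j0.
by rewrite !mxE four_casesE j0 /ev meval0 mulr0.
Qed.

End Osculating.

(** * The symplectic hyperplane osculates to order two *)

Section SymplecticOsculates.
Variables (K : numClosedFieldType) (m d : nat) (F : {mpoly K[m.+2]}).
Hypotheses (hd : (1 < d.+1)%N) (hF : F \is d.+1.-homog) (pF : prime_elt F).
Hypotheses (c1 : F@_(U_(var1) *+ d.+1) != 0) (cn : F@_(U_(ord_max) *+ d.+1) != 0).
Local Notation N := (2 * m.+1)%N.
Local Notation C := (contact_variety F).
Implicit Types (x : 'rV[K]_m.+2) (v w h : 'rV[K]_N) (f : {mpoly K[N]}).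

(* The affine coordinate x_i / x_0 as a function of z. *)
Definition affine_unc (i : 'I_m.+2) v : K := uncontact (v 0) i / v 0 ev0 ^+ 2.

Lemma at_affine_unc G v : at_X affine_unc G v = ev G ((v 0 ev0 ^+ 2)^-1 *: unc_row v).
Proof. by apply: meval_eq => i; rewrite !mxE mulrC. Qed.

Lemma affine_unc_F v : C v -> at_X affine_unc F v = 0.
Proof.
by move=> Cv; rewrite at_affine_unc (ev_scale _ _ hF) (contact_unc_F hd hF pF cn Cv) mulr0.
Qed.

Lemma affine_unc_deriv i v :
  at_X affine_unc F^`M(i) v = (v 0 ev0 ^+ 2)^-1 ^+ d * ev F^`M(i) (unc_row v).
Proof. by rewrite at_affine_unc (ev_scale _ _ (dhomog_mderiv i hF)). Qed.

(** Expresses the gradient of [F] by the odd coordinates of [v]; so the differentials of [F],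
    normalized by the derivative along x_1, become expressions in the coordinates of [v] and [z]. *)
Lemma affine_unc_slope v : C v -> v 0 ev0 != 0 -> forall j,
  at_X affine_unc F^`M(varr j) v =
  - (2%:R * at_X affine_unc F^`M(var1) v * (v 0 (odr j) / v 0 ev0)).
Proof.
move=> Cv v0 j; rewrite !affine_unc_deriv.
have e : ev F^`M(varr j) (unc_row v) =
    - (2%:R * v 0 (odr j) * ev F^`M(var1) (unc_row v)) / v 0 ev0.
  have /eqP := contact_unc_eq hd hF pF cn Cv j; rewrite addrC addr_eq0 => /eqP <-.
  by rewrite mulfK.
by rewrite e; field.
Qed.

Lemma affine_unc0 v : v 0 ev0 != 0 -> affine_unc var0 v = 1.
Proof. by move=> v0; rewrite /affine_unc uncontactE -expr2 divff // expf_neq0. Qed.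

Lemma affine_unc1 v : v 0 ev0 != 0 -> affine_unc var1 v = v 0 od0 / v 0 ev0 +
  \sum_j (v 0 (evr j) / v 0 ev0) * (v 0 (odr j) / v 0 ev0).
Proof.
move=> v0; rewrite /affine_unc uncontactE mulrDl mulr_suml; congr (_ + _); first by field.
by apply: eq_bigr => j _; field.
Qed.

Lemma affine_uncr v j : v 0 ev0 != 0 -> affine_unc (varr j) v = v 0 (evr j) / v 0 ev0.
Proof. by move=> v0; rewrite /affine_unc uncontactE; field. Qed.

Variable z : 'rV[K]_N.
Hypotheses (Cz : C z) (Uz : chart F z).
Let z0 : z != 0. Proof. by case: Cz. Qed.
Let ze0 : z 0 ev0 != 0. Proof. by case: ((chartP F z).1 Uz). Qed.

Let b := at_X affine_unc F^`M(var1) z.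
Let b0 : b != 0.
Proof.
rewrite /b affine_unc_deriv mulf_neq0 ?expf_neq0 ?invr_eq0 ?expf_neq0 //.
by case: ((chartP F z).1 Uz).
Qed.

Lemma regular_affine_unc i : regular_at C z (affine_unc i).
Proof.
have h : regular_at C z (fun v => ev (tnth (unc_tuple K m) i) v / ev ('X_ev0 ^+ 2) v).
  apply: (@regular_quot _ _ _ _ z0 2).
  - have hX : ('X_i : {mpoly K[m.+2]}) \is 1.-homog by rewrite dhomogX /= mdeg1.
    by have := dhomog_unc hX; rewrite comp_mpolyXU -tnth_nth mul1n.
  - by rewrite mpolyXn dhomogX /= mdegMn mdeg1.
  - by rewrite /ev rmorphXn /= mevalXU expf_neq0.
apply: (regular_near z0 h); apply: near_ptT => v _.
rewrite /affine_unc /ev rmorphXn /= mevalXU tnth_mktuple uncontact_morph.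
by congr (_ / _); congr (uncontact _ _); apply/funext => j /=; rewrite mevalXU.
Qed.

Let reg G := regular_at_X z0 regular_affine_unc G.

(** As [F] vanishes on the variety, [taylor3] puts the sum of its differentials at v and at [z] in
    the cube of the maximal ideal. Once each is divided by its own derivative along x_1, they add up
    to a multiple of the symplectic pairing. *)
Lemma symplectic_mpow : max_ideal_pow C z 3
  (fun v => pairing (z *m symplectic_mx K m.+1) v / v 0 ev0).
Proof.
pose a := at_X affine_unc F^`M(var1).
have ha : regular_at C z (fun v => (a v)^-1) by apply: regularV (reg _) _.
have h3 := mpowM_regular z0 ha (taylor3 z0 regular_affine_unc F).
(* In [h3] both differentials are divided by [a], but the one at [z] should be divided by [b]. The
   discrepancy is a multiple of (a - b) times that differential, which has order three and is
   supplied by [h2]. *)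
have h2 := mpowS z0 (max_ideal_incr z0 regular_affine_unc F^`M(var1))
  (taylor2_z z0 regular_affine_unc F).
have h2' := mpowM_regular z0 (regularM z0 (regular_cst C z0 (2%:R^-1 * b^-1)) ha) h2.
have h := mpowM_regular z0 (regular_cst C z0 (- z 0 ev0)) (mpowD z0 h3 h2').
have nv0 : near_pt C z (fun v => v 0 ev0 != 0).
  have hX : ('X_ev0 : {mpoly K[N]}) \is 1.-homog by rewrite dhomogX /= mdeg1.
  have Xz : ev 'X_ev0 z != 0 by rewrite /ev mevalXU.
  by apply: (near_pt2 (near_pt_neq0 C hX Xz) (near_pt_neq0 C hX Xz)) => v _; rewrite /ev mevalXU.
apply: (mpow_near z0 h); apply: (near_pt2 nv0 (near_regular_neq0 z0 Cz (reg F^`M(var1)) b0)).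
move=> v Cv v0 av0; rewrite -/(a v) in av0.
have incr0 : incr z affine_unc F v = 0 by rewrite /incr !affine_unc_F ?subrr.
have incrE : incr z affine_unc F^`M(var1) v = a v - b by [].
rewrite incrE incr0 !sub0r.
pose D i := affine_unc i v - affine_unc i z.
pose V i := v 0 i / v 0 ev0; pose Z i := z 0 i / z 0 ev0.
have D0 : D var0 = 0 by rewrite /D !affine_unc0 ?subrr.
have dXE : diff_X z affine_unc F v =
    a v * D var1 - 2%:R * a v * \sum_j V (odr j) * D (varr j).
  rewrite /diff_X sum_var -/(D _) D0 mulr0 add0r; congr (_ + _).
  rewrite mulr_sumr -sumrN; apply: eq_bigr => j _; rewrite -/(D _) affine_unc_slope //.
  by rewrite -/(a v) /V; ring.
have dzE : diff_z z affine_unc F v =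
    b * D var1 - 2%:R * b * \sum_j Z (odr j) * D (varr j).
  rewrite /diff_z sum_var -/(D _) D0 mulr0 add0r; congr (_ + _).
  rewrite mulr_sumr -sumrN; apply: eq_bigr => j _; rewrite -/(D _) affine_unc_slope //.
  by rewrite -/b /Z; ring.
rewrite dXE dzE.
transitivity (z 0 ev0 * (D var1 - (\sum_j V (odr j) * D (varr j) + \sum_j Z (odr j) * D (varr j)))).
  by field; rewrite av0 b0.
have D1E : D var1 = V od0 - Z od0 + \sum_j (V (evr j) * V (odr j) - Z (evr j) * Z (odr j)).
  by rewrite /D !affine_unc1 // -/(V _) -/(Z _) big_split sumrN /=; ring.
(* In each further pair, V_e V_o - Z_e Z_o - (V_o + Z_o)(V_e - Z_e) = Z_e V_o - Z_o V_e, a term of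
   the symplectic form. *)
rewrite D1E -big_split -addrA -sumrN -big_split /=.
rewrite pairing_symplectic big_ord_recl mulrDl mulrDr mulr_sumr mulr_suml; congr (_ + _).
  by rewrite /V /Z; field; rewrite v0 ze0.
apply: eq_bigr => j _; rewrite /D !affine_uncr // /V /Z.
by field; rewrite v0 ze0.
Qed.

Lemma symplectic_od0 : (z *m symplectic_mx K m.+1) 0 od0 = z 0 ev0.
Proof. by rewrite symplectic_odn. Qed.

Lemma symplectic_neq0 : z *m symplectic_mx K m.+1 != 0.
Proof. by apply: contra_neq ze0 => e; rewrite -symplectic_od0 e mxE. Qed.

Lemma symplectic_osculates : osculates C z 2 (z *m symplectic_mx K m.+1).
Proof.
split; first exact: symplectic_neq0.
  by rewrite pairing_symplectic big1 // => k _; rewrite mulrC subrr.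
have lE v : pairing (delta_mx 0 ev0) v = v 0 ev0.
  rewrite /pairing (bigD1 ev0) //= mxE !eqxx mul1r big1 ?addr0 // => i /negbTE ni.
  by rewrite mxE ni mul0r.
exists (delta_mx 0 ev0); first by rewrite lE.
apply: (mpow_near z0 symplectic_mpow); apply: near_ptT => v _.
by rewrite lE.
Qed.

(** Both hyperplanes satisfy the row conditions; [t] makes their difference vanish at [od0], so
    [osc_rows_inj] applies to it. *)
Lemma osculates_symplectic h : osculates C z 2 h ->
  exists2 t, t != 0 & h = t *: (z *m symplectic_mx K m.+1).
Proof.
move=> oh; have [h0 _ _] := oh.
pose t := h 0 od0 / z 0 ev0; pose k := z *m symplectic_mx K m.+1.
have e : h - t *: k = 0.
  apply: (osc_rows_inj Uz) => [i ni|]; last first.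
    by rewrite mxE [X in _ + X]mxE [X in - X]mxE symplectic_od0 divfK ?subrr.
  rewrite mulmxBl -scalemxAl mxE [X in _ + X]mxE [X in - X]mxE.
  rewrite (osculates_rows hd hF pF cn Cz Uz oh ni).
  rewrite (osculates_rows hd hF pF cn Cz Uz symplectic_osculates ni).
  by rewrite mulr0 subrr.
have hE : h = t *: k by apply/eqP; rewrite -subr_eq0 e.
exists t => //; apply: contra_neq h0 => t0.
by rewrite hE t0 scale0r.
Qed.

Lemma osc_contact : osc 2 C z = hyperplane (z *m symplectic_mx K m.+1).
Proof.
apply/seteqP; split => v /= [v0 hv]; first exact/hv/symplectic_osculates.
split=> // h /osculates_symplectic [t t0 ->]; split=> //.
rewrite /pairing; under eq_bigr => i _ do rewrite mxE -mulrA.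
by rewrite -mulr_sumr -/(pairing _ _) hv mulr0.
Qed.

End SymplecticOsculates.

Lemma linear_of_dim_hyperplane_eq (K : fieldType) n e (h : 'rV[K]_n) : n = e.+2 ->
  h != 0 -> linear_of_dim (hyperplane h) e.
Proof. by move=> ne; subst n; apply: linear_of_dim_hyperplane. Qed.

(** * The osculating dual of the contact variety *)

Section OsculatingDual.
Variables (K : numClosedFieldType) (m d : nat) (F : {mpoly K[m.+2]}).
Hypotheses (hm : (0 < m)%N) (hd : (1 < d.+1)%N).
Hypotheses (hF : F \is d.+1.-homog) (pF : prime_elt F).
Hypotheses (c1 : F@_(U_(var1) *+ d.+1) != 0) (cn : F@_(U_(ord_max) *+ d.+1) != 0).
Hypothesis nD : ~ divides F (osc_det F).
Local Notation N := (2 * m.+1)%N.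
Local Notation C := (contact_variety F).
Local Notation J := (symplectic_mx K m.+1).

Lemma contact_scale t z : t != 0 -> C z -> C (t *: z).
Proof.
move=> t0 [z0 hz]; split; first by rewrite scaler_eq0 negb_or t0.
by move=> f [[e hf] Ff]; rewrite (ev_scale _ _ hf) hz ?mulr0 //; split=> //; exists e.
Qed.

Lemma general_osc : general C (fun z => smooth_point C z /\ linear_of_dim (osc 2 C z) (2 * m)).
Proof.
exists (chart F); split; first exact: zopen_chart hF.
  exact: (chart_nonempty hd hF pF c1 cn nD).
move=> z Cz Uz; split; first exact: (smooth_contact hd hF pF c1 cn Cz Uz).
rewrite (osc_contact hd hF pF cn Cz Uz); apply: linear_of_dim_hyperplane_eq.
  by rewrite mulnS.
exact: symplectic_neq0 Uz.
Qed.

(** A hyperplane containing the variety osculates at each of its points, hence is proportional to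
    omega(z, .) at every [z] of the chart. Then z_2 / z_0 would be constant there, but it is x_2 /
    x_0, which takes other values. *)
Lemma not_in_hyperplane_contact : not_in_hyperplane C.
Proof.
move=> h h0 Ch; pose j0 := Ordinal hm.
(* The constant value that z_2 / z_0 would have, read off [h] as a multiple of omega(z, .). *)
pose r := h 0 (odr j0) / h 0 od0.
have P0 : 'X_j0 - r%:MP != 0 :> {mpoly K[m]}.
  apply/eqP => /(congr1 (mcoeff U_(j0))).
  rewrite mcoeffB mcoeffX eqxx mcoeffC mcoeff0 mnm1_eq0 mulr0 subr0 => /eqP.
  by rewrite oner_eq0.
have [x [x0 Fx x00 ux]] :=
  generic_zero_independent hd hF pF c1 cn (not_divides_chart hd hF pF c1 cn nD) P0.
rewrite mevalB mevalXU mevalC => /eqP; apply.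
set z := theta_row F x; rewrite ev_pull -/z in ux.
have z0 : z != 0.
  apply: contra_neq ux => z0; rewrite /chart_eq z0 /ev mevalM mevalXU mxE mul0r //.
have Cz : C z by apply: theta_in_variety.
have Uz : chart F z by split.
have oh : osculates C z 2 h.
  have [_ hz] := Ch _ Cz; split=> //.
  have lE v : pairing (delta_mx 0 ev0) v = v 0 ev0.
    rewrite /pairing (bigD1 ev0) //= mxE !eqxx mul1r big1 ?addr0 // => i /negbTE ni.
    by rewrite mxE ni mul0r.
  exists (delta_mx 0 ev0); first by rewrite lE; case: ((chartP F z).1 Uz).
  apply: (mpow_near z0 (mpow0 C z0 3)); apply: near_ptT => v Cv.
  by have [_ ->] := Ch _ Cv; rewrite mul0r.
have [t t0 hE] := osculates_symplectic hd hF pF cn Cz Uz oh.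
have [_ ze0 _ _] := (chartP F z).1 Uz.
rewrite /r hE [X in _ - X / _]mxE [X in _ - _ / X]mxE !symplectic_odn.
have -> : t * z 0 (evr j0) / (t * z 0 ev0) = z 0 (evr j0) / z 0 ev0.
  by rewrite -mulf_div divff // mul1r.
have := ze0; rewrite theta_row_ev0 !mulf_eq0 !negb_or => /and3P [n2 _ y1].
rewrite !mxE /contact !four_casesE !mxE.
by field; rewrite x00 y1.
Qed.

Definition symplectic_tuple : N.-tuple {mpoly K[N]} :=
  [tuple \sum_i J i j *: 'X_i | j < N].

Lemma ev_symplectic f z : ev (f \mPo symplectic_tuple) z = ev f (z *m J).
Proof.
rewrite /ev comp_mpoly_meval; apply: meval_eq => j; rewrite tnth_mktuple mxE raddf_sum.
by apply: eq_bigr => i _; rewrite /= mevalZ mevalXU mulrC.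
Qed.

Lemma dhomog_symplectic e f : f \is e.-homog -> f \mPo symplectic_tuple \is e.-homog.
Proof.
move=> hf; rewrite -[e]muln1; apply: dhomog_comp hf _ => j; rewrite tnth_mktuple.
by apply: rpred_sum => i _; apply: rpredZ; rewrite dhomogX /= mdeg1.
Qed.

Lemma symplectic_mul_neq0 (z : 'rV[K]_N) : z != 0 -> z *m J != 0.
Proof.
apply: contra_neq => e; apply: oppr_inj; rewrite oppr0.
by rewrite -symplectic_invol e mul0mx.
Qed.

(** The matrix squares to -1, so composing the equations of the variety with it gives equations of
    the image. *)
Lemma zclosed_symplectic : zclosed [set v *m J | v in C].
Proof.
exists [set g | exists2 f, ((exists e, f \is e.-homog) /\ divides F (pull F f)) &
  g = f \mPo symplectic_tuple]; split.
  by move=> g [f [[e hf] _] ->]; exists e; apply: dhomog_symplectic.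
apply/seteqP; split => v /=.
  move=> [z [z0 hz] <-]; split; first exact: symplectic_mul_neq0.
  move=> g [f hf ->]; rewrite ev_symplectic symplectic_invol -scaleN1r.
  by have [[e he] _] := hf; rewrite (ev_scale _ _ he) hz ?mulr0.
move=> [v0 hv]; exists (-1 *: (v *m J)).
  apply: contact_scale; first by rewrite oppr_eq0 oner_eq0.
  split; first exact: symplectic_mul_neq0.
  by move=> f hf; rewrite -ev_symplectic; apply: hv; exists f.
by rewrite -scalemxAl symplectic_invol scaleN1r opprK.
Qed.

(** Testing on [chart] gives one inclusion, since the osculating hyperplanes there lie in the closed
    image. Conversely, if a form vanishes on the osculating hyperplanes over [U], its composite with
    omega vanishes on C after multiplication by an equation [s] of a smaller open set and by
    [chart_eq]; primality removes these two factors. *)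
Theorem osc_dual_contact : osc_dual C = [set v *m J | v in C].
Proof.
apply/seteqP; split => [h hh|_ [z Cz <-] U oU [y [Cy Uy]] Z [E [hE ->]] sub].
  apply: (hh (chart F)) => //; first exact: zopen_chart hF.
  - exact: (chart_nonempty hd hF pF c1 cn nD).
  - exact: zclosed_symplectic.
  move=> k [k0 [z [Cz Uz _]]]; rewrite (osc_contact hd hF pF cn Cz Uz) => hk.
  have [|t t0 ->] := hyperplane_sub (symplectic_neq0 Uz) k0; first by rewrite hk.
  by exists (t *: z); [apply: contact_scale | rewrite -scalemxAl].
split; first by apply: symplectic_mul_neq0; case: Cz.
move=> f Ef; have [e hf] := hE _ Ef.
have [e' [s [hs sy sU]]] := zopen_basic_sub oU Uy.
have nds : ~ divides F (pull F s).
  by move=> Fs; case/eqP: sy; case: Cy => _; apply; split=> //; exists e'.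
have Ffs : divides F (pull F ((f \mPo symplectic_tuple) * (s * chart_eq F))).
  apply: (vanishing_pull hd hF pF c1 cn) => w Cw; rewrite {1}/ev mevalM [X in _ * X]mevalM -!/(ev _ _).
  have w0 : w != 0 by case: Cw.
  have [->|sw] := eqVneq (ev s w) 0; first by rewrite mul0r mulr0.
  have [->|uw] := eqVneq (ev (chart_eq F) w) 0; first by rewrite !mulr0.
  have Uw : chart F w by split.
  have Kw := symplectic_neq0 Uw.
  have [|_ /(_ _ Ef)] := sub (w *m J); last by rewrite ev_symplectic => ->; rewrite mul0r.
  split=> //; exists w; split=> //; first exact: sU.
    exact: (smooth_contact hd hF pF c1 cn Cw Uw).
  exact: (osc_contact hd hF pF cn Cw Uw).
rewrite -ev_symplectic; case: Cz => _; apply; split.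
  by exists e; apply: dhomog_symplectic.
have pullM f1 f2 : pull F (f1 * f2) = pull F f1 * pull F f2 by apply: rmorphM.
move: Ffs; rewrite pullM [pull F (s * _)]pullM; case: pF => _ _ hmul /hmul [//|/hmul [//|]].
by move=> Fc; case: (not_divides_chart hd hF pF c1 cn nD Fc).
Qed.

Theorem contact_variety_self_dual :
  [/\ variety C /\ has_dim C m,
      general C (fun z => smooth_point C z /\ linear_of_dim (osc 2 C z) (2 * m)),
      not_in_hyperplane C &
      proj_equivalent C (osc_dual C)].
Proof.
split.
- split; first exact: (variety_contact hd hF pF c1 cn).
  exact: (has_dim_contact hd hF pF c1 cn).
- exact: general_osc.
- exact: not_in_hyperplane_contact.
by exists J; [exact: symplectic_unit | exact: osc_dual_contact].
Qed.

End OsculatingDual.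

(** * General hypersurfaces *)

Section Forms.
Variables (K : fieldType) (n d : nat).

Definition mon_at (i : 'I_#|monomials n d|) : 'X_{1..n.+1} := val (enum_val i).

Definition coefs_of (f : {mpoly K[n.+1]}) (i : 'I_#|monomials n d|) : K := f@_(mon_at i).

Lemma mdeg_mon_at i : mdeg (mon_at i) = d.
Proof. by have := enum_valP i; rewrite inE => /eqP. Qed.

Lemma mon_at_inj : injective mon_at.
Proof. by move=> i j /val_inj /enum_val_inj. Qed.

Lemma mon_atP (mu : 'X_{1..n.+1}) : mdeg mu = d -> exists i, mu = mon_at i.
Proof.
move=> hmu; have hb : (mdeg mu < d.+1)%N by rewrite hmu.
have h : BMultinom hb \in monomials n d by rewrite inE /= hmu.
by exists (enum_rank_in h (BMultinom hb)); rewrite /mon_at enum_rankK_in.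
Qed.

Lemma form_of_coefsK (f : {mpoly K[n.+1]}) : f \is d.-homog ->
  f = \sum_i coefs_of f i *: 'X_[mon_at i].
Proof.
move=> hf; apply/mpolyP => mu; rewrite raddf_sum /=.
have [e|ne] := eqVneq (mdeg mu) d.
  have [i ->] := mon_atP e; rewrite (bigD1 i) //= mcoeffZ mcoeffX eqxx mulr1.
  rewrite big1 ?addr0 // => j /negbTE ji.
  by rewrite mcoeffZ mcoeffX (inj_eq mon_at_inj) ji mulr0.
rewrite (dhomog_nemf_coeff hf) // big1 // => i _; rewrite mcoeffZ mcoeffX.
case: eqP => [e|_]; last by rewrite mulr0.
by rewrite -e mdeg_mon_at eqxx in ne.
Qed.

Lemma dhomog_form_of_coefs (a : 'rV[K]_#|monomials n d|) : form_of_coefs a \is d.-homog.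
Proof.
by apply: rpred_sum => i _; apply: rpredZ; rewrite dhomogX /= mdeg_mon_at.
Qed.

Lemma coefs_of_form (a : 'rV[K]_#|monomials n d|) i : coefs_of (form_of_coefs a) i = a 0 i.
Proof.
rewrite /coefs_of raddf_sum (bigD1 i) //= mcoeffZ mcoeffX -/(mon_at i) eqxx mulr1.
rewrite big1 ?addr0 // => j /negbTE ji.
by rewrite mcoeffZ mcoeffX -/(mon_at j) (inj_eq mon_at_inj) ji mulr0.
Qed.

End Forms.

(* Apart from x_0 ^ b x_1 ^ a, no monomial is a multiple of both x_0 ^ b and  *)
(* x_1 ^ a; x_2 ^ (a + b) and x_3 ^ (a + b) are multiples of none of them.    *)
Lemma card_monomials_lt n a b : (3 <= n)%N -> (0 < a)%N -> (0 < b)%N ->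
  (#|monomials n a| + #|monomials n b| < #|monomials n (a + b)|)%N.
Proof.
move=> hn a0 b0; pose i k : 'I_n.+1 := inord k.
have iE k l : (k <= 3)%N -> (l <= 3)%N -> (i k == i l) = (k == l).
  by move=> hk hl; rewrite -val_eqE /= !inordK //; lia.
pose L e := [seq @mon_at n e j | j <- enum 'I_#|monomials n e|].
have Lin e mu : (mu \in L e) = (mdeg mu == e).
  apply/mapP/eqP => [[j _ ->]|/mon_atP [j ->]]; first exact: mdeg_mon_at.
  by exists j; rewrite ?mem_enum.
have Lu e : uniq (L e) by rewrite map_inj_uniq ?enum_uniq //; apply: mon_at_inj.
pose L1 := [seq (mu + U_(i 0%N) *+ b)%MM | mu <- L a].
pose L2 := [seq (mu + U_(i 1%N) *+ a)%MM | mu <- rem (U_(i 0%N) *+ b)%MM (L b)].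
pose L3 := [:: (U_(i 2%N) *+ (a + b))%MM; (U_(i 3%N) *+ (a + b))%MM].
have sb : (U_(i 0%N) *+ b)%MM \in L b by rewrite Lin mdegMn mdeg1 mul1n.
have U1 : uniq L1 by rewrite map_inj_uniq // => mu nu /addIm.
have U2 : uniq L2 by rewrite map_inj_uniq ?rem_uniq // => mu nu /addIm.
have h1 mu : mu \in L1 -> (b <= mu (i 0%N))%N.
  by case/mapP => nu _ ->; rewrite mnmDE mulmnE mnm1E eqxx mul1n leq_addl.
have h2 mu : mu \in L2 -> (a <= mu (i 1%N))%N.
  by case/mapP => nu _ ->; rewrite mnmDE mulmnE mnm1E eqxx mul1n leq_addl.
have disj : ~~ has (mem L1) L2.
  apply/hasPn => _ /mapP [nu hnu ->]; apply/negP => /h1.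
  rewrite mnmDE mulmnE mnm1E iE // mul0n addn0 => bnu.
  move: hnu; rewrite mem_rem_uniq // !inE Lin => /andP [ne /eqP nub].
  case/eqP: ne; rewrite -nub; apply: mnm_eq_mdeg; apply/eqP.
  by rewrite eqn_leq mnm_le_mdeg nub.
have U123 : uniq (L3 ++ L1 ++ L2).
  rewrite !cat_uniq U1 U2 disj !andbT; apply/andP; split.
    rewrite /= inE andbT; apply/eqP => /mnmP /(_ (i 2%N)).
    by rewrite !mulmnE !mnm1E !iE // mul1n mul0n; lia.
  apply/hasPn => mu; rewrite mem_cat => hmu; apply/negP; rewrite !inE.
  case/orP: hmu => [/h1|/h2] hmu /orP [] /eqP e; move: hmu;
    by rewrite e mulmnE mnm1E iE // mul0n leqNgt ?a0 ?b0.
have sub : {subset L3 ++ L1 ++ L2 <= L (a + b)%N}.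
  move=> mu; rewrite !mem_cat Lin => /or3P [].
  - by rewrite !inE => /orP [] /eqP ->; rewrite mdegMn mdeg1 mul1n.
  - by case/mapP => nu; rewrite Lin => /eqP nua ->; rewrite mdegD nua mdegMn mdeg1 mul1n.
  case/mapP => nu /mem_rem; rewrite Lin => /eqP nub ->.
  by rewrite mdegD nub mdegMn mdeg1 mul1n addnC.
have sL e : size (L e) = #|monomials n e| by rewrite size_map size_enum_ord.
have s1 : size L1 = #|monomials n a| by rewrite size_map sL.
have s2 : size L2 = #|monomials n b|.-1 by rewrite size_map size_rem // sL.
have := uniq_leq_size U123 sub; rewrite !size_cat s1 s2 sL.
have : (0 < #|monomials n b|)%N by rewrite -sL; case: (L b) sb.
by rewrite /=; lia.
Qed.

Lemma mcoeff_pihomog n (K : fieldType) a (f : {mpoly K[n]}) mu :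
  (pihomog mdeg a f)@_mu = if mdeg mu == a then f@_mu else 0.
Proof.
case: eqP => [<-|/eqP ne]; last exact: (dhomog_nemf_coeff (pihomogP _ _ _) ne).
pose k := maxn (msize f) (mdeg mu).+1.
have -> : f@_mu = \sum_(j < k) (pihomog mdeg j f)@_mu.
  by rewrite {1}(@pihomog_partitionE _ _ mdeg k f) ?leq_maxl // raddf_sum.
have hk : (mdeg mu < k)%N by rewrite leq_maxr.
rewrite (bigD1 (Ordinal hk)) //= [X in _ + X]big1 ?addr0 // => j nj.
apply: (dhomog_nemf_coeff (pihomogP _ _ _)); rewrite eq_sym.
by apply: contra nj => /eqP e; apply/eqP/val_inj.
Qed.

(** In degree [a + b] a monomial of the product comes from the top degrees, or one of its two
    factors has too large a degree. *)
Lemma pihomogM_top n (K : fieldType) a b (f g : {mpoly K[n]}) :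
  (msize f <= a.+1)%N -> (msize g <= b.+1)%N ->
  pihomog mdeg (a + b) (f * g) = pihomog mdeg a f * pihomog mdeg b g.
Proof.
move=> sf sg; apply/mpolyP => mu; rewrite mcoeff_pihomog.
case: eqP => [hmu|/eqP ne]; last first.
  by rewrite (dhomog_nemf_coeff (dhomogM (pihomogP _ _ _) (pihomogP _ _ _)) ne).
pose k := (mdeg mu).+1.
rewrite !(mcoeff_poly_mul _ _ (k := k)) //; apply: eq_bigr => -[k1 k2] /= /eqP e.
rewrite !mcoeff_pihomog; have := congr1 (@mdeg n) e; rewrite mdegD hmu => hd.
have small (h : {mpoly K[n]}) c (l : 'X_{1..n}) : (msize h <= c.+1)%N -> (c < mdeg l)%N -> h@_l = 0.
  by move=> sh cl; apply/eqP; rewrite mcoeff_eq0; apply: msize_mdeg_ge; apply: leq_trans sh cl.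
have [e1|l1|g1] := ltngtP (mdeg k1) a.
- rewrite mul0r (small g b) ?mulr0 //; move: hd e1; lia.
- by rewrite (small f a) ?mul0r.
by rewrite (_ : mdeg k2 == b) //; apply/eqP; move: hd; rewrite g1 => /addnI.
Qed.

Section GenericIrreducible.
Variables (K : numFieldType) (n d : nat).
Hypothesis hn : (3 <= n)%N.

(** The coefficients of [f * g] are polynomials in those of [f] and [g], which by
    [card_monomials_lt] are fewer; so they satisfy a fixed algebraic relation. *)
Lemma split_relation a b : (0 < a)%N -> (0 < b)%N ->
  exists2 P : {mpoly K[#|monomials n (a + b)|]}, P != 0 &
    forall f g : {mpoly K[n.+1]}, f \is (a).-homog -> g \is b.-homog ->
      P.@[coefs_of (f * g)] = 0.
Proof.
move=> a0 b0; pose M := (#|monomials n a| + #|monomials n b|)%N.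
pose c (i : 'I_#|monomials n (a + b)|) : {mpoly K[M]} :=
  \sum_j \sum_(k | mon_at i == (mon_at j + mon_at k)%MM) 'X_(lshift _ j) * 'X_(rshift _ k).
have [P P0 hP] := algebraic_dependence c (card_monomials_lt hn a0 b0).
exists P => // f g hf hg.
pose x (i : 'I_M) := match split i with inl j => coefs_of f j | inr k => coefs_of g k end.
rewrite -[RHS](hP x); apply: meval_eq => i.
rewrite /coefs_of {1}(form_of_coefsK hf) {1}(form_of_coefsK hg) mulr_suml !raddf_sum /=.
apply: eq_bigr => j _; rewrite mulr_sumr !raddf_sum [RHS]big_mkcond /=.
apply: eq_bigr => k _; rewrite -scalerAl -scalerAr scalerA -[in LHS]mpolyXD mcoeffZ mcoeffX eq_sym.
case: ifP => _; last by rewrite mulr0.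
by rewrite mulr1 mevalM !mevalXU /x -[lshift _ _]/(unsplit (inl _))
  -[rshift _ _]/(unsplit (inr _)) !unsplitK.
Qed.

Lemma generic_irreducible : exists2 P : {mpoly K[#|monomials n d|]}, P != 0 &
  forall F : {mpoly K[n.+1]}, F \is d.-homog -> F != 0 -> P.@[coefs_of F] != 0 ->
    forall f g, F = f * g -> invertible f \/ invertible g.
Proof.
have rel (a : 'I_d.+1) : exists P : {mpoly K[#|monomials n d|]}, P != 0 /\
    ((0 < a)%N -> (0 < d - a)%N -> forall f g : {mpoly K[n.+1]},
      f \is (nat_of_ord a).-homog -> g \is (d - a)%N.-homog -> P.@[coefs_of (f * g)] = 0).
  (* If [a] is 0 or [d] there is no splitting to exclude, and the constant 1 serves. *)
  have [a0|a0] := ltnP 0 a; last by exists 1; rewrite oner_neq0.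
  have [b0|b0] := ltnP 0 (d - a); last by exists 1; rewrite oner_neq0.
  have [P P0 hP] := split_relation a0 b0.
  have ad : (a <= d)%N by rewrite -ltnS.
  by move: P P0 hP; rewrite (subnKC ad) => P P0 hP; exists P.
have [P hP] := choice rel.
exists (\prod_a P a); first by apply/prodf_neq0 => a _; case: (hP a).
move=> F hF F0 PF f g e.
have [f0 g0] : f != 0 /\ g != 0 by apply/andP; rewrite -negb_or -mulf_eq0 -e.
have sizes : (msize f + msize g = d.+2)%N.
  have sf0 : (0 < msize f)%N by rewrite lt0n msize_poly_eq0.
  have sg0 : (0 < msize g)%N by rewrite lt0n msize_poly_eq0.
  have : (msize f + msize g).-1 = d.+1 by rewrite -msizeM // -e (dhomog_size F0 hF).
  by move: (msize f) (msize g) sf0 sg0 => x y; lia.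
have unit1 (h : {mpoly K[n.+1]}) : h != 0 -> (msize h <= 1)%N -> invertible h.
  move=> h0 /msize1_polyC hE; exists ((h@_0)^-1)%:MP.
  rewrite {2}hE -mpolyCM mulVf ?mpolyC1 //.
  by apply: contra_neq h0 => h0; rewrite hE h0 mpolyC0.
have [/(unit1 _ f0)|sf] := leqP (msize f) 1; first by left.
have [/(unit1 _ g0)|sg] := leqP (msize g) 1; first by right.
have ha : ((msize f).-1 < d.+1)%N by lia.
pose a := Ordinal ha.
have [_ /(_ _ _ (pihomog mdeg a f) (pihomog mdeg (d - a) g))] := hP a.
have sgE : msize g = (d - (msize f).-1).+1.
  by move: (msize f) (msize g) sizes sf sg => x y; lia.
(* The factors are not assumed homogeneous, but the homogeneous [F] is the product of their top
   parts. *)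
have FE : pihomog mdeg a f * pihomog mdeg (d - a) g = F.
  rewrite -pihomogM_top ?sgE //=; last by rewrite prednK // ltnW.
  by rewrite (subnKC (_ : (msize f).-1 <= d)%N) -?e ?pihomog_dE // -ltnS.
rewrite FE => h; case/eqP: PF; rewrite rmorph_prod (bigD1 a) //= h ?mul0r ?pihomogP //=.
  by rewrite -ltnS prednK // ltnW.
by rewrite -ltnS -sgE.
Qed.

End GenericIrreducible.

(* The remainder r of the pseudo-division of p by f cannot vanish, by the     *)
(* specialization phi0; so p is not a multiple of f for any specialization    *)
(* keeping the leading coefficients of f and r.                               *)
Lemma specialized_not_multiple (B : idomainType) (K : fieldType) (f p : {poly B})
    (phi0 : {rmorphism B -> K}) t : phi0 (lead_coef f) != 0 ->
  (map_poly phi0 f).[t] = 0 -> (map_poly phi0 p).[t] != 0 ->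
  exists2 c, c != 0 & forall phi : {rmorphism B -> K}, phi c != 0 ->
    forall q, map_poly phi p <> q * map_poly phi f.
Proof.
move=> lf ft pt; have f0 : f != 0 by apply: contra_neq lf => ->; rewrite lead_coef0 rmorph0.
have e := Pdiv.Idomain.divp_eq p f; set k := scalp p f in e; set r := p %% f in e.
have spec (phi : {rmorphism B -> K}) : (phi (lead_coef f) ^+ k)%:P * map_poly phi p =
    map_poly phi (p %/ f) * map_poly phi f + map_poly phi r.
  by rewrite -rmorphM -rmorphD -e -mul_polyC rmorphM /= map_polyC /= (rmorphXn phi).
have r0 : r != 0.
  apply: contra_neq pt => r0; have := congr1 (horner^~ t) (spec phi0).
  rewrite r0 rmorph0 addr0 /= !hornerM ft mulr0 hornerC => /eqP.
  by rewrite mulf_eq0 expf_eq0 (negbTE lf) andbF => /eqP.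
exists (lead_coef r * lead_coef f); first by rewrite mulf_neq0 ?lead_coef_eq0.
move=> phi; rewrite rmorphM mulf_eq0 negb_or => /andP [pr pf] q pq.
have := spec phi; rewrite pq mulrA => /eqP; rewrite addrC -subr_eq -mulrBl => /eqP rE.
have sf : size (map_poly phi f) = size f by rewrite size_poly_eq.
have sr : size (map_poly phi r) = size r by rewrite size_poly_eq.
have rs : (size r < size f)%N by rewrite ltn_modp.
move: rE; set u := _ - _ => rE.
have u0 : u != 0.
  apply/eqP => u0; move: sr; rewrite -rE u0 mul0r size_poly0 => /esym/eqP.
  by rewrite size_poly_eq0 (negbTE r0).
have fp0 : map_poly phi f != 0 by rewrite -size_poly_eq0 sf size_poly_eq0.
have := size_mul u0 fp0; rewrite rE sr sf; move: u0 rs; rewrite -size_poly_gt0.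
by move: (size u) (size r) (size f) => x y z; lia.
Qed.

Lemma mderiv_Xn n (A : comNzRingType) (i j : 'I_n) k : i != j ->
  ('X_j ^+ k : {mpoly A[n]})^`M(i) = 0.
Proof.
by move=> ij; rewrite mpolyXn mderivX mulmnE mnm1E eq_sym (negbTE ij) mul0n scale0r.
Qed.

Lemma mderiv_var n (A : comNzRingType) (i j : 'I_n) :
  ('X_j : {mpoly A[n]})^`M(i) = (i == j)%:R.
Proof.
rewrite mderivX mnm1E eq_sym; case: eqP => [->|_]; last by rewrite scale0r.
rewrite scale1r (_ : (U_(j) - U_(j))%MM = 0%MM) ?mpolyX0 //.
by apply/mnmP => k; rewrite !mnmE subnn.
Qed.

(** * An explicit form whose osculation matrix is invertible at a point *)

Section Example.
Variables (K : numClosedFieldType) (m e : nat).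
Local Notation P := {mpoly K[m.+2]}.

(* Near (1 : 0 : ... : 0) this is the graph of a sum of cubes, for which       *)
(* y_j / y_1 is quadratic in x_j; so theta has independent second derivatives. *)
Definition sample : P := 'X_var0 ^+ e.+2 * 'X_var1 + 'X_var1 ^+ e.+3
  - 'X_var0 ^+ e * \sum_j 'X_(varr j) ^+ 3.

Definition base_point : 'rV[K]_m.+2 := delta_mx 0 var0.
Local Notation x := base_point.

Lemma ev_base_var i : ev 'X_i x = (i == var0)%:R.
Proof. by rewrite /ev mevalXU mxE. Qed.

Let evM (p q : P) : ev (p * q) x = ev p x * ev q x. Proof. exact: mevalM. Qed.
Let evD (p q : P) : ev (p + q) x = ev p x + ev q x. Proof. exact: mevalD. Qed.
Let evB (p q : P) : ev (p - q) x = ev p x - ev q x. Proof. exact: mevalB. Qed.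
Let evN (p : P) : ev (- p) x = - ev p x. Proof. exact: mevalN. Qed.
Let evX (p : P) k : ev (p ^+ k) x = ev p x ^+ k. Proof. exact: rmorphXn. Qed.
Let ev_nat k : ev (k%:R : P) x = k%:R. Proof. exact: rmorph_nat. Qed.

Lemma dhomog_sample : sample \is e.+3.-homog.
Proof.
rewrite /sample mulr_sumr; apply: rpredB; last first.
  apply: rpred_sum => j _; rewrite !mpolyXn -mpolyXD dhomogX /= mdegD !mdegMn !mdeg1.
  by rewrite !mul1n addnC.
rewrite !mpolyXn; apply: rpredD; last by rewrite dhomogX /= mdegMn mdeg1 mul1n.
by rewrite -mpolyXD dhomogX /= mdegD mdegMn !mdeg1 mul1n addn1.
Qed.

(** The term x_1^(e+3) of [sample] is there for this: the restriction to a line along x_1 keeps full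
    degree. *)
Lemma sample_coef : sample@_(U_(var1) *+ e.+3) = 1.
Proof.
rewrite /sample mulr_sumr !mpolyXn -mpolyXD mcoeffB mcoeffD !mcoeffX raddf_sum /= eqxx.
rewrite (_ : (_ == _) = false) ?add0r; last first.
  by apply/eqP => /mnmP /(_ var0); rewrite mnmDE !mulmnE !mnm1E /=; lia.
rewrite big1 ?subr0 // => j _; rewrite mpolyXn -mpolyXD mcoeffX.
case: eqP => // /mnmP /(_ (varr j)).
by rewrite mnmDE !mulmnE !mnm1E eqxx (inj_eq (@lift_inj _ _)) /=; lia.
Qed.

Lemma sample_derivE i : sample^`M(i) =
  ('X_var0 ^+ e.+2)^`M(i) * 'X_var1 + 'X_var0 ^+ e.+2 * (i == var1)%:R +
  ('X_var1 ^+ e.+3)^`M(i) - (('X_var0 ^+ e)^`M(i) * \sum_j 'X_(varr j) ^+ 3 +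
  'X_var0 ^+ e * \sum_j ('X_(varr j) ^+ 3)^`M(i)).
Proof.
rewrite /sample mderivB mderivD -(raddf_sum (mderiv i)) /=.
move: ('X_var0 ^+ e.+2) ('X_var0 ^+ e) ('X_var1 ^+ e.+3) (\sum_j _) => p q r s.
by rewrite !mderivM mderiv_var.
Qed.

Lemma sample_derivr l :
  sample^`M(varr l) = - (3%:R * ('X_var0 ^+ e * ('X_(varr l) * 'X_(varr l)))).
Proof.
rewrite sample_derivE !mderiv_Xn // mulr0n mulr0 !mul0r !add0r.
rewrite (bigD1 l) //= big1 ?addr0 => [|j jl]; last first.
  by rewrite mderiv_Xn // (inj_eq (@lift_inj _ _)) (inj_eq (@lift_inj _ _)) eq_sym.
move: ('X_var0 ^+ e) => p.
rewrite (_ : 'X_(varr l) ^+ 3 = 'X_(varr l) * ('X_(varr l) * 'X_(varr l))) //.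
by rewrite !mderivM mderiv_var eqxx /=; ring.
Qed.

Lemma sample_deriv1 : ev sample^`M(var1) x = 1.
Proof.
rewrite sample_derivE !(mderiv_Xn _ (i := var1) (j := var0)) // eqxx.
rewrite [\sum_j ('X_(varr j) ^+ 3)^`M(_)]big1 => [|j _]; last by rewrite mderiv_Xn.
rewrite mul0r add0r mulr1 mul0r add0r mulr0 subr0 (exprS _ e.+2) mderivM mderiv_var.
by rewrite !(evD, evM, evX) !ev_base_var expr1n expr0n mulr0 mul0r !addr0.
Qed.

Lemma ev_base_cubes : ev (\sum_(j < m) 'X_(varr j) ^+ 3) x = 0.
Proof.
rewrite /ev raddf_sum big1 // => j _.
by rewrite /= rmorphXn /= -/(ev _ _) ev_base_var expr0n.
Qed.

Lemma sample_deriv0 : ev sample^`M(var0) x = 0.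
Proof.
rewrite sample_derivE (mderiv_Xn _ (i := var0) (j := var1)) //.
rewrite [\sum_j ('X_(varr j) ^+ 3)^`M(_)]big1 => [|j _]; last by rewrite mderiv_Xn.
by rewrite mulr0n !mulr0 !addr0 evB !evM ev_base_cubes ev_base_var !mulr0 subr0.
Qed.

Lemma ev_sample : ev sample x = 0.
Proof.
rewrite evB evD !evM !evX ev_base_cubes !ev_base_var.
by rewrite (mulr0n (1 : K)) !(mulr0, mul0r) !(subr0, addr0).
Qed.

Lemma sample_deriv b : ev sample^`M(b) x = (b == var1)%:R.
Proof.
move: b; apply: var_ind => [||l]; rewrite ?sample_deriv0 ?sample_deriv1 //.
by rewrite sample_derivr !(evN, evM) !ev_base_var /= !mulr0 oppr0.
Qed.

Lemma sample_deriv2 b l : ev sample^`M(b)^`M(varr l) x = 0.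
Proof.
rewrite mderiv_comm sample_derivr mderivN !mderivM !(evN, evM, evD) !ev_base_var /=.
by ring.
Qed.

Lemma sample_derivrr l :
  sample^`M(varr l)^`M(varr l) = - ('X_var0 ^+ e * 'X_(varr l) *+ 6).
Proof.
have : ('X_var0 ^+ e : P)^`M(varr l) = 0 by apply: mderiv_Xn.
rewrite sample_derivr mulr_natl mderivN mderivMn; move: ('X_var0 ^+ e) => p dp.
by rewrite !mderivM dp mderiv_var eqxx /=; ring.
Qed.

Lemma sample_deriv3 b l :
  ev sample^`M(b)^`M(varr l)^`M(varr l) x = - (6%:R * (b == varr l)%:R).
Proof.
rewrite (mderiv_comm b) (mderiv_comm b) sample_derivrr mderivN mderivMn mderivM mderiv_var.
rewrite evN /ev mevalMn -/(ev _ _) evD !evM ev_nat ev_base_var evX ev_base_var expr1n.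
by rewrite mulr0 add0r mul1r mulr_natl.
Qed.

(** At the base point the gradient is the coordinate vector of x_1, so Koszul derivatives are
    partial derivatives there. The same holds for the squares below, as the second derivatives
    involved vanish by [sample_deriv2]. *)
Lemma ev_koszul_sample l (p : P) : ev (koszul sample (varr l) p) x = ev p^`M(varr l) x.
Proof. by rewrite evB !evM !sample_deriv /= mul1r mul0r subr0. Qed.

Lemma ev_koszul2_sample l (p : P) :
  ev (koszul sample (varr l) (koszul sample (varr l) p)) x = ev p^`M(varr l)^`M(varr l) x.
Proof.
rewrite ev_koszul_sample /koszul mderivB !mderivM !(evB, evD, evM) !sample_deriv2 !sample_deriv /=.
by ring.
Qed.

Lemma theta_sample_deriv a b l : ev ('X_a * sample^`M(b))^`M(varr l) x = ((a == varr l) && (b == var1))%:R.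
Proof.
rewrite mderivM mderiv_var evD !evM ev_nat sample_deriv2 mulr0 addr0 sample_deriv.
by rewrite -natrM mulnb eq_sym.
Qed.

Lemma theta_sample_deriv2 a b l : ev ('X_a * sample^`M(b))^`M(varr l)^`M(varr l) x =
  - (6%:R * ((a == var0) && (b == varr l))%:R).
Proof.
move: (sample_deriv2 b l) (sample_deriv3 b l); move: sample^`M(b) => p p2 p3.
rewrite mderivM mderiv_var mderivD !mderivM mderiv_var.
have -> : ((varr l == a)%:R : P)^`M(varr l) = 0 by rewrite -mpolyC_nat mderivC.
rewrite !(evD, evM) ev_nat ev_base_var p2 p3 !mulr0.
have -> : ev (0 : P) x = 0 by exact: meval0.
by rewrite -mulnb natrM; ring.
Qed.

(** Handles evaluation, first derivatives and second derivatives of theta, the three kinds of rows,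
    by the same formula. *)
Lemma additive_theta_poly (L : P -> K) (F : P) j :
  (forall p q, L (p - q) = L p - L q) ->
  L (theta_poly F j) = four_cases (2%:R * L ('X_var0 * F^`M(var1)))
    (L ('X_var1 * F^`M(var1)) - L ('X_var0 * F^`M(var0)))
    (fun k => 2%:R * L ('X_(varr k) * F^`M(var1)))
    (fun k => - L ('X_var0 * F^`M(varr k))) j.
Proof.
move=> LB; have L0 : L 0 = 0 by rewrite -(subrr 0) LB subrr.
have LN p : L (- p) = - L p by rewrite -sub0r LB L0 sub0r.
have L2 p : L (2%:R * p) = 2%:R * L p.
  by rewrite (_ : 2%:R * p = p - - p) ?LB ?LN; ring.
move: j; apply: index_ind => [||k|k]; rewrite /theta_poly /contact !four_casesE //.
Qed.

Lemma osc_at_sample : osc_at sample x =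
  diag_mx (\row_i four_cases 2%:R 1 (fun=> 2%:R) (fun=> 6%:R) i).
Proof.
have od_ev k l : (odn k == evn l :> 'I_(2 * m.+1)) = false by rewrite eq_sym evn_odn.
have evI k l : (evn k == evn l :> 'I_(2 * m.+1)) = (k == l) := can_eq (@evnK _) k l.
have odI k l : (odn k == odn l :> 'I_(2 * m.+1)) = (k == l) := can_eq (@odnK _) k l.
have lI k l : (varr k == varr l :> 'I_m.+2) = (k == l).
  by rewrite !(inj_eq (@lift_inj _ _)).
have lI1 (k l : 'I_m) : (lift ord0 k == lift ord0 l :> 'I_m.+1) = (k == l).
  by rewrite (inj_eq (@lift_inj _ _)).
have th a b : ev ('X_a * sample^`M(b)) x = ((a == var0) && (b == var1))%:R.
  by rewrite evM ev_base_var sample_deriv -natrM mulnb.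
apply/matrixP => i j; rewrite !mxE; move: i; apply: index_ind => [||l|l]; rewrite !four_casesE.
- rewrite (additive_theta_poly _ _ (L := fun p => ev p x)); last exact: evB.
  move: j; apply: index_ind => [||k|k]; rewrite !four_casesE !th ?(evn_odn, od_ev, evI, odI) /=.
  all: try (by rewrite ?mulr0n ?mulr1n; ring).
- rewrite eq_sym /ev; case: (_ == j); rewrite ?mulr1n ?mulr0n; [exact: meval1 | exact: meval0].
- rewrite ev_koszul_sample (additive_theta_poly _ _ (L := fun p => ev p^`M(varr l) x)); last first.
    by move=> p q; rewrite mderivB evB.
  move: j; apply: index_ind => [||k|k]; rewrite !four_casesE !theta_sample_deriv
    ?(evn_odn, od_ev, evI, odI, lI, lI1) /=.
  all: try (by rewrite ?mulr0n ?mulr1n; ring).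
  rewrite andbT eq_sym; case: (l == k); rewrite ?mulr0n ?mulr1n /=; ring.
rewrite ev_koszul2_sample
  (additive_theta_poly _ _ (L := fun p => ev p^`M(varr l)^`M(varr l) x)); last first.
  by move=> p q; rewrite !mderivB evB.
move: j; apply: index_ind => [||k|k]; rewrite !four_casesE !theta_sample_deriv2
  ?(evn_odn, od_ev, evI, odI, lI, lI1) /=.
all: try (by rewrite ?mulr0n ?mulr1n; ring).
by rewrite eq_sym; case: (l == k); rewrite ?mulr0n ?mulr1n /=; ring.
Qed.

Lemma osc_det_sample : ev (osc_det sample) x != 0.
Proof.
rewrite -[ev _ x]/((meval (x 0)) _) /osc_det -det_map_mx -[map_mx _ _]/(osc_at sample x).
rewrite osc_at_sample det_diag; apply/prodf_neq0 => i _; rewrite mxE.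
by move: i; apply: index_ind => [||l|l]; rewrite !four_casesE ?oner_neq0 // Num.Theory.pnatr_eq0.
Qed.

End Example.

Lemma map_slice (A A' : comNzRingType) (f : {rmorphism A -> A'}) k (G : {mpoly A[k]}) i h :
  map_poly f (slice G i h) = slice (map_mpoly f G) i (f \o h).
Proof.
rewrite -[LHS]/((map_poly f \o mmap polyC (fun j => if j == i then 'X else (h j)%:P)) G).
rewrite -[RHS]/((mmap polyC (fun j => if j == i then 'X else (f (h j))%:P) \o map_mpoly f) G).
apply: mpoly_morph_ext => [c|j] /=.
  by rewrite mmapC map_polyC /= map_mpolyC mmapC.
rewrite mmapX mmap1U map_mpolyX mmapX mmap1U.
by case: ifP => _; rewrite ?map_polyX ?map_polyC.
Qed.

Lemma divides_slice (K : idomainType) n (F G : {mpoly K[n]}) i h : divides F G ->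
  exists q, slice G i h = q * slice F i h.
Proof. by case=> q ->; exists (slice q i h); rewrite /slice rmorphM. Qed.

(** Both [G] and its [osc_det] are restricted to the line through the base point along x_1. For
    [sample] the first vanishes at the base point and the second does not, so
    [specialized_not_multiple] applies. *)
Lemma specialized_osc_det (B : idomainType) (K : numClosedFieldType) m e
    (G : {mpoly B[m.+2]}) (phi0 : {rmorphism B -> K}) :
  G \is e.+3.-homog -> map_mpoly phi0 G = sample K m e ->
  exists2 c, c != 0 & forall (phi : {rmorphism B -> K}) F, map_mpoly phi G = F ->
    phi c != 0 -> ~ divides F (osc_det F).
Proof.
move=> hG G0; pose h (i : 'I_m.+2) : B := (i == var0)%:R.
have spec (phi : {rmorphism B -> K}) H : map_poly phi (slice H var1 h) =
    slice (map_mpoly phi H) var1 (fun i => (i == var0)%:R).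
  by rewrite map_slice; congr (slice _ _ _); apply/funext => i; rewrite /= rmorph_nat.
have spec0 H : (map_poly phi0 (slice H var1 h)).[0] = ev (map_mpoly phi0 H) (base_point K m).
  by rewrite spec horner_slice; apply: meval_eq; apply: var_ind => [||j]; rewrite mxE.
have p1 : phi0 G@_(U_(var1) *+ e.+3) = 1.
  by rewrite -mcoeff_map_mpoly G0 sample_coef.
have lf : lead_coef (slice G var1 h) = G@_(U_(var1) *+ e.+3).
  rewrite lead_coefE (size_slice_eq _ hG) /=; first by rewrite (coef_slice _ _ hG).
  by apply: contra_eq_neq p1 => ->; rewrite rmorph0 eq_sym oner_neq0.
have [||| c c0 hc] := @specialized_not_multiple B K (slice G var1 h)
  (slice (osc_det G) var1 h) phi0 0.
- by rewrite lf p1 oner_neq0.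
- by rewrite spec0 G0 ev_sample.
- by rewrite spec0 map_osc_det G0; apply: osc_det_sample.
exists c => // phi F FE pc /(divides_slice var1 (fun i => (i == var0)%:R)) [q qE].
by apply: (hc phi pc q); rewrite !spec map_osc_det FE.
Qed.

(** * From the example to general hypersurfaces *)

Section GenericOsculation.
Variables (K : numClosedFieldType) (m e : nat).
Local Notation d := e.+3.
Local Notation n := m.+1.
Local Notation B := {mpoly K[#|monomials n d|]}.

Definition generic_form : {mpoly B[m.+2]} :=
  \sum_i ('X_i : B) *: 'X_[@mon_at n d i].

Lemma map_generic_form (a : 'rV[K]_#|monomials n d|) :
  map_mpoly (meval (a 0)) generic_form = form_of_coefs a.
Proof.
rewrite raddf_sum; apply: eq_bigr => i _; rewrite /= map_mpolyZ map_mpolyX /=.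
by rewrite mevalXU.
Qed.

Lemma dhomog_generic_form : generic_form \is d.-homog.
Proof.
by apply: rpred_sum => i _; apply: rpredZ; rewrite dhomogX /= mdeg_mon_at.
Qed.

Theorem generic_osc_det : exists2 c : B, c != 0 &
  forall a : 'rV[K]_#|monomials n d|, c.@[a 0] != 0 ->
    ~ divides (form_of_coefs a) (osc_det (form_of_coefs a)).
Proof.
pose a0 : 'rV[K]_#|monomials n d| := \row_i coefs_of (sample K m e) i.
have a0E : map_mpoly (meval (a0 0)) generic_form = sample K m e.
  rewrite map_generic_form [RHS](form_of_coefsK (dhomog_sample K m e)).
  by apply: eq_bigr => i _; rewrite mxE.
have [c c0 hc] := specialized_osc_det dhomog_generic_form a0E.
exists c => // a; exact: hc (map_generic_form a).
Qed.

End GenericOsculation.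

(* A non-homogeneous condition P != 0 which only depends on the point of the  *)
(* projective space holds, after rescaling, wherever some homogeneous         *)
(* component of P does not vanish.                                            *)
Lemma general_of_nonvanishing (K : numFieldType) N (i0 : 'I_N) (P : {mpoly K[N]})
    (Q : 'rV[K]_N -> Prop) : P != 0 ->
  (forall v, v != 0 -> ev P v != 0 -> Q v) ->
  (forall t v, t != 0 -> Q (t *: v) -> Q v) -> general (@proj_space _ _) Q.
Proof.
move=> P0 hP hQ; have [s partE] : exists s, P = \sum_(k < s) pihomog mdeg k P.
  by exists (msize P); apply: pihomog_partitionE.
have [j j0] : exists j : 'I_s, pihomog mdeg j P != 0.
  apply: contrapT => h; case/eqP: P0; rewrite partE big1 // => j _.
  by apply: contrapT => /eqP hj; apply: h; exists j.
exists (basic_open (pihomog mdeg j P)); split.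
- exact: (zopen_basic (pihomogP _ _ _)).
- have /mpoly_nonroot [v] : pihomog mdeg j P * 'X_i0 != 0.
    by rewrite mulf_neq0 // -msize_poly_eq0 msizeX mdeg1.
  rewrite mevalM mulf_eq0 mevalXU negb_or => /andP [pv v0].
  have w0 : \row_i v i != 0 by apply: contra_neq v0 => /rowP /(_ i0); rewrite !mxE.
  exists (\row_i v i); split=> //; split=> //.
  by rewrite /ev (meval_eq (v2 := v)) // => i; rewrite mxE.
(* [q] is P(t v) as a polynomial in t; its coefficient [j] is nonzero, so some nonzero t gives a
   multiple of [v] at which [P] does not vanish. *)
move=> v v0 [_ pv]; pose q : {poly K} := \poly_(k < s) ev (pihomog mdeg k P) v.
have /poly_nonroot [t t0 qt] : q != 0.
  by apply: contra_neq pv => /(congr1 (coefp j)) /=; rewrite coef0 coef_poly ltn_ord.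
apply: (hQ t) => //; apply: hP; first by rewrite scaler_eq0 negb_or t0.
apply: contra_neq qt => pt; rewrite -[RHS]pt horner_poly {2}/ev {2}partE raddf_sum /=.
by apply: eq_bigr => k _; rewrite -[RHS]/(ev _ _) (ev_scale _ _ (pihomogP _ _ _)) mulrC.
Qed.

Lemma hypersurface_scale (K : fieldType) n d t (a : 'rV[K]_#|monomials n d|) : t != 0 ->
  hypersurface (t *: a) = hypersurface a.
Proof.
move=> t0; have fE : form_of_coefs (t *: a) = t *: form_of_coefs a.
  by rewrite /form_of_coefs scaler_sumr; apply: eq_bigr => i _; rewrite mxE scalerA.
rewrite /hypersurface fE; apply/seteqP; split=> x /= [x0]; rewrite /ev mevalZ => fx.
  by split=> //; move/eqP: fx; rewrite mulf_eq0 (negbTE t0) => /eqP.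
by split=> //; rewrite [X in _ * X]fx mulr0.
Qed.

(** Four conditions on the coefficients are multiplied: [c] for osculation, [p] for irreducibility,
    which is primality in a factorial ring, and two pure powers. The power of the last variable
    serves the Nullstellensatz, that of x_1 the monomial count and the restriction to lines. *)
Theorem general_hypersurface (K : numClosedFieldType) (m e : nat) : (1 < m)%N ->
  general (@proj_space _ _) (fun a : 'rV[K]_#|monomials m.+1 e.+3| =>
    exists F : {mpoly K[m.+2]}, [/\ hypersurface a = zeros F,
      F \is e.+3.-homog /\ prime_elt F, F@_(U_(lift ord0 ord0) *+ e.+3) != 0,
      F@_(U_(ord_max) *+ e.+3) != 0 & ~ divides F (osc_det F)]).
Proof.
move=> hm; have mon i : exists j, (U_(i) *+ e.+3)%MM = @mon_at m.+1 e.+3 j.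
  by apply: mon_atP; rewrite mdegMn mdeg1 mul1n.
have [i1 i1E] := mon (lift ord0 ord0); have [i2 i2E] := mon ord_max.
have [c c0 hc] := generic_osc_det K m e.
have [p p0 hp] := generic_irreducible K e.+3 (hm : (3 <= m.+1)%N).
apply: (@general_of_nonvanishing K _ i1 (c * p * ('X_i1 * 'X_i2))).
- by rewrite !mulf_neq0 // -msize_poly_eq0 msizeX mdeg1.
- move=> a _; rewrite /ev !mevalM !mulf_eq0 !mevalXU !negb_or => /andP [/andP [ca pa] /andP [a1 a2]].
  have hF := dhomog_form_of_coefs a; set F := form_of_coefs a in hF *.
  have F1 : F@_(U_(lift ord0 ord0) *+ e.+3) != 0 by rewrite i1E -/(coefs_of F i1) coefs_of_form.
  have F2 : F@_(U_(ord_max) *+ e.+3) != 0 by rewrite i2E -/(coefs_of F i2) coefs_of_form.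
  have F0 : F != 0 by apply: contra_neq F1 => ->; rewrite mcoeff0.
  exists F; split=> //; last exact: hc.
  split=> //; apply: irreducible_prime => //; first exact: factorial_mpoly.
    move=> [v vF]; have v0 : v != 0.
      by apply: contra_eq_neq vF => ->; rewrite mul0r eq_sym oner_neq0.
    have := msizeM v0 F0; rewrite vF msize1 (dhomog_size F0 hF).
    by move: v0; rewrite -msize_poly_eq0; case: (msize v) => // k _ /eqP; rewrite addnS /= addnS.
  apply: hp => //; rewrite (meval_eq (v2 := a 0)) // => i.
  exact: coefs_of_form.
by move=> t a t0 [F [aF hF F1 F2 nD]]; exists F; split=> //; rewrite -aF hypersurface_scale.
Qed.

Theorem proposition4p4 (R : realType) (n d : nat)
    (hn : (3 <= n)%N) (hd : (3 <= d)%N) :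
  general (@proj_space _ _)
    (fun a : 'rV[R[i]]_#|monomials n d| =>
      let C := proper_image (@theta _ n) (conormal (hypersurface a)) in
      [/\ variety C /\ has_dim C (n - 1),
          general C (fun x =>
            smooth_point C x /\ linear_of_dim (osc 2 C x) (2 * n - 2)),
          not_in_hyperplane C &
          proj_equivalent C (osc_dual C)]).
Proof.
case: n hn => // m hm; case: d hd => [|[|[|e]]] // _.
have [U [oU U0 hU]] := general_hypersurface R[i] e hm.
exists U; split=> // a a0 Ua.
have [F [aF [hF pF] F1 F2 nD]] := hU _ a0 Ua.
have hd : (1 < e.+3)%N by [].
have e1 : (m.+1 - 1 = m)%N by rewrite subn1.
have e2 : (2 * m.+1 - 2 = 2 * m)%N by rewrite mulnS addKn.
rewrite e1 e2 aF (proper_image_conormal hd hF pF F1 F2).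
exact: (contact_variety_self_dual (ltnW hm) hd hF pF F1 F2 nD).
Qed.
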